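(* Let $T:\mathcal{C}\to\mathcal{D}$ be a cellular functor between small categories. Let $\mathbf{F}_T:\mathcal{D}\to\mathbf{Cat}$ be the functor $d\mapsto T\downarrow d$. Then the mapping cone of $C_*(T):C_*(\mathcal{C})\to C_*(\mathcal{D})$ is quasi-isomorphic to $C_*(\mathcal{D}-\mathcal{C},\tilde{\mathbf{F}}_T)[1]$. In particular, we have a long exact sequence $$\dots\to H_i(\mathcal{D}-\mathcal{C},\tilde{\mathbf{F}}_T;A)\to H_i(\mathcal{C},A)\to H_i(\mathcal{D},A)\to H_{i-1}(\mathcal{D}-\mathcal{C},\tilde{\mathbf{F}}_T;A)\to\dots$$ for any abelian group $A$.
   Context: A functor $T:\mathcal{C}\to\mathcal{D}$ is called cellular if (1) $T$ is fully faithful and (2) for any object $d$ of $\mathcal{D}$ not in the image of $T$ and any object $c$ of $\mathcal{C}$, $\mathcal{D}(d,T(c))=\emptyset$. $\mathcal{D}-\mathcal{C}$ denotes the full subcategory of $\mathcal{D}$ given by the objects not in the image of $\mathcal{C}$. $T\downarrow d$ is the comma category of pairs $(c,f:T(c)\to d)$; $\mathbf{F}_T$ is restricted to $\mathcal{D}-\mathcal{C}$. Homology of a category $\mathcal{E}$: $C_*(\mathcal{E})$ is the chain complex of the free simplicial abelian group on the nerve of $\mathcal{E}$, and $H_i(\mathcal{E},A)=H_i(C_*(\mathcal{E})\otimes A)$. For a functor $\mathbf{F}:\mathcal{E}\to\mathbf{Cat}$, let $N(\mathcal{E},\mathbf{F})$ be the bisimplicial set with $N_{p,q}(\mathcal{E},\mathbf{F})=\coprod_{d_0\to\dots\to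 d_p}N_q(\mathbf{F}(d_0))$ ($N_q$ being the $q$-simplices of the nerve), and let $C_*(\mathcal{E},\mathbf{F})$ be the chain complex of the free simplicial abelian group on its diagonal. If $\mathbf{F}(d)\ne\emptyset$ for all $d$, put $C_*(\mathcal{E},\tilde{\mathbf{F}};A)=\mathrm{Ker}(C_*(\mathcal{E},\mathbf{F})\to C_*(\mathcal{E}))\otimes A$, the map being induced by $\mathbf{F}\to *$; in general, $C_*(\mathcal{E},\tilde{\mathbf{F}};A)$ denotes the complex $\mathrm{cone}(C_*(\mathcal{E},\mathbf{F})\to C_*(\mathcal{E}))[-1]\otimes A$, which is homotopy equivalent to the former when $\mathbf{F}$ is everywhere nonempty. When $A$ is omitted, $A=\mathbb{Z}$. The shift is normalised by $H_i(C[1])=H_{i-1}(C)$ and $H_i(C[-1])=H_{i+1}(C)$. Finally $H_i(\mathcal{E},\tilde{\mathbf{F}};A)=H_i(C_*(\mathcal{E},\tilde{\mathbf{F}};A))$. *)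

(* Defs.v *)
From HB Require Import structures.
From mathcomp Require Import all_boot all_order all_algebra.
From mathcomp Require Import generic_quotient ring_quotient.
From mathcomp Require Import boolp.
From mathcomp Require Import freeg zify.
From Stdlib Require Import Relation_Operators.

Set Implicit Arguments.
Unset Strict Implicit.
Unset Printing Implicit Defensive.

Import GRing.Theory.
Local Open Scope ring_scope.

#[local] Obligation Tactic := idtac.

Record category := Category {
  ob :> Type;
  hom : ob -> ob -> Type;
  idm : forall x, hom x x;
  comp : forall x y z, hom y z -> hom x y -> hom x z;
  comp1m : forall x y (f : hom x y), comp (idm y) f = f;
  compm1 : forall x y (f : hom x y), comp f (idm x) = f;
  compA : forall x y z t (h : hom z t) (g : hom y z) (f : hom x y),
    comp h (comp g f) = comp (comp h g) f }.

Arguments hom {c} _ _.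
Arguments idm {c} x.
Arguments comp {c x y z} _ _.

Record functor (C D : category) := Functor {
  fob :> C -> D;
  fhom : forall x y, hom x y -> hom (fob x) (fob y);
  fhom1 : forall x, fhom (idm x) = idm (fob x);
  fhomM : forall x y z (g : hom y z) (f : hom x y),
    fhom (comp g f) = comp (fhom g) (fhom f) }.

Arguments fhom {C D} _ {x y} _.

Lemma functor_eq (C D : category) (F G : functor C D) (e : fob F = fob G) :
  (forall x y (f : hom x y),
     ecast h (hom (h x) (h y)) e (fhom F f) = fhom G f) -> F = G.
Proof.
case: F G e => [F0 F1 F2 F3] [G0 G1 G2 G3] /= e; case: _ / e G1 G2 G3 => G1 G2 G3 /= H.
have E : F1 = G1 by do 3 (apply: functional_extensionality_dep => ?).
case: _ / E G2 G3 {H} => G2 G3.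
by rewrite (Prop_irrelevance F2 G2) (Prop_irrelevance F3 G3).
Qed.

Definition functor_id (C : category) : functor C C :=
  @Functor C C id (fun _ _ f => f) (fun _ => erefl) (fun _ _ _ _ _ => erefl).

Program Definition functor_comp (C D E : category) (G : functor D E)
    (F : functor C D) : functor C E :=
  @Functor C E (fun x => G (F x)) (fun _ _ f => fhom G (fhom F f)) _ _.
Next Obligation. by move=> C D E G F x /=; rewrite !fhom1. Qed.
Next Obligation. by move=> C D E G F x y z g f /=; rewrite !fhomM. Qed.

Definition fully_faithful (C D : category) (T : functor C D) :=
  forall x y : C, bijective (@fhom C D T x y).

Definition in_image (C D : category) (T : functor C D) (d : D) :=
  exists c : C, T c = d.

Definition cellular (C D : category) (T : functor C D) :=
  fully_faithful T /\
  forall (d : D) (c : C), ~ in_image T d -> hom d (T c) -> False.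

Program Definition full_subcategory (D : category) (P : D -> Prop) :=
  @Category {d : D | P d} (fun x y => hom (sval x) (sval y))
    (fun x => idm (sval x)) (fun x y z g f => comp g f) _ _ _.
Next Obligation. by move=> *; exact: comp1m. Qed.
Next Obligation. by move=> *; exact: compm1. Qed.
Next Obligation. by move=> *; exact: compA. Qed.

Definition subcategory_incl (D : category) (P : D -> Prop) :
    functor (full_subcategory P) D :=
  @Functor (full_subcategory P) D sval (fun _ _ f => f)
    (fun _ => erefl) (fun _ _ _ _ _ => erefl).

(* D - C, for the image of T on objects, not closed under isomorphism. *)
Definition complement (C D : category) (T : functor C D) : category :=
  full_subcategory (fun d : D => ~ in_image T d).

(* Strict functors from E to the category of small categories. *)
Record cat_functor (E : category) := CatFunctor {
  cfob :> E -> category;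
  cfhom : forall x y, hom x y -> functor (cfob x) (cfob y);
  cfhom1 : forall x, cfhom (idm x) = functor_id (cfob x);
  cfhomM : forall x y z (g : hom y z) (f : hom x y),
    cfhom (comp g f) = functor_comp (cfhom g) (cfhom f) }.

Arguments cfhom {E} _ {x y} _.

Definition cat_functor_comp (B E : category) (F : cat_functor E)
    (G : functor B E) : cat_functor B.
Proof.
refine (@CatFunctor B (fun x => F (G x)) (fun _ _ f => cfhom F (fhom G f)) _ _).
- by move=> x; rewrite fhom1 cfhom1.
- by move=> x y z g f; rewrite fhomM cfhomM.
Defined.

Section Comma.
Variables (C D : category) (T : functor C D).

#[projections(primitive)]
Record comma_ob (d : D) := CommaOb {
  comma_src : C;
  comma_arr : hom (T comma_src) d }.

Definition comma_hom (d : D) (x y : comma_ob d) :=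
  {h : hom (comma_src x) (comma_src y) |
     comp (comma_arr y) (fhom T h) = comma_arr x}.

Lemma comma_hom_eq d (x y : comma_ob d) (f g : comma_hom x y) :
  sval f = sval g -> f = g.
Proof.
case: f g => [f ef] [g eg] /= e; case: _ / e eg => eg.
by rewrite (Prop_irrelevance ef eg).
Qed.

Program Definition comma_id d (x : comma_ob d) : comma_hom x x :=
  exist _ (idm (comma_src x)) _.
Next Obligation. by move=> d x /=; rewrite fhom1 compm1. Qed.

Program Definition comma_comp d (x y z : comma_ob d)
    (g : comma_hom y z) (f : comma_hom x y) : comma_hom x z :=
  exist _ (comp (sval g) (sval f)) _.
Next Obligation.
by move=> d x y z [g eg] [f ef] /=; rewrite fhomM compA eg ef.
Qed.

Program Definition comma (d : D) : category :=
  @Category (comma_ob d) (@comma_hom d) (@comma_id d) (@comma_comp d) _ _ _.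
Next Obligation. by move=> d x y f; apply: comma_hom_eq; exact: comp1m. Qed.
Next Obligation. by move=> d x y f; apply: comma_hom_eq; exact: compm1. Qed.
Next Obligation. by move=> d x y z t h g f; apply: comma_hom_eq; exact: compA. Qed.

Section CommaMap.
Variables (d d' : D) (p : forall c : C, hom (T c) d -> hom (T c) d').
Hypothesis pT : forall (x y : C) (h : hom x y) (f : hom (T y) d),
  comp (p f) (fhom T h) = p (comp f (fhom T h)).

Definition comma_map_ob (x : comma d) : comma d' := CommaOb (p (comma_arr x)).

Program Definition comma_map_hom (x y : comma d) (h : hom x y) :
    hom (comma_map_ob x) (comma_map_ob y) := exist _ (sval h) _.
Next Obligation. by move=> x y [h eh] /=; rewrite pT eh. Qed.

Program Definition comma_map : functor (comma d) (comma d') :=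
  @Functor (comma d) (comma d') comma_map_ob comma_map_hom _ _.
Next Obligation. by move=> x; apply: comma_hom_eq. Qed.
Next Obligation. by move=> x y z k h; apply: comma_hom_eq. Qed.
End CommaMap.

Lemma comma_map_eq d d' (p q : forall c : C, hom (T c) d -> hom (T c) d') pT qT :
  (forall c f, p c f = q c f) -> @comma_map d d' p pT = @comma_map d d' q qT.
Proof.
move=> pq; have {pq} pq : p = q.
  by do 2 (apply: functional_extensionality_dep => ?).
by case: _ / pq qT => qT; rewrite (Prop_irrelevance pT qT).
Qed.

Definition comma_push d d' (g : hom d d') : functor (comma d) (comma d') :=
  @comma_map d d' (fun c f => comp g f)
    (fun _ _ h f => esym (compA g f (fhom T h))).

Program Definition comma_functor : cat_functor D :=
  @CatFunctor D comma comma_push _ _.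
Next Obligation.
move=> d; transitivity (@comma_map d d (fun _ f => f) (fun _ _ _ _ => erefl)).
  by apply: comma_map_eq => c f; exact: comp1m.
refine (@functor_eq _ _ (comma_map _) (functor_id _)
  (erefl (id : comma d -> comma d)) _).
by move=> x y f; apply: comma_hom_eq.
Qed.
Next Obligation.
move=> x y z g f; transitivity (@comma_map x z (fun _ k => comp g (comp f k))
    (fun _ _ h k => etrans (esym (compA g (comp f k) (fhom T h)))
                    (congr1 (comp g) (esym (compA f k (fhom T h)))))).
  by apply: comma_map_eq => c k; rewrite compA.
refine (@functor_eq _ _ (comma_map _)
  (functor_comp (comma_push g) (comma_push f)) erefl _).
by move=> a b h; apply: comma_hom_eq.
Qed.
End Comma.

(* The poset [n] = {0 < ... < n} as a category. *)
Program Definition ordcat (n : nat) : category :=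
  @Category 'I_n.+1 (fun i j => (i <= j)%N) (fun i => leqnn i)
    (fun i j k jk ij => leq_trans ij jk) _ _ _.
Next Obligation. by move=> *; exact: bool_irrelevance. Qed.
Next Obligation. by move=> *; exact: bool_irrelevance. Qed.
Next Obligation. by move=> *; exact: bool_irrelevance. Qed.

(* Functors [m] -> [n] are the monotone maps. *)
Program Definition monotone_functor m n (f : 'I_m.+1 -> 'I_n.+1)
    (fM : forall i j : 'I_m.+1, (i <= j)%N -> (f i <= f j)%N) :
    functor (ordcat m) (ordcat n) :=
  @Functor (ordcat m) (ordcat n) f fM _ _.
Next Obligation. by move=> *; exact: bool_irrelevance. Qed.
Next Obligation. by move=> *; exact: bool_irrelevance. Qed.

Lemma coface_subproof n (k : 'I_n.+2) (i j : 'I_n.+1) :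
  (i <= j)%N -> (fintype.lift k i <= fintype.lift k j)%N.
Proof. by rewrite leq_bump2. Qed.

Definition coface n (k : 'I_n.+2) : functor (ordcat n) (ordcat n.+1) :=
  monotone_functor (@coface_subproof n k).

Definition from0 n (i : ordcat n) : @hom (ordcat n) ord0 i := leq0n i.

Lemma functor_ordcat_eq m n (F G : functor (ordcat m) (ordcat n)) :
  (forall i, F i = G i) -> F = G.
Proof.
move=> FG; have e : fob F = fob G by exact: functional_extensionality_dep.
by apply: (functor_eq (e := e)) => *; exact: bool_irrelevance.
Qed.

Lemma coface_coface n (k k' : 'I_n.+3) (j j' : 'I_n.+2) :
  (j < k)%N -> k' = j :> nat -> j' = k.-1 :> nat ->
  functor_comp (@coface n.+1 k) (coface j) = functor_comp (coface k') (coface j').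
Proof.
move=> jk k'j j'k; apply: functor_ordcat_eq => i; apply: val_inj => /=.
rewrite /bump k'j j'k; lia.
Qed.

Record sset := SSet {
  simplex :> nat -> Type;
  sact : forall m n, functor (ordcat m) (ordcat n) -> simplex n -> simplex m;
  sact1 : forall n (x : simplex n), sact (functor_id _) x = x;
  sactM : forall l m n (a : functor (ordcat m) (ordcat n))
      (b : functor (ordcat l) (ordcat m)) (x : simplex n),
    sact (functor_comp a b) x = sact b (sact a x) }.

Arguments sact {_ m n} _ _.

Record sset_map (X Y : sset) := SSetMap {
  smap :> forall n, X n -> Y n;
  smapP : forall m n (a : functor (ordcat m) (ordcat n)) (x : X n),
    smap (sact a x) = sact a (smap x) }.

Record bisset := BiSSet {
  bisimplex :> nat -> nat -> Type;
  bact : forall m n p q, functor (ordcat m) (ordcat p) ->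
    functor (ordcat n) (ordcat q) -> bisimplex p q -> bisimplex m n;
  bact1 : forall p q (x : bisimplex p q),
    bact (functor_id _) (functor_id _) x = x;
  bactM : forall k l m n p q
      (a : functor (ordcat m) (ordcat p)) (b : functor (ordcat k) (ordcat m))
      (a' : functor (ordcat n) (ordcat q)) (b' : functor (ordcat l) (ordcat n))
      (x : bisimplex p q),
    bact (functor_comp a b) (functor_comp a' b') x = bact b b' (bact a a' x) }.

Arguments bact {_ m n p q} _ _ _.

Definition diagonal (X : bisset) : sset :=
  @SSet (fun n => X n n) (fun _ _ a => bact a a) (fun _ => @bact1 X _ _)
    (fun _ _ _ a b => @bactM X _ _ _ _ _ _ a b a b).

Lemma functor_comp1f C D (F : functor C D) : functor_comp (functor_id D) F = F.
Proof.
exact: (@functor_eq _ _ (functor_comp (functor_id D) F) F erefl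
  (fun _ _ _ => erefl)).
Qed.

Lemma functor_compf1 C D (F : functor C D) : functor_comp F (functor_id C) = F.
Proof.
exact: (@functor_eq _ _ (functor_comp F (functor_id C)) F erefl
  (fun _ _ _ => erefl)).
Qed.

Lemma functor_compA A B C D (H : functor C D) (G : functor B C) (F : functor A B) :
  functor_comp H (functor_comp G F) = functor_comp (functor_comp H G) F.
Proof.
exact: (@functor_eq _ _ (functor_comp H (functor_comp G F))
  (functor_comp (functor_comp H G) F) erefl (fun _ _ _ => erefl)).
Qed.

(* An n-simplex is a string x_0 -> ... -> x_n together with its composites. *)
Definition nerve (E : category) : sset :=
  @SSet (fun n => functor (ordcat n) E) (fun _ _ a x => functor_comp x a)
    (fun _ x => functor_compf1 x)
    (fun _ _ _ a b x => functor_compA x a b).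

Definition nerve_map (C D : category) (T : functor C D) :
    sset_map (nerve C) (nerve D) :=
  @SSetMap (nerve C) (nerve D) (fun _ x => functor_comp T x)
    (fun _ _ a x => functor_compA T x a).

Section Transport.
Variables (E : category) (F : cat_functor E).

(* The (p,q)-simplices are the pairs of a string d_0 -> ... -> d_p in E and of
   a q-simplex of the nerve of F(d_0). *)
#[projections(primitive)]
Record transport_simplex (p q : nat) := TransportSimplex {
  base : nerve E p;
  fibre : nerve (F (base ord0)) q }.

(* Reindexing along a moves the fibre from F(d_0) to F(d_(a 0)). *)
Definition transport_act m n p q (a : functor (ordcat m) (ordcat p))
    (b : functor (ordcat n) (ordcat q)) (x : transport_simplex p q) :
    transport_simplex m n :=
  @TransportSimplex m n (sact a (base x))
    (functor_comp
      (cfhom F (fhom (base x) (from0 (a ord0))))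
      (sact b (fibre x))).

Lemma transport_eq p q (x y : nerve E p) (eo : fob x = fob y)
    (s : nerve (F (x ord0)) q) (t : nerve (F (y ord0)) q) :
  x = y ->
  ecast f (functor (ordcat q) (F (f ord0))) eo s = t ->
  TransportSimplex s = TransportSimplex t.
Proof.
move=> e; case: _ / e eo t => eo t.
by rewrite (Prop_irrelevance eo erefl) /= => ->.
Qed.

Lemma transport_act1 p q (x : transport_simplex p q) :
  transport_act (functor_id _) (functor_id _) x = x.
Proof.
apply: (@transport_eq _ _ (functor_comp (base x) (functor_id _)) (base x) erefl).
  exact: functor_compf1.
rewrite /= (_ : from0 _ = idm (ord0 : ordcat p)); last exact: bool_irrelevance.
by rewrite fhom1 cfhom1 functor_comp1f functor_compf1.
Qed.

Lemma transport_actM k l m n p q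
    (a : functor (ordcat m) (ordcat p)) (b : functor (ordcat k) (ordcat m))
    (a' : functor (ordcat n) (ordcat q)) (b' : functor (ordcat l) (ordcat n))
    (x : transport_simplex p q) :
  transport_act (functor_comp a b) (functor_comp a' b') x
  = transport_act b b' (transport_act a a' x).
Proof.
apply: (@transport_eq _ _ (functor_comp (base x) (functor_comp a b))
  (functor_comp (functor_comp (base x) a) b) erefl).
  exact: functor_compA.
rewrite /= (_ : from0 _ = comp (fhom a (from0 (b ord0))) (from0 (a ord0))); last exact: bool_irrelevance.
by rewrite fhomM cfhomM !functor_compA.
Qed.

Definition transport_nerve : bisset :=
  BiSSet transport_act1 transport_actM.

(* Induced by F -> *, the diagonal of N(E, * ) being the nerve of E. *)
Definition transport_proj : sset_map (diagonal transport_nerve) (nerve E) :=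
  @SSetMap (diagonal transport_nerve) (nerve E) (fun _ x => base x)
    (fun _ _ _ _ => erefl).
End Transport.

Definition free_group (X : Type) : zmodType := {freeg {classic X}}.

Definition gen (X : Type) (x : X) : free_group X := << (x : {classic X}) >>.

Section FreeLift.
Variables (X : Type) (M : zmodType) (f : X -> M).

Definition free_lift (z : free_group X) : M :=
  @fglift int (zmodule M) {classic X} f z.

Lemma free_lift_additive : zmod_morphism free_lift.
Proof.
move=> x y; exact: (@lift_is_additive int {classic X} (zmodule M) f x y).
Qed.

HB.instance Definition _ :=
  GRing.isZmodMorphism.Build (free_group X) M free_lift free_lift_additive.
End FreeLift.

Lemma free_lift_gen (X : Type) (M : zmodType) (f : X -> M) x :
  free_lift f (gen x) = f x.
Proof. by rewrite /free_lift liftU scale1r. Qed.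

Lemma free_group_ext (X : Type) (M : zmodType) (f g : {additive free_group X -> M}) :
  (forall x, f (gen x) = g (gen x)) -> f =1 g.
Proof.
move=> fg z; rewrite -[z]freeg_sumE !raddf_sum; apply: eq_bigr => x _.
by rewrite -[coeff x z]intz -freegU_mulz !raddfMz [f _]fg.
Qed.

Section QuotientLift.
Variables (U V : zmodType) (I : zmodClosed U) (f : {additive U -> V}).

Definition quot_lift (fI : forall x, x \in I -> f x = 0) :
  Quotient.quot I -> V := fun x => f (repr x).

Hypothesis fI : forall x, x \in I -> f x = 0.

Lemma quot_liftE x : quot_lift fI (\pi_(Quotient.quot I)%qT x) = f x.
Proof.
apply/eqP; rewrite -subr_eq0 -raddfB; apply/eqP/fI.
by rewrite Quotient.idealrBE reprK.
Qed.

Lemma quot_lift_additive : zmod_morphism (quot_lift fI).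
Proof.
elim/quotW => x; elim/quotW => y.
by rewrite -raddfB !quot_liftE raddfB.
Qed.

HB.instance Definition _ :=
  GRing.isZmodMorphism.Build (Quotient.quot I) V (quot_lift fI)
    quot_lift_additive.
End QuotientLift.

Section Tensor.
Variables M A : zmodType.

(* M (x) A is the free abelian group on M * A modulo this subgroup. *)
Inductive bilinear_span : free_group (M * A) -> Prop :=
| Bilinear_l m m' a :
    bilinear_span (gen (m + m', a) - gen (m, a) - gen (m', a))
| Bilinear_r m a a' :
    bilinear_span (gen (m, a + a') - gen (m, a) - gen (m, a'))
| Bilinear_0 : bilinear_span 0
| Bilinear_B x y :
    bilinear_span x -> bilinear_span y -> bilinear_span (x - y).

Definition bilinear : {pred free_group (M * A)} :=
  fun x => `[< bilinear_span x >].

Lemma bilinear_zmod : zmod_closed bilinear.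
Proof.
split=> [|x y /asboolP bx /asboolP by_]; apply/asboolP; first exact: Bilinear_0.
exact: Bilinear_B.
Qed.

HB.instance Definition _ :=
  GRing.isZmodClosed.Build (free_group (M * A)) bilinear bilinear_zmod.

Definition tensor : zmodType := Quotient.quot bilinear.

Definition tens (m : M) (a : A) : tensor :=
  (\pi_(Quotient.quot bilinear) (gen (m, a)))%qT.
End Tensor.

Section TensorTheory.
Variables M A : zmodType.

Lemma tensDl (m m' : M) (a : A) : tens (m + m') a = tens m a + tens m' a.
Proof.
rewrite /tens -raddfD; apply/eqP; rewrite -Quotient.idealrBE opprD addrA.
by apply/asboolP; exact: Bilinear_l.
Qed.

Lemma tensDr (m : M) (a a' : A) : tens m (a + a') = tens m a + tens m a'.
Proof.
rewrite /tens -raddfD; apply/eqP; rewrite -Quotient.idealrBE opprD addrA.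
by apply/asboolP; exact: Bilinear_r.
Qed.

Lemma tens0l (a : A) : tens (0 : M) a = 0.
Proof. by apply: (addrI (tens 0 a)); rewrite -tensDl !addr0. Qed.

Lemma tensor_ext (V : zmodType) (f g : {additive tensor M A -> V}) :
  (forall m a, f (tens m a) = g (tens m a)) -> f =1 g.
Proof.
move=> fg; elim/quotW.
pose p : free_group (M * A) -> tensor M A := \pi_(Quotient.quot (@bilinear M A))%qT.
apply: (@free_group_ext _ _ (f \o p) (g \o p)) => -[m a]; exact: fg.
Qed.
End TensorTheory.

Section TensorMap.
Variables (M N A : zmodType) (f : {additive M -> N}).

Definition tensor_map_gen (x : M * A) : tensor N A := tens (f x.1) x.2.

Lemma tensor_map_subproof x :
  x \in @bilinear M A -> free_lift tensor_map_gen x = 0.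
Proof.
move=> /asboolP; elim=> {x} [m m' a|m a a'||x y _ ex _ ey].
- rewrite !raddfB /= !free_lift_gen /tensor_map_gen /= raddfD tensDl.
  by rewrite addrAC addrK subrr.
- rewrite !raddfB /= !free_lift_gen /tensor_map_gen /= tensDr.
  by rewrite addrAC addrK subrr.
- exact: raddf0.
- by rewrite raddfB /= ex ey subr0.
Qed.

Definition tensor_map : {additive tensor M A -> tensor N A} :=
  quot_lift tensor_map_subproof.

Lemma tensor_mapE m a : tensor_map (tens m a) = tens (f m) a.
Proof.
exact: etrans (quot_liftE tensor_map_subproof _) (free_lift_gen _ _).
Qed.
End TensorMap.

(* The differentials are the maps d i (i - 1); indexing them by two degrees,
   with d i j = 0 for j <> i - 1, avoids casts along equalities of degrees. *)
Record complex := Complex {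
  chain :> int -> zmodType;
  diff : forall i j, {additive chain i -> chain j};
  diff_shape : forall i j x, j + 1 <> i -> diff i j x = 0;
  diff_diff : forall i j k x, diff j k (diff i j x) = 0 }.

Record chain_map (C D : complex) := ChainMap {
  cmap :> forall i, {additive C i -> D i};
  cmapP : forall i j x, cmap j (diff C i j x) = diff D i j (cmap i x) }.

Section Kernel.
Variables (V W : zmodType) (g : {additive V -> W}).

Definition in_kernel : {pred V} := fun x => g x == 0.

Lemma in_kernel_zmod : zmod_closed in_kernel.
Proof.
split=> [|x y]; rewrite !unfold_in ?raddf0 // => /eqP ex /eqP ey.
by rewrite raddfB ex ey subr0 eqxx.
Qed.

HB.instance Definition _ := GRing.isZmodClosed.Build V in_kernel in_kernel_zmod.

Record kernel := Kernel { kval : V; kvalP : kval \in in_kernel }.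

HB.instance Definition _ := [isSub for kval].
HB.instance Definition _ := [Choice of kernel by <:].
HB.instance Definition _ := [SubChoice_isSubZmodule of kernel by <:].
End Kernel.

Section Homology.
Variables (C : complex) (i : int).

Definition cycle : zmodType := kernel (diff C i (i - 1)).

Definition boundary : {pred cycle} :=
  fun z => `[< exists x, diff C (i + 1) i x = kval z >].

Lemma boundary_zmod : zmod_closed boundary.
Proof.
split=> [|x y /asboolP[u eu] /asboolP[v ev]]; apply/asboolP.
  by exists 0; rewrite !raddf0.
by exists (u - v); rewrite !raddfB eu ev.
Qed.

HB.instance Definition _ := GRing.isZmodClosed.Build cycle boundary boundary_zmod.

Definition homology : zmodType := Quotient.quot boundary.
End Homology.

Section HomologyMap.
Variables (C D : complex) (f : chain_map C D) (i : int).

Lemma cycle_map_subproof (z : cycle C i) :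
  f i (kval z) \in in_kernel (diff D i (i - 1)).
Proof.
by rewrite unfold_in -cmapP; move/eqP: (kvalP z) => ->; rewrite raddf0.
Qed.

Definition cycle_map (z : cycle C i) : cycle D i := Kernel (cycle_map_subproof z).

Definition cycle_class (z : cycle C i) : homology D i :=
  (\pi_(Quotient.quot (@boundary D i)) (cycle_map z))%qT.

Lemma cycle_class_additive : zmod_morphism cycle_class.
Proof.
move=> x y; rewrite /cycle_class -raddfB; congr (\pi_(_)%qT _).
by apply: val_inj; rewrite /= !raddfB.
Qed.

HB.instance Definition _ :=
  GRing.isZmodMorphism.Build (cycle C i) (homology D i) cycle_class
    cycle_class_additive.

Lemma homology_map_subproof z : z \in @boundary C i -> cycle_class z = 0.
Proof.
move=> /asboolP[x ex]; rewrite /cycle_class -[RHS](raddf0 \pi_(_)%qT).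
apply/eqP; rewrite -Quotient.idealrBE subr0; apply/asboolP.
by exists (f (i + 1) x); rewrite -cmapP ex.
Qed.

Definition homology_map : {additive homology C i -> homology D i} :=
  quot_lift homology_map_subproof.
End HomologyMap.

Definition quasi_iso (C D : complex) (f : chain_map C D) :=
  forall i, bijective (homology_map f i).

(* Zigzags of quasi-isomorphisms. *)
Definition quasi_isomorphic : complex -> complex -> Prop :=
  clos_refl_sym_trans complex
    (fun C D => exists f : chain_map C D, quasi_iso f).

Definition exact (U V W : zmodType) (f : U -> V) (g : V -> W) :=
  forall y, g y = 0 <-> exists x, f x = y.

(* C[k]_i = C_(i-k), so that H_i(C[k]) = H_(i-k)(C). *)
Section Shift.
Variables (k : int) (C : complex).

Definition shift_diff i j (x : C (i - k)) : C (j - k) :=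
  diff C (i - k) (j - k) x *~ ((-1) ^+ `|k|%N).

Lemma shift_diff_additive i j : zmod_morphism (@shift_diff i j).
Proof. by move=> x y; rewrite /shift_diff raddfB mulrzBl. Qed.

HB.instance Definition _ i j :=
  GRing.isZmodMorphism.Build (C (i - k)) (C (j - k)) (@shift_diff i j)
    (@shift_diff_additive i j).

Program Definition shift : complex :=
  @Complex (fun i => C (i - k)) (fun i j => @shift_diff i j) _ _.
Next Obligation.
move=> i j x ij; rewrite /= /shift_diff diff_shape ?mul0rz // => e.
by apply: ij; apply: (addIr (- k)); rewrite addrAC.
Qed.
Next Obligation.
by move=> i j l x; rewrite /= /shift_diff raddfMz diff_diff !mul0rz.
Qed.
End Shift.

Section TensorComplex.
Variables (C : complex) (A : zmodType).

Program Definition tensor_complex : complex :=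
  @Complex (fun i => tensor (C i) A) (fun i j => tensor_map A (diff C i j)) _ _.
Next Obligation.
move=> i j x ij; apply: (@tensor_ext _ _ _ (tensor_map A (diff C i j)) \0) => m a.
by rewrite tensor_mapE diff_shape // tens0l.
Qed.
Next Obligation.
move=> i j k x; apply: (@tensor_ext _ _ _
  (tensor_map A (diff C j k) \o tensor_map A (diff C i j)) \0) => m a.
change (tensor_map A (diff C j k) (tensor_map A (diff C i j) (tens m a)) = 0).
by rewrite !tensor_mapE diff_diff tens0l.
Qed.
End TensorComplex.

Program Definition tensor_chain_map (C D : complex) (f : chain_map C D)
    (A : zmodType) : chain_map (tensor_complex C A) (tensor_complex D A) :=
  @ChainMap (tensor_complex C A) (tensor_complex D A)
    (fun i => tensor_map A (f i)) _.
Next Obligation.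
move=> C D f A i j x; apply: (@tensor_ext _ _ _
  (tensor_map A (f j) \o tensor_map A (diff C i j))
  (tensor_map A (diff D i j) \o tensor_map A (f i))) => m a.
change (tensor_map A (f j) (tensor_map A (diff C i j) (tens m a))
  = tensor_map A (diff D i j) (tensor_map A (f i) (tens m a))).
by rewrite !tensor_mapE cmapP.
Qed.

Section Cone.
Variables (C D : complex) (f : chain_map C D).

Definition degree_cast i j (x : D i) : D j :=
  if eqP is ReflectT e then ecast k (D k) (e : i = j) x else 0.

(* Here degree_cast is the identification D_(i-1) = D_j when j = i - 1, and 0
   for the other j. *)
Definition cone_diff i j (z : D i * C (i - 1)) : D j * C (j - 1) :=
  (diff D i j z.1 + degree_cast j (f (i - 1) z.2), - diff C (i - 1) (j - 1) z.2).

Lemma degree_castB i j (x y : D i) :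
  degree_cast j (x - y) = degree_cast j x - degree_cast j y.
Proof. by rewrite /degree_cast; case: eqP => [e|_]; [case: _ / e | rewrite subr0]. Qed.

Lemma degree_castN i j (x : D i) : degree_cast j (- x) = - degree_cast j x.
Proof.
by rewrite /degree_cast; case: eqP => [e|_]; [case: _ / e | rewrite oppr0].
Qed.

Lemma degree_castC i j k l (x : D i) : l + 1 = j ->
  degree_cast k (diff D i l x) = diff D j k (degree_cast j x).
Proof.
move=> lj; rewrite /degree_cast; case: (i =P j) => [e|ij].
  case: _ / e lj => li; case: eqP => [e|lk]; first by case: _ / e.
  by rewrite diff_shape // => ki; apply: lk; apply: (addIr 1); rewrite li ki.
rewrite raddf0; case: eqP => // e; case: _ / e.
by rewrite diff_shape // lj => /esym.
Qed.

Lemma cone_diff_additive i j : zmod_morphism (@cone_diff i j).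
Proof.
move=> [y x] [y' x']; rewrite /cone_diff /= !raddfB degree_castB.
by congr (_, _); rewrite addrACA -opprD.
Qed.

HB.instance Definition _ i j :=
  GRing.isZmodMorphism.Build (D i * C (i - 1))%type (D j * C (j - 1))%type
    (@cone_diff i j) (@cone_diff_additive i j).

Program Definition cone : complex :=
  @Complex (fun i => (D i * C (i - 1))%type) (fun i j => @cone_diff i j) _ _.
Next Obligation.
move=> i j [y x] ij; have ij' : j - 1 + 1 <> i - 1.
  by rewrite subrK => e; apply: ij; rewrite e subrK.
rewrite /= /cone_diff /= !diff_shape // oppr0 add0r /degree_cast.
by case: eqP => // e; case: ij; rewrite -e subrK.
Qed.
Next Obligation.
move=> i j k [y x]; apply: injective_projections => /=.
  rewrite raddfD diff_diff add0r raddfN degree_castN cmapP.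
  by apply/eqP; rewrite subr_eq0 (@degree_castC (i - 1) j) ?subrK.
by rewrite raddfN diff_diff !oppr0.
Qed.
End Cone.

Lemma alternating_sum0 (V : zmodType) n (G : 'I_n.+2 -> 'I_n.+1 -> V) :
  (forall (k k' : 'I_n.+2) (j j' : 'I_n.+1),
    (j < k)%N -> k' = j :> nat -> j' = k.-1 :> nat -> G k j = G k' j') ->
  \sum_(k < n.+2) \sum_(j < n.+1) G k j *~ ((-1) ^+ (k + j)) = 0.
Proof.
move=> GE; rewrite pair_big /=.
rewrite (bigID (fun p : 'I_n.+2 * 'I_n.+1 => (p.2 < p.1)%N)) /=.
pose h (p : 'I_n.+2 * 'I_n.+1) : 'I_n.+2 * 'I_n.+1 :=
  (inord p.2, inord p.1.-1).
pose h' (p : 'I_n.+2 * 'I_n.+1) : 'I_n.+2 * 'I_n.+1 :=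
  (inord p.2.+1, inord p.1).
rewrite [X in _ + X](reindex_onto h h') /=; last first.
  move=> [k j] /= kj; have := ltn_ord k; have := ltn_ord j => jn kn.
  by congr (_, _); apply: val_inj; rewrite /= !inordK //=; lia.
rewrite [X in _ + X](eq_big (fun p : 'I_n.+2 * 'I_n.+1 => (p.2 < p.1)%N)
  (fun p => - (G p.1 p.2 *~ ((-1) ^+ (p.1 + p.2))))).
- by rewrite sumrN subrr.
- move=> [k j] /=; have := ltn_ord k; have := ltn_ord j => jn kn.
  rewrite xpair_eqE -!val_eqE /= !inordK //; try lia.
move=> [k j] /= /andP[]; have := ltn_ord k; have := ltn_ord j => jn kn.
rewrite xpair_eqE -!val_eqE /= !inordK //; try lia.
move=> jk0 /andP[/eqP e _]; have {e jk0} jk : (j < k)%N by lia.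
rewrite (GE k (inord j) j (inord k.-1)) ?inordK //; try lia.
have [k0 ek] : exists k0, k = k0.+1 :> nat by exists k.-1; lia.
by rewrite ek /= addSn exprS mulN1r mulrNz opprK addnC.
Qed.

Section Chains.
Variable X : sset.

(* No simplices in negative degrees, so that chains vanishes there. *)
Definition simplexz (i : int) : Type := if i is Posz n then X n else void.

Definition simplexz_boundary (i j : int) : simplexz i -> free_group (simplexz j) :=
  match i, j return simplexz i -> free_group (simplexz j) with
  | Posz m, Posz n => fun x =>
      if eqP is ReflectT e then
        \sum_(k < n.+2) gen (sact (coface k) (ecast l (X l) (e : m = n.+1) x))
          *~ ((-1) ^+ k)
      else 0
  | _, _ => fun _ => 0
  end.

#[local] Arguments simplexz_boundary : simpl never.

Lemma simplexz_boundaryS n (x : X n.+1) :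
  @simplexz_boundary n.+1 n x =
  \sum_(k < n.+2) gen (sact (coface k) x : simplexz n) *~ ((-1) ^+ k).
Proof.
rewrite /simplexz_boundary.
by case: eqP => // e; rewrite (eq_irrelevance e erefl).
Qed.

Lemma simplexz_boundary0 i j (x : simplexz i) :
  j + 1 <> i -> simplexz_boundary j x = 0.
Proof.
rewrite /simplexz_boundary.
case: i x => [m|m] x //; case: j => [n|n] //= ij; case: eqP => // e.
by case: ij; rewrite e -addn1 PoszD.
Qed.

Definition chain_diff i j :
    {additive free_group (simplexz i) -> free_group (simplexz j)} :=
  free_lift (@simplexz_boundary i j).

Lemma chain_diff_shape i j x : j + 1 <> i -> chain_diff i j x = 0.
Proof.
move=> ij; apply: (@free_group_ext _ _ (chain_diff i j) \0) => y.
by rewrite /= free_lift_gen simplexz_boundary0.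
Qed.

Lemma chain_diff_diff i j k x : chain_diff j k (chain_diff i j x) = 0.
Proof.
have [jk|/eqP jk] := eqVneq (k + 1) j; last exact: chain_diff_shape.
have [ij|/eqP ij] := eqVneq (j + 1) i; last first.
  by rewrite [chain_diff i j x]chain_diff_shape ?raddf0.
apply: (@free_group_ext _ _ (chain_diff j k \o chain_diff i j) \0) => {}x.
rewrite /= free_lift_gen.
case: k j i x jk ij => [l|l] [n|n] [m|m] x //; try by rewrite raddf0.
- move=> jk ij.
  have en : n = l.+1 by lia.
  have em : m = n.+1 by lia.
  subst n; subst m; rewrite simplexz_boundaryS raddf_sum -[RHS](@alternating_sum0
    _ _ (fun k j => gen (sact (coface j) (sact (coface k) x) : simplexz l))).
    apply: eq_bigr => k _; rewrite raddfMz /= free_lift_gen simplexz_boundaryS.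
    rewrite mulrz_suml; apply: eq_bigr => j _.
    by rewrite -mulrzA -exprD addnC.
  move=> k k' j j' jk' k'j j'k.
  by rewrite -!sactM (coface_coface jk' k'j j'k).
- move=> _ _; rewrite (_ : @simplexz_boundary _ _ = fun _ => 0) //.
  exact: (@free_group_ext _ _ (free_lift (fun _ => 0)) \0) (free_lift_gen _) _.
Qed.

(* The unnormalized complex: degenerate simplices are kept. *)
Definition chains : complex := Complex chain_diff_shape chain_diff_diff.
End Chains.

Definition smapz (X Y : sset) (f : sset_map X Y) (i : int) :
    simplexz X i -> simplexz Y i :=
  if i is Posz n then f n else id.

Program Definition chains_map (X Y : sset) (f : sset_map X Y) :
    chain_map (chains X) (chains Y) :=
  @ChainMap (chains X) (chains Y)
    (fun i => free_lift (fun x => gen (smapz f x))) _.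
Next Obligation.
move=> X Y f i j x; set F := fun i => free_lift (fun x => gen (@smapz X Y f i x)).
apply: (@free_group_ext _ _ (F j \o chain_diff X i j) (chain_diff Y i j \o F i)).
move=> {}x; rewrite /= /F !free_lift_gen.
have [ij|/eqP ij] := eqVneq (j + 1) i; last by rewrite !simplexz_boundary0 ?raddf0.
case: j i x ij {F} => [n|n] [m|m] x //; last by rewrite raddf0.
move=> ij; have em : m = n.+1 by lia.
subst m; rewrite !simplexz_boundaryS raddf_sum; apply: eq_bigr => k _.
by rewrite raddfMz /= free_lift_gen /= smapP.
Qed.

Definition cat_chains (E : category) : complex := chains (nerve E).

Definition cat_chains_map (C D : category) (T : functor C D) :
    chain_map (cat_chains C) (cat_chains D) := chains_map (nerve_map T).

Definition cat_homology (E : category) (A : zmodType) (i : int) : zmodType :=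
  homology (tensor_complex (cat_chains E) A) i.

Definition cat_homology_map (C D : category) (T : functor C D) (A : zmodType)
    (i : int) : {additive cat_homology C A i -> cat_homology D A i} :=
  homology_map (tensor_chain_map (cat_chains_map T) A) i.

Definition functor_chains (E : category) (F : cat_functor E) : complex :=
  chains (diagonal (transport_nerve F)).

Definition functor_chains_map (E : category) (F : cat_functor E) :
    chain_map (functor_chains F) (cat_chains E) := chains_map (transport_proj F).

(* C_*(E, F~; A): the shifted cone of C_*(E, F) -> C_*(E), which makes sense
   without assuming that every F(d) is nonempty. *)
Definition reduced_chains (E : category) (F : cat_functor E) (A : zmodType) :
    complex :=
  tensor_complex (shift (-1) (cone (functor_chains_map F))) A.

Definition reduced_homology (E : category) (F : cat_functor E) (A : zmodType)
    (i : int) : zmodType :=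
  homology (reduced_chains F A) i.

Definition comma_functor_compl (C D : category) (T : functor C D) :
    cat_functor (complement T) :=
  cat_functor_comp (comma_functor T) (subcategory_incl _).

(* Main.v *)
(* Let [P] be the set of objects in the image of [T] and [E] its complement. A
   simplex of the transport is a string [c_0 -> .. -> c_n] in [C] and a string
   [d_0 -> .. -> d_n] in [E], with an arrow [T c_n -> d_0]. The alternating sum of
   the strings [T c_0 -> .. -> T c_k -> d_k -> .. -> d_n] is a homotopy between
   the two maps from the chains of the transport to those of [D], so it defines a
   map from the cone of [C_*(E, F_T) -> C_*(E)] to the cone of [C_*(T)]. This map
   is a quasi-isomorphism, a form of the Eilenberg-Zilber theorem which is proved
   by acyclic models. When [T] is the inclusion of the full subcategory on [P],
   the cone of the map is natural in [(D, P)] and free on the models [[n]], cut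
   anywhere, and [[n] * [n]], cut in the middle; there every category involved is
   empty or has an initial object. In general [C] is equivalent to this full
   subcategory, and the comma categories are equivalent accordingly. The cone of
   the map, being bounded below, free and acyclic, is contractible, so that it
   stays acyclic after tensoring with [A]; the exact sequence is then that of the
   cone of [C_*(T)] tensored with [A]. *)

From HB Require Import structures.
From mathcomp Require Import all_boot all_order all_algebra.
From mathcomp Require Import boolp freeg zify.
From Stdlib Require Import Relation_Operators.
Require Import Defs.

Set Implicit Arguments.
Unset Strict Implicit.
Unset Printing Implicit Defensive.

Import GRing.Theory.
Local Open Scope ring_scope.

(* Morphisms of categories with a cut respect both sides of the cut. This makes the four chain
   groups of the cone of the comparison map functorial, and makes the place where a string crosses
   the cut an invariant, so that every simplex comes from a universal simplex of a model. A simplex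
   of the transport is a single functor out of a join because [T c_n -> d_0] determines all the
   arrows [T c_i -> d_j].

   The contraction found by acyclic models is not carried over to a general [T]: the passage from
   [T] to the full subcategory on its image chooses preimages of objects and is only shown to be a
   quasi-isomorphism. Contractibility of the cone for [T] itself, which is what survives the tensor
   product, is therefore obtained a second time, without naturality, from freeness and boundedness.

   Degrees such as [i - 1 + 1] and [i] are not convertible. To keep casts away, cycles and
   boundaries quantify over all degrees, and homotopies carry two degrees of which only the adjacent
   ones are constrained. *)
#[local] Obligation Tactic := idtac.

(* Reflexive decision of equalities in an abelian group. *)
Inductive zexpr := ZVar of nat | ZZero | ZOpp of zexpr | ZAdd of zexpr & zexpr.

Fixpoint zeval (V : zmodType) (env : seq V) (e : zexpr) : V :=
  match e with
  | ZVar n => env`_n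
  | ZZero => 0
  | ZOpp e => - zeval env e
  | ZAdd e e' => zeval env e + zeval env e'
  end.

Fixpoint zcount (b : bool) (k : nat) (e : zexpr) : nat :=
  match e with
  | ZVar n => b && (n == k)
  | ZZero => 0
  | ZOpp e => zcount (~~ b) k e
  | ZAdd e e' => zcount b k e + zcount b k e'
  end.

Lemma zevalE (V : zmodType) (env : seq V) e :
  zeval env e =
  \sum_(k < size env) (env`_k *+ zcount true k e - env`_k *+ zcount false k e).
Proof.
elim: e => [n||e IH|e IHe e' IHe'] /=.
- have [ns|ns] := ltnP n (size env); last first.
    rewrite nth_default // big1 // => k _.
    by rewrite (gtn_eqF (leq_trans (ltn_ord k) ns)) subr0.
  rewrite (bigD1 (Ordinal ns)) //= eqxx subr0 big1 ?addr0 // => k /eqP kn.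
  by case: eqP => [e|_]; [case: kn; apply: val_inj | rewrite subr0].
- by rewrite big1 // => k _; rewrite subrr.
- by rewrite IH -sumrN; apply: eq_bigr => k _; rewrite opprB.
- rewrite IHe IHe' -big_split; apply: eq_bigr => k _ /=.
  by rewrite !mulrnDr opprD addrACA.
Qed.

(** Occurrences of each atom are counted by sign in [nat], and negative counts are moved across the
    equation, so that the test computes without integers. A variable beyond [env] evaluates to 0. *)
Lemma zeval_eq (V : zmodType) (env : seq V) e e' :
  all (fun k => (zcount true k e + zcount false k e' ==
                 zcount true k e' + zcount false k e)%N) (iota 0 (size env)) ->
  zeval env e = zeval env e'.
Proof.
move=> /allP h; rewrite !zevalE; apply: eq_bigr => k _.
have /h/eqP ek : (k : nat) \in iota 0 (size env) by rewrite mem_iota /=.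
by apply/eqP; rewrite subr_eq addrAC eq_sym subr_eq -!mulrnDr ek.
Qed.

Ltac zmem x env :=
  lazymatch env with
  | [::] => constr:(false)
  | x :: _ => constr:(true)
  | _ :: ?env => zmem x env
  end.

Ltac zindex x env :=
  lazymatch env with
  | x :: _ => constr:(0%N)
  | _ :: ?env => let n := zindex x env in constr:(n.+1)
  end.

Ltac zatoms e env :=
  lazymatch e with
  | (?a + ?b)%R => let env := zatoms a env in zatoms b env
  | (- ?a)%R => zatoms a env
  | (0)%R => env
  | _ => let b := zmem e env in
         lazymatch b with true => env | false => constr:(e :: env) end
  end.

Ltac zquote e env :=
  lazymatch e with
  | (?a + ?b)%R =>
      let a := zquote a env in let b := zquote b env in constr:(ZAdd a b)
  | (- ?a)%R => let a := zquote a env in constr:(ZOpp a)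
  | (0)%R => constr:(ZZero)
  | _ => let n := zindex e env in constr:(ZVar n)
  end.

Ltac zmod := cbv beta;
  lazymatch goal with
  | |- @eq ?V ?a ?b =>
    let env := zatoms a (@nil V) in
    let env := zatoms b env in
    let ea := zquote a env in
    let eb := zquote b env in
    refine (@zeval_eq _ env ea eb _); vm_compute; reflexivity
  end.

(** * Homological algebra on elements *)

Section CyclesBoundaries.
Variable X : complex.

(** All target degrees are allowed here, and all source degrees in [bdr]: by [diff_shape] only the
    adjacent one matters, and no cast of degrees appears. *)
Definition cyc i (z : X i) := forall j, diff X i j z = 0.

Definition bdr i (z : X i) := exists j (x : X j), diff X j i x = z.

Lemma cycP i (z : X i) : diff X i (i - 1) z = 0 <-> cyc z.
Proof.
split=> [dz j|]; last exact.
have [ij|/eqP ij] := eqVneq (j + 1) i; last exact: diff_shape.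
by rewrite (_ : j = i - 1) // -ij addrK.
Qed.

Lemma bdrP i (z : X i) : bdr z <-> exists x, diff X (i + 1) i x = z.
Proof.
split=> [[j [x dx]]|[x dx]]; last by exists (i + 1), x.
have [ij|/eqP ij] := eqVneq (i + 1) j; first by subst j; exists x.
by exists 0; rewrite raddf0 -dx diff_shape.
Qed.

Lemma bdr_diff i j (x : X i) : bdr (diff X i j x).
Proof. by exists i, x. Qed.

Lemma cyc0 i : cyc (0 : X i).
Proof. by move=> j; rewrite raddf0. Qed.

Lemma bdr0 i : bdr (0 : X i).
Proof. by exists i, 0; rewrite raddf0. Qed.

Lemma cycD i (z w : X i) : cyc z -> cyc w -> cyc (z + w).
Proof. by move=> cz cw j; rewrite raddfD cz cw addr0. Qed.

Lemma cycN i (z : X i) : cyc z -> cyc (- z).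
Proof. by move=> cz j; rewrite raddfN cz oppr0. Qed.

Lemma bdrD i (z w : X i) : bdr z -> bdr w -> bdr (z + w).
Proof.
move=> /bdrP[x <-] /bdrP[y <-]; apply/bdrP; exists (x + y).
by rewrite raddfD.
Qed.

Lemma bdrN i (z : X i) : bdr z -> bdr (- z).
Proof. by move=> /bdrP[x <-]; apply/bdrP; exists (- x); rewrite raddfN. Qed.

Lemma bdrB i (z w : X i) : bdr z -> bdr w -> bdr (z - w).
Proof. by move=> bz bw; apply: bdrD bz (bdrN bw). Qed.

Lemma bdr_eq i (z w : X i) : bdr (z - w) -> bdr w -> bdr z.
Proof. by move=> bzw bw; rewrite -(subrK w z); apply: bdrD. Qed.

Definition acyclic := forall i (z : X i), cyc z -> bdr z.
End CyclesBoundaries.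

(** Injectivity and surjectivity on homology, phrased on elements; [qis_quasi_iso] passes to the
    quotients. *)
Definition qis (X Y : complex) (f : chain_map X Y) :=
  (forall i (z : X i), cyc z -> bdr (f i z) -> bdr z) /\
  (forall i (y : Y i), cyc y -> exists z : X i, cyc z /\ bdr (f i z - y)).

Section ChainMap.
Variables (X Y : complex).

Lemma cyc_map (f : chain_map X Y) i (z : X i) : cyc z -> cyc (f i z).
Proof. by move=> cz j; rewrite -cmapP cz raddf0. Qed.

Lemma bdr_map (f : chain_map X Y) i (z : X i) : bdr z -> bdr (f i z).
Proof. by move=> [j [x <-]]; exists j, (f j x); rewrite -cmapP. Qed.

Lemma qis_bij (f : chain_map X Y) : (forall i, bijective (f i)) -> qis f.
Proof.
move=> fb; have fi i := bij_inj (fb i); split=> i.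
  move=> z cz [j [y dy]]; exists j; have [g fK gK] := fb j; exists (g y).
  by apply: fi; rewrite cmapP gK.
move=> y cy; have [g fK gK] := fb i; exists (g y); split.
  by move=> j; apply: fi; rewrite cmapP gK cy raddf0.
by rewrite gK subrr; apply: bdr0.
Qed.

Lemma qis_acyclic (f : chain_map X Y) : acyclic X -> acyclic Y -> qis f.
Proof.
move=> aX aY; split=> i z cz; first by move=> _; apply: aX.
exists 0; split; first exact: cyc0.
by rewrite raddf0 add0r; apply/bdrN/aY.
Qed.

End ChainMap.

Section Composition.
Variables (X Y Z : complex).

Definition chain_comp (g : chain_map Y Z) (f : chain_map X Y) : chain_map X Z.
Proof.
refine (@ChainMap X Z (fun i => (g i \o f i : {additive X i -> Z i})) _).
by move=> i j x; rewrite /= !cmapP.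
Defined.

Lemma qis_comp (f : chain_map X Y) (g : chain_map Y Z) (h : chain_map X Z) :
  (forall i x, h i x = g i (f i x)) -> qis f -> qis g -> qis h.
Proof.
move=> hE [fi fs] [gi gs]; split=> i.
  by move=> z cz; rewrite hE => /(gi _ _ (cyc_map _ cz)); apply: fi.
move=> z cz; have [y [cy by_]] := gs i z cz; have [x [cx bx]] := fs i y cy.
exists x; split=> //; rewrite hE.
have -> : g i (f i x) - z = g i (f i x - y) + (g i y - z).
  by rewrite raddfB; zmod.
exact: bdrD (bdr_map _ bx) by_.
Qed.

Lemma qis_right (f : chain_map X Y) (g : chain_map Y Z) (h : chain_map X Z) :
  (forall i x, h i x = g i (f i x)) -> qis h -> qis g -> qis f.
Proof.
move=> hE [hi hs] [gi gs]; split=> i.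
  by move=> z cz bz; apply: hi => //; rewrite hE; apply: bdr_map.
move=> y cy; have [x [cx bx]] := hs i _ (cyc_map g cy).
exists x; split=> //; apply: gi; last by rewrite raddfB -hE.
exact: cycD (cyc_map _ cx) (cycN cy).
Qed.

End Composition.

(** The composites are separate arguments, so that each can be given in the form for which a
    homotopy to the identity is known. *)
Lemma qis_inverse (X Y : complex) (f : chain_map X Y) (g : chain_map Y X)
    (gf : chain_map X X) (fg : chain_map Y Y) :
  (forall i x, gf i x = g i (f i x)) -> (forall i y, fg i y = f i (g i y)) ->
  (forall i (x : X i), cyc x -> bdr (gf i x - x)) ->
  (forall i (y : Y i), cyc y -> bdr (fg i y - y)) -> qis f.
Proof.
move=> gfE fgE gf1 fg1; split=> i.
  move=> z cz bfz; rewrite -[z](subKr (gf i z)).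
  by apply: bdrB (gf1 _ _ cz); rewrite gfE; apply: bdr_map.
move=> y cy; exists (g i y); split; first exact: cyc_map.
by rewrite -fgE; apply: fg1.
Qed.

(** * Casts between degrees, mapping cones, and maps between cones *)

HB.instance Definition _ (D : complex) i j :=
  GRing.isZmodMorphism.Build (D i) (D j) (@degree_cast D i j)
    (@degree_castB D i j).

Lemma degree_cast_id (D : complex) i (x : D i) : degree_cast i x = x.
Proof. by rewrite /degree_cast; case: eqP => // e; rewrite (eq_irrelevance e erefl). Qed.

Lemma degree_castK (D : complex) i j (x : D i) :
  i = j -> degree_cast i (degree_cast j x) = x.
Proof. by move=> e; subst j; rewrite !degree_cast_id. Qed.

Lemma degree_cast_map (X Y : complex) (f : chain_map X Y) i j (x : X i) :
  f j (degree_cast j x) = degree_cast j (f i x).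
Proof.
by rewrite /degree_cast; case: eqP => [e|_]; [case: _ / e | rewrite raddf0].
Qed.

Lemma cyc_cast (D : complex) i j (x : D i) : cyc x -> cyc (degree_cast j x).
Proof.
have [ij|/eqP ij] := eqVneq i j; first by subst j; rewrite degree_cast_id.
by move=> _; rewrite /degree_cast; case: eqP => // _; apply: cyc0.
Qed.

Lemma bdr_cast (D : complex) i j (x : D i) : bdr x -> bdr (degree_cast j x).
Proof.
have [ij|/eqP ij] := eqVneq i j; first by subst j; rewrite degree_cast_id.
by move=> _; rewrite /degree_cast; case: eqP => // _; apply: bdr0.
Qed.

Lemma diff_castl (D : complex) i j k (x : D i) :
  i = j -> diff D j k (degree_cast j x) = diff D i k x.
Proof. by move=> e; subst j; rewrite degree_cast_id. Qed.

Section ConeElements.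
Variables (X Y : complex) (f : chain_map X Y).

Lemma cone_cycP i (y : Y i) (x : X (i - 1)) :
  cyc ((y, x) : cone f i) <->
  diff Y i (i - 1) y + f (i - 1) x = 0 /\ cyc x.
Proof.
split=> [/cycP|[dy cx]].
  rewrite /= /cone_diff /= degree_cast_id => -[].
  by move=> dy /eqP; rewrite oppr_eq0 => /eqP dx; split=> //; apply/cycP.
by apply/cycP; rewrite /= /cone_diff /= degree_cast_id dy cx oppr0.
Qed.

(** The component [x'] is taken in degree [i] instead of [i + 1 - 1]; the cast is absorbed here once
    and for all. *)
Lemma cone_bdrP i (y : Y i) (x : X (i - 1)) :
  bdr ((y, x) : cone f i) <->
  exists (y' : Y (i + 1)) (x' : X i),
    diff Y (i + 1) i y' + f i x' = y /\ - diff X i (i - 1) x' = x.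
Proof.
split=> [/bdrP[[y' x']]|[y' [x' [dy dx]]]].
  rewrite /= /cone_diff /= => -[dy dx]; exists y', (degree_cast i x').
  by rewrite degree_cast_map dy diff_castl ?addrK.
apply/bdrP; exists (y', degree_cast (i + 1 - 1) x').
rewrite /= /cone_diff /= -degree_cast_map degree_castK ?addrK //.
by rewrite diff_castl ?addrK // dy dx.
Qed.

(** The exact sequence of the cone, on elements. A cycle [(y, x)] satisfies [f x = - d y], so
    injectivity makes [x] a boundary and surjectivity then corrects [y]. Conversely, a cycle killed
    by [f] extends to a cycle of the cone, and a cycle [y] gives the cycle [(y, 0)]; primitives of
    these yield the two halves of [qis]. *)
Lemma qis_coneP : acyclic (cone f) <-> qis f.
Proof.
split=> [af|[fi fs] i [y x] /cone_cycP[dy cx]].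
  split=> i.
    move=> z cz /bdrP[y dy].
    have e : (i + 1 - 1 = i)%R by rewrite addrK.
    have : cyc ((- y, degree_cast (i + 1 - 1) z) : cone f (i + 1)).
      apply/cone_cycP; split; last exact: cyc_cast.
      rewrite degree_cast_map raddfN -dy.
      by rewrite (@degree_castC _ (i + 1) (i + 1)) // degree_cast_id addNr.
    move=> /af/cone_bdrP[y' [x' [_ dx']]].
    by rewrite -[z](degree_castK _ (esym e)) -dx'; apply/bdr_cast/bdrN/bdr_diff.
  move=> y cy; have : cyc ((y, 0) : cone f i).
    by apply/cone_cycP; split; rewrite ?cy ?raddf0 ?addr0 //; apply: cyc0.
  move=> /af/cone_bdrP[y' [x' [dy dx]]]; exists x'; split.
    by apply/cycP; apply/eqP; rewrite -oppr_eq0 dx.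
  by rewrite -dy opprD addrCA subrr addr0; apply/bdrN/bdr_diff.
have [x1 dx1] : exists x1 : X i, diff X i (i - 1) x1 = x.
  have /bdrP[x1 dx1] : bdr x.
    apply: fi => //; have -> : f (i - 1) x = - diff Y i (i - 1) y.
      by rewrite -(addr0_eq dy).
    exact/bdrN/bdr_diff.
  exists (degree_cast i x1).
  by rewrite diff_castl ?subrK.
have cy : cyc (y + f i x1) by apply/cycP; rewrite raddfD -cmapP dx1.
have [z [cz /bdrP[y2 dy2]]] := fs _ _ cy.
apply/cone_bdrP; exists (- y2), (z - x1); split.
  by rewrite raddfN dy2 (raddfB (f i)); zmod.
by rewrite raddfB (cz (i - 1)) sub0r opprK.
Qed.
End ConeElements.

Section LaxCone.
Variables (X Y X' Y' : complex) (f : chain_map X Y) (f' : chain_map X' Y').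
Variables (a : chain_map X X') (b : chain_map Y Y').
Variable s : forall i j, {additive X i -> Y' j}.
Hypothesis sP : forall i j k (x : X i), j = i + 1 -> i = k + 1 ->
  b i (f i x) - f' i (a i x) = diff Y' j i (s i j x) + s k i (diff X i k x).

(** A square that commutes up to the homotopy [s] still induces a map of cones, [s] being the
    off-diagonal term. *)
Definition lax_cone_fun i (z : cone f i) : cone f' i :=
  (b i z.1 + s (i - 1) i z.2, a (i - 1) z.2).

Lemma lax_cone_additive i : zmod_morphism (@lax_cone_fun i).
Proof.
move=> [y x] [y' x']; rewrite /lax_cone_fun /= !raddfB.
by congr (_, _); rewrite addrACA -opprD.
Qed.

HB.instance Definition _ i :=
  GRing.isZmodMorphism.Build (cone f i) (cone f' i) (@lax_cone_fun i)
    (@lax_cone_additive i).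

Lemma lax_cone_proof i j (z : cone f i) :
  lax_cone_fun (diff (cone f) i j z) = diff (cone f') i j (lax_cone_fun z).
Proof.
have [ij|/eqP ij] := eqVneq (j + 1) i; last by rewrite !diff_shape ?raddf0.
case: z => [y x]; have {ij} ij : j = i - 1 by rewrite -ij addrK.
subst j; rewrite /= /lax_cone_fun /cone_diff /=; apply: injective_projections => /=.
  rewrite !degree_cast_id !raddfD /= !cmapP raddfN.
  have /(canRL (subrK _)) -> : b (i - 1) (f (i - 1) x) - f' (i - 1) (a (i - 1) x) = _
    := @sP (i - 1) i (i - 1 - 1) x (esym (subrK _ _)) (esym (subrK _ _)).
  by zmod.
by rewrite raddfN cmapP.
Qed.

Definition lax_cone : chain_map (cone f) (cone f') :=
  ChainMap lax_cone_proof.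

(** Five lemma on elements: in both halves the component in [X] is treated first, through [a], and
    the one in [Y] afterwards, through [b]. By [sb], the square commutes on cycles up to
    boundaries. *)
Lemma qis_lax_cone : qis a -> qis b -> qis lax_cone.
Proof.
move=> [ai as_] [bi bs].
have sb i (z : X i) : cyc z -> bdr (b i (f i z) - f' i (a i z)).
  move=> cz; rewrite (@sP _ (i + 1) (i - 1)) ?subrK // cz raddf0 addr0.
  exact: bdr_diff.
split=> i [y x].
  move=> /cone_cycP[dy cx] /cone_bdrP[y' [x' /= [e1 e2]]].
  have [x1 dx1] : exists x1 : X i, - diff X i (i - 1) x1 = x.
    have /bdrP[x1 dx1] : bdr x.
      by apply: ai => //; rewrite -e2; apply/bdrN/bdr_diff.
    by exists (- degree_cast i x1); rewrite raddfN opprK diff_castl ?subrK.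
  have cy1 : cyc (y - f i x1).
    by apply/cycP; rewrite raddfB -cmapP -raddfN dx1 in dy *.
  have cx3 : cyc (x' - a i x1).
    apply/cycP; rewrite raddfB -cmapP -[diff X' _ _ x']opprK e2 /= -dx1.
    by rewrite (raddfN (a (i - 1))) opprK subrr.
  (* The primitive [x1] may be changed by a cycle; the right choice is [x1 + x2], which [a] sends to
     [x'] up to a boundary. *)
  have [x2 [cx2 bx2]] := as_ _ _ cx3.
  have /bdrP[w dw] : bdr (y - f i x1 - f i x2).
    apply: bi; first exact: cycD cy1 (cycN (cyc_map f cx2)).
    have -> : b i (y - f i x1 - f i x2) = diff Y' (i + 1) i (y' - s i (i + 1) x1)
        - f' i (a i x2 - (x' - a i x1)) - (b i (f i x2) - f' i (a i x2)).
      rewrite !raddfB /= -[diff _ _ _ y'](addrK (f' i x')) e1 -dx1 raddfN.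
      have /(canRL (subrK _)) -> : b i (f i x1) - f' i (a i x1) = _
        := @sP i (i + 1) (i - 1) x1 erefl (esym (subrK _ _)).
      by zmod.
    by apply: bdrB (sb _ _ cx2); apply: bdrB (bdr_map _ bx2); exact: bdr_diff.
  apply/cone_bdrP; exists w, (x1 + x2); split.
    by rewrite dw raddfD; zmod.
  by rewrite raddfD (cx2 (i - 1)) addr0.
move=> /cone_cycP[dy cx].
have [x2 [cx2 /bdrP[u du]]] := as_ _ _ cx.
have [y1 dy1] : exists y1 : Y i, diff Y i (i - 1) y1 = - f (i - 1) x2.
  have /bdrP[y1 dy1] : bdr (f (i - 1) x2).
    apply: bi; first exact: cyc_map.
    apply: (bdr_eq (sb _ _ cx2)); rewrite -[a _ x2](subrK x) raddfD -du.
    apply: bdrD; first by rewrite cmapP; exact: bdr_diff.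
    rewrite -(addr0_eq dy); exact/bdrN/bdr_diff.
  by exists (- degree_cast i y1); rewrite raddfN diff_castl ?subrK ?dy1.
(* The difference of [(y, x)] and the image of [(y1, x2)] is [(y2, 0)] plus the boundary of
   [(0, u)]. *)
pose y2 := y - b i y1 - s (i - 1) i x2 - f' i (degree_cast i u).
have cy2 : cyc y2.
  apply/cycP; rewrite /y2 !raddfB /= -!cmapP dy1 raddfN.
  rewrite diff_castl ?subrK // du raddfB.
  have /(canRL (subrK _)) -> : b (i - 1) (f (i - 1) x2) - f' (i - 1) (a (i - 1) x2) = _
    := @sP (i - 1) i (i - 1 - 1) x2 (esym (subrK _ _)) (esym (subrK _ _)).
  rewrite (cx2 (i - 1 - 1)) raddf0 /= -(addr0_eq dy).
  by zmod.
have [y3 [cy3 /bdrP[w dw]]] := bs _ _ cy2.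
exists (y1 + y3, x2); split.
  apply/cone_cycP; split=> //.
  by rewrite raddfD dy1 (cy3 (i - 1)) addr0 addNr.
apply/cone_bdrP; exists w, (- degree_cast i u); split.
  by rewrite dw /y2 (raddfN (f' i)) /= (raddfD (b i)); zmod.
by rewrite raddfN opprK diff_castl ?subrK // du.
Qed.
End LaxCone.

Section ConeMap.
Variables (X Y X' Y' : complex) (f : chain_map X Y) (f' : chain_map X' Y').
Variables (a : chain_map X X') (b : chain_map Y Y').
Hypothesis bf : forall i x, b i (f i x) = f' i (a i x).

Lemma cone_map_proof i j k (x : X i) : j = i + 1 -> i = k + 1 ->
  b i (f i x) - f' i (a i x) =
  diff Y' j i ((\0 : {additive X i -> Y' j}) x)
  + (\0 : {additive X k -> Y' i}) (diff X i k x).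
Proof. by rewrite bf subrr raddf0 addr0. Qed.

Definition cone_map : chain_map (cone f) (cone f') :=
  @lax_cone _ _ _ _ f f' a b (fun _ _ => \0) cone_map_proof.

Lemma cone_mapE i (z : cone f i) : cone_map i z = (b i z.1, a (i - 1) z.2).
Proof. by rewrite /= /lax_cone_fun /= addr0. Qed.
End ConeMap.

(** * Simplicial homotopies *)

Lemma degen_subproof n k (i j : 'I_n.+2) : (i <= j)%N ->
  ((inord (minn n (i - (k < i))) : 'I_n.+1) <=
   (inord (minn n (j - (k < j))) : 'I_n.+1))%N.
Proof. by move=> ij; rewrite !inordK; lia. Qed.

(* The [k]-th codegeneracy; [minn] only matters in the meaningless case [k > n]. *)
Definition degen n (k : nat) : functor (ordcat n.+1) (ordcat n) :=
  monotone_functor (@degen_subproof n k).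

Lemma step_subproof n k (i j : 'I_n.+1) : (i <= j)%N ->
  ((inord (k <= i) : 'I_2) <= (inord (k <= j) : 'I_2))%N.
Proof. by move=> ij; rewrite !inordK; lia. Qed.

(** The ends of a homotopy are the extreme cases: [k = 0] gives the constant 1 and [k = n.+1] the
    constant 0. *)
Definition step n (k : nat) : functor (ordcat n) (ordcat 1) :=
  monotone_functor (@step_subproof n k).

(* A map [X x Delta^1 -> Y]. *)
Record shomotopy (X Y : sset) := SHomotopy {
  shom :> forall n, X n -> functor (ordcat n) (ordcat 1) -> Y n;
  shomP : forall m n (a : functor (ordcat m) (ordcat n)) x t,
    @shom m (sact a x) (functor_comp t a) = sact a (@shom n x t) }.

Section Prism.
Variables (X Y : sset) (H : shomotopy X Y).

(** The [k]-th simplex of the usual triangulation of the prism: vertex [k] is doubled, and the level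
    jumps from 0 to 1 between its two copies. *)
Definition prism_simplex n k (x : X n) : Y n.+1 :=
  H n.+1 (sact (degen n k) x) (step n.+1 k.+1).

Lemma prism_face_lt n (k : nat) (j : 'I_n.+3) (x : X n.+1) :
  (j < k < n.+2)%N ->
  sact (coface j) (prism_simplex k x) =
  prism_simplex k.-1 (sact (coface (inord j : 'I_n.+2)) x).
Proof.
move=> jk; rewrite /prism_simplex -shomP -!sactM; congr (shom _ (sact _ x) _).
  apply: functor_ordcat_eq => i; apply: val_inj; have := ltn_ord i => ilt.
  by rewrite /= /bump /= !inordK; lia.
apply: functor_ordcat_eq => i; apply: val_inj.
by rewrite /= /bump /= !inordK; lia.
Qed.

Lemma prism_face_gt n (k : nat) (j : 'I_n.+3) (x : X n.+1) :
  (k.+1 < j)%N ->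
  sact (coface j) (prism_simplex k x) =
  prism_simplex k (sact (coface (inord j.-1 : 'I_n.+2)) x).
Proof.
move=> jk; rewrite /prism_simplex -shomP -!sactM; congr (shom _ (sact _ x) _).
  apply: functor_ordcat_eq => i; apply: val_inj; have := ltn_ord i => ilt.
  by have jlt := ltn_ord j; rewrite /= /bump /= !inordK; lia.
apply: functor_ordcat_eq => i; apply: val_inj.
by rewrite /= /bump /= !inordK; lia.
Qed.

(** Removing either copy of the doubled vertex leaves a face that depends on [j] alone. Consecutive
    simplices of the prism therefore share a face, and these faces telescope. *)
Lemma prism_face_eq n (k : nat) (j : 'I_n.+2) (x : X n) :
  (k <= j <= k.+1)%N -> (k <= n)%N ->
  sact (coface j) (prism_simplex k x) = H n x (step n j).
Proof.
move=> jk kn; rewrite /prism_simplex -shomP -[in RHS](sact1 x) -!sactM.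
congr (shom _ (sact _ x) _).
  apply: functor_ordcat_eq => i; apply: val_inj; have := ltn_ord i => ilt.
  by have jlt := ltn_ord j; rewrite /= /bump /= !inordK; lia.
apply: functor_ordcat_eq => i; apply: val_inj.
by rewrite /= /bump /= !inordK; lia.
Qed.
End Prism.

(** The signs of the prism formula, in the abstract: [D k j] is the [j]-th face of the [k]-th prism
    simplex, [G k j] the [k]-th prism simplex over the [j]-th face, [E] the shared faces. The two
    diagonals of [D] telescope; the rest cancels against [G]. *)
Lemma prism_sum (V : zmodType) n (D G : nat -> nat -> V) (E : nat -> V) :
  (forall k j, (j < k < n.+1)%N -> D k j = G k.-1 j) ->
  (forall k j, (k.+1 < j < n.+2)%N -> D k j = G k j.-1) ->
  (forall k, (k < n.+1)%N -> D k k = E k /\ D k k.+1 = E k.+1) ->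
  \sum_(0 <= k < n.+1) \sum_(0 <= j < n.+2) D k j *~ ((-1) ^+ (k + j)) +
  \sum_(0 <= j < n.+1) \sum_(0 <= k < n) G k j *~ ((-1) ^+ (k + j)) =
  E 0%N - E n.+1.
Proof.
move=> Dlt Dgt Deq.
pose e (k j : nat) : int := (-1) ^+ (k + j).
have eS k j : e k.+1 j = - e k j by rewrite /e addSn exprS mulN1r.
have eS' k j : e k j.+1 = - e k j by rewrite /e addnS exprS mulN1r.
have kk k : e k k = 1 by rewrite /e addnn -mul2n exprM sqrrN expr1n.
have -> : \sum_(0 <= k < n.+1) \sum_(0 <= j < n.+2) D k j *~ e k j =
    \sum_(0 <= k < n.+1) \sum_(0 <= j < k) D k j *~ e k j +
    \sum_(0 <= k < n.+1) (E k - E k.+1) +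
    \sum_(0 <= k < n.+1) \sum_(k.+2 <= j < n.+2) D k j *~ e k j.
  rewrite -!big_split /=; apply: eq_big_nat => k /andP[_ kn].
  rewrite (big_cat_nat (n := k)) //=; last lia.
  rewrite -addrA; congr (_ + _).
  rewrite big_ltn; last lia.
  rewrite big_ltn; last lia.
  have [-> ->] := Deq k kn.
  by rewrite addrA eS' kk mulrNz !mulr1z.
have -> : \sum_(0 <= k < n.+1) (E k - E k.+1) = E 0%N - E n.+1.
  have <- : - E n.+1 - - E 0%N = E 0%N - E n.+1 by zmod.
  rewrite -(telescope_sumr (fun k => - E k)) //.
  by apply: eq_bigr => k _; zmod.
suff -> : \sum_(0 <= j < n.+1) \sum_(0 <= k < n) G k j *~ e k j =
   - \sum_(0 <= k < n.+1) \sum_(0 <= j < k) D k j *~ e k j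
   - \sum_(0 <= k < n.+1) \sum_(k.+2 <= j < n.+2) D k j *~ e k j.
  by zmod.
(* Row [k = 0] has no [j < k], and row [k = n] has no [j > k + 1]; without these empty rows, both
   sums have [n] rows like the sum of [G]. *)
rewrite exchange_big_nat /= [X in - X - _]big_nat_recl // [X in - (X + _)]big_geq // add0r.
rewrite [X in _ - X]big_nat_recr //= [X in _ - (_ + X)]big_geq // addr0.
rewrite -!sumrN -big_split /=; apply: eq_big_nat => k kn.
rewrite (big_cat_nat (n := k.+1)) //=; last lia.
congr (_ + _); rewrite -sumrN.
  apply: eq_big_nat => j jk; rewrite eS mulrNz opprK Dlt //; lia.
rewrite [in RHS]big_add1 /=; apply: eq_big_nat => j jk.
by rewrite eS' mulrNz opprK Dgt //; lia.
Qed.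

Section PrismOperator.
Variables (X Y : sset) (H : shomotopy X Y).

Definition prism_gen (i j : int) : simplexz X i -> free_group (simplexz Y j) :=
  match i, j return simplexz X i -> free_group (simplexz Y j) with
  | Posz m, Posz n => fun x =>
      if eqP is ReflectT e then
        \sum_(k < m.+1) gen (ecast l (Y l) (e : m.+1 = n) (prism_simplex H k x))
          *~ ((-1) ^+ k)
      else 0
  | _, _ => fun _ => 0
  end.

Definition prism i j : {additive chains X i -> chains Y j} :=
  free_lift (@prism_gen i j).

Lemma prism_genS n (x : X n) :
  @prism_gen n n.+1 x =
  \sum_(k < n.+1) gen (prism_simplex H k x : simplexz Y n.+1) *~ ((-1) ^+ k).
Proof.
rewrite /prism_gen.
by case: eqP => // e; rewrite (eq_irrelevance e erefl).
Qed.

Lemma chains_mapE (Z W : sset) (u : sset_map Z W) i (x : simplexz Z i) :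
  chains_map u i (gen x) = gen (smapz u x).
Proof. exact: free_lift_gen. Qed.

Lemma chains_diffE (Z : sset) i j (x : simplexz Z i) :
  diff (chains Z) i j (gen x) = simplexz_boundary j x.
Proof. exact: free_lift_gen. Qed.

Lemma prismE i j (x : simplexz X i) : prism i j (gen x) = prism_gen j x.
Proof. exact: free_lift_gen. Qed.

Variables (f g : sset_map X Y).
Hypothesis fE : forall n x, f n x = H n x (step n 0).
Hypothesis gE : forall n x, g n x = H n x (step n n.+1).

Lemma prismP i j k (x : chains X i) : j = i + 1 -> i = k + 1 ->
  chains_map f i x - chains_map g i x =
  diff (chains Y) j i (prism i j x) + prism k i (diff (chains X) i k x).
Proof.
move=> ji ik.
apply: (@free_group_ext _ _ (chains_map f i \- chains_map g i)
  ((diff (chains Y) j i \o prism i j) \+ (prism k i \o diff (chains X) i k))).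
move=> {}x /=; rewrite !chains_mapE chains_diffE prismE.
case: i j x ji ik => [n|n] // [m|m] x ji; last by exfalso; lia.
have {}ji : m = n.+1 by lia.
subst m; rewrite prism_genS raddf_sum.
pose D h j := gen (sact (coface (inord j)) (prism_simplex H h x) : simplexz Y n).
pose E h := gen (H n x (step n h) : simplexz Y n).
have Dl : \sum_(h < n.+1) diff (chains Y) n.+1 n
      (gen (prism_simplex H h x : simplexz Y n.+1) *~ ((-1) ^+ h)) =
    \sum_(0 <= h < n.+1) \sum_(0 <= j < n.+2) D h j *~ ((-1) ^+ (h + j)).
  rewrite [RHS]big_mkord; apply: eq_bigr => h _.
  rewrite raddfMz chains_diffE simplexz_boundaryS big_mkord mulrz_suml.
  apply: eq_bigr => j _; rewrite /D inord_val -mulrzA -exprD addnC //.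
have Deq h : (h < n.+1)%N -> D h h = E h /\ D h h.+1 = E h.+1.
  move=> hn; rewrite /D /E; split; rewrite prism_face_eq ?inordK //; lia.
have -> : smapz f x = H n x (step n 0) :> simplexz Y n by exact: fE.
have -> : smapz g x = H n x (step n n.+1) :> simplexz Y n by exact: gE.
transitivity (E 0%N - E n.+1) => //.
(* A vertex has no boundary: degree 0 is [prism_sum] with [G] equal to 0. *)
case: n k x ik @D @E Dl Deq => [|n] k x ik D E Dl Deq.
  have -> : simplexz_boundary k x = 0 by case: k ik => // k; lia.
  apply: etrans _ (congr1 (+%R _) (esym (raddf0 (prism k 0%N)))).
  apply: etrans _ (esym (addr0 _)); apply: etrans _ (esym Dl).
  apply: etrans (esym (@prism_sum _ 0 D (fun _ _ => 0) E _ _ _)) _ => //.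
  - by move=> h j; lia.
  - by move=> h j; lia.
  - apply: etrans _ (addr0 _); congr (_ + _).
    by rewrite big1 // => i _; rewrite big_geq.
case: k ik => [k|k] ik; last by exfalso; lia.
have {}ik : k = n by lia.
subst k; pose G h j := gen (prism_simplex H h (sact (coface (inord j)) x) : simplexz Y n.+1).
rewrite -(@prism_sum _ n.+1 D G E) //.
- congr (_ + _); first by rewrite -Dl.
  rewrite simplexz_boundaryS raddf_sum big_mkord; apply: eq_bigr => j _.
  rewrite raddfMz prismE prism_genS mulrz_suml big_mkord.
  by apply: eq_bigr => h _; rewrite /G inord_val -mulrzA -exprD.
- by move=> h j hj; rewrite /D /G prism_face_lt ?inordK //; lia.
- by move=> h j hj; rewrite /D /G prism_face_gt ?inordK //; lia.
Qed.
End PrismOperator.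

Definition sset_id (X : sset) : sset_map X X :=
  @SSetMap X X (fun _ x => x) (fun _ _ _ _ => erefl).

Definition sset_comp (X Y Z : sset) (v : sset_map Y Z) (u : sset_map X Y) :
  sset_map X Z.
Proof.
refine (@SSetMap X Z (fun n x => v n (u n x)) _).
by move=> m n a x; rewrite !smapP.
Defined.

Lemma chains_map_comp (X Y Z : sset) (v : sset_map Y Z) (u : sset_map X Y) i x :
  chains_map (sset_comp v u) i x = chains_map v i (chains_map u i x).
Proof.
apply: (@free_group_ext _ _ (chains_map (sset_comp v u) i)
  (chains_map v i \o chains_map u i)).
by move=> {}x /=; rewrite !chains_mapE; case: i x.
Qed.

Lemma chains_map_ext (X Y : sset) (u v : sset_map X Y) i x :
  (forall n y, u n y = v n y) -> chains_map u i x = chains_map v i x.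
Proof.
move=> uv; apply: (@free_group_ext _ _ (chains_map u i) (chains_map v i)).
by move=> {}x; rewrite !chains_mapE; case: i x => // n x; rewrite /= uv.
Qed.

Lemma chains_map_id (X : sset) (u : sset_map X X) i x :
  (forall n y, u n y = y) -> chains_map u i x = x.
Proof.
move=> uid; apply: (@free_group_ext _ _ (chains_map u i) idfun).
by move=> {}x; rewrite !chains_mapE; case: i x => // n x; rewrite /= uid.
Qed.

Lemma prism_nat (X Y X' Y' : sset) (H : shomotopy X Y) (H' : shomotopy X' Y')
    (u : sset_map X X') (v : sset_map Y Y') i j x :
  (forall n y t, H' n (u n y) t = v n (H n y t)) ->
  chains_map v j (prism H i j x) = prism H' i j (chains_map u i x).
Proof.
move=> HH; apply: (@free_group_ext _ _ (chains_map v j \o prism H i j)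
  (prism H' i j \o chains_map u i)) => {}x /=.
rewrite prismE chains_mapE prismE; case: i j x => [m|m] // [n|n] x;
  rewrite /prism_gen ?raddf0 //=.
case: eqP => [e|_]; last exact: raddf0.
subst n; rewrite raddf_sum; apply: eq_bigr => k _.
by rewrite raddfMz /= free_lift_gen /prism_simplex -smapP HH.
Qed.

Lemma shomotopy_bdr (X Y : sset) (H : shomotopy X Y) (f g : sset_map X Y) :
  (forall n x, f n x = H n x (step n 0)) ->
  (forall n x, g n x = H n x (step n n.+1)) ->
  forall i (z : chains X i), cyc z -> bdr (chains_map f i z - chains_map g i z).
Proof.
move=> fE gE i z cz.
rewrite (@prismP _ _ H f g fE gE i (i + 1) (i - 1)) ?subrK // cz raddf0 addr0.
exact: bdr_diff.
Qed.

(** * The comparison map of cones *)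

Section MixHom.
Variables (D : category) (ax bx ay b_y : D).
Variables (fa : hom ax ay) (fb : hom bx b_y) (fd : hom ax b_y).

(** The type depends on both levels, so that the arrow reduces as soon as they are known. No arrow
    goes from level 1 down to level 0, whence the absurd branch. *)
Definition mixhom (b c : bool) :
    (b -> c) -> hom (if b then bx else ax) (if c then b_y else ay) :=
  match b, c return
    (b -> c) -> hom (if b then bx else ax) (if c then b_y else ay) with
  | true, true => fun _ => fb
  | false, true => fun _ => fd
  | false, false => fun _ => fa
  | true, false => fun bc => False_rect _ (notF (bc isT))
  end.
End MixHom.

Section Mix.
Variables (E D : category) (A B : functor E D).
Variable eta : forall x, hom (A x) (B x).
Hypothesis etaP : forall x y (f : hom x y),
  comp (eta y) (fhom A f) = comp (fhom B f) (eta x).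
Variable t : E -> bool.
Hypothesis tP : forall x y, hom x y -> t x -> t y.

Definition mix_hom x y (f : hom x y) :=
  mixhom (fhom A f) (fhom B f) (comp (eta y) (fhom A f)) (tP f).

(** A natural transformation is a functor on [E x [1]]; this is its restriction to the graph of
    [t]. *)
Program Definition mix : functor E D :=
  @Functor E D (fun x => if t x then B x else A x) mix_hom _ _.
Next Obligation.
move=> x; rewrite /mix_hom !fhom1; move: (tP _).
by case: (t x) => // h.
Qed.
Next Obligation.
move=> x y z g f; rewrite /mix_hom; move: (tP _) (tP g) (tP f).
case: (t x) (t y) (t z) => [] [] [] h1 h2 h3 /=;
  do ?[by case: (notF (h1 isT)) | by case: (notF (h2 isT)) | by case: (notF (h3 isT))];
  rewrite ?fhomM ?compA //.
by rewrite etaP.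
Qed.

End Mix.

Lemma mix_true (E D : category) (A B : functor E D) eta etaP t tP :
  (forall x, t x = true) -> @mix E D A B eta etaP t tP = B.
Proof.
move=> t1; have e : t = fun=> true by apply: functional_extensionality_dep.
subst t; apply: (@functor_eq _ _ (mix etaP tP) B erefl) => x y f /=.
by rewrite /mix_hom; move: (tP _ _ f).
Qed.

Lemma mix_false (E D : category) (A B : functor E D) eta etaP t tP :
  (forall x, t x = false) -> @mix E D A B eta etaP t tP = A.
Proof.
move=> t1; have e : t = fun=> false by apply: functional_extensionality_dep.
subst t; apply: (@functor_eq _ _ (mix etaP tP) A erefl) => x y f /=.
by rewrite /mix_hom; move: (tP _ _ f).
Qed.

Lemma mixhom_eq (D : category) (ax bx ay b_y : D) fa fb fd fa' fb' fd'
    (b c : bool) (h h' : b -> c) :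
  fa = fa' -> fb = fb' -> fd = fd' ->
  @mixhom D ax bx ay b_y fa fb fd b c h = mixhom fa' fb' fd' h'.
Proof. by move=> -> -> ->; rewrite (Prop_irrelevance h h'). Qed.

Definition level n (t : functor (ordcat n) (ordcat 1)) (i : ordcat n) : bool :=
  (0 < (t i : 'I_2))%N.

Lemma levelP n (t : functor (ordcat n) (ordcat 1)) (i j : ordcat n) :
  hom i j -> level t i -> level t j.
Proof. by move=> ij; have := fhom t ij; rewrite /level /=; lia. Qed.

Lemma level_top n i : level (step n 0) i = true.
Proof. by rewrite /level /= inordK. Qed.

Lemma level_bot n i : level (step n n.+1) i = false.
Proof. by have := ltn_ord i; rewrite /level /= inordK; lia. Qed.

Section NerveHomotopy.
Variables (E D : category) (A B : functor E D).
Variable eta : forall x, hom (A x) (B x).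
Hypothesis etaP : forall x y (f : hom x y),
  comp (eta y) (fhom A f) = comp (fhom B f) (eta x).

Definition nerve_homotopy_fun n (x : nerve E n) (t : functor (ordcat n) (ordcat 1)) :
    nerve D n :=
  @mix (ordcat n) D (functor_comp A x) (functor_comp B x) (fun i => eta (x i))
    (fun i j f => etaP (fhom x f)) (level t) (@levelP n t).

Lemma nerve_homotopy_proof m n (a : functor (ordcat m) (ordcat n)) (x : nerve E n) t :
  nerve_homotopy_fun (sact a x) (functor_comp t a) = sact a (nerve_homotopy_fun x t).
Proof.
apply: (@functor_eq _ _ (nerve_homotopy_fun (functor_comp x a) (functor_comp t a))
  (functor_comp (nerve_homotopy_fun x t) a) erefl) => i j f /=.
by rewrite /mix_hom; apply: mixhom_eq.
Qed.

Definition nerve_homotopy : shomotopy (nerve E) (nerve D) :=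
  @SHomotopy (nerve E) (nerve D) nerve_homotopy_fun nerve_homotopy_proof.

Lemma nerve_homotopy_bdr i (z : cat_chains E i) :
  cyc z -> bdr (cat_chains_map B i z - cat_chains_map A i z).
Proof.
apply: (@shomotopy_bdr _ _ nerve_homotopy (nerve_map B) (nerve_map A)) => n x /=.
  by rewrite [RHS]mix_true // => k; apply: level_top.
by rewrite [RHS]mix_false // => k; apply: level_bot.
Qed.
End NerveHomotopy.

Section Comparison.
Variables (C D E : category) (T : functor C D) (I : functor E D).

Definition comma_src_functor (d : D) : functor (comma T d) C :=
  @Functor (comma T d) C (@comma_src _ _ T d) (fun _ _ f => sval f)
    (fun _ => erefl) (fun _ _ _ _ _ => erefl).

Definition comma_transport : sset :=
  diagonal (transport_nerve (cat_functor_comp (comma_functor T) I)).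

Lemma transport_src_proof m n (a : functor (ordcat m) (ordcat n))
    (x : comma_transport n) :
  functor_comp (comma_src_functor _) (fibre (sact a x)) =
  sact a (functor_comp (comma_src_functor _) (fibre x) : nerve C n).
Proof.
exact: (@functor_eq _ _ (functor_comp (comma_src_functor _) (fibre (transport_act a a x)))
  (functor_comp (functor_comp (comma_src_functor _) (fibre x)) a) erefl (fun _ _ _ => erefl)).
Qed.

Definition transport_src : sset_map comma_transport (nerve C) :=
  @SSetMap comma_transport (nerve C)
    (fun _ x => functor_comp (comma_src_functor _) (fibre x)) transport_src_proof.

Section Homotopy.
Variables (n : nat) (x : comma_transport n).

(** The composite [T c_i -> d_0 -> d_i], since the fibre lives over the first object of the base. *)
Definition comparison_arr (i : ordcat n) :
    hom (T (comma_src (fibre x i))) (I (base x i)) :=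
  comp (fhom I (fhom (base x) (from0 i))) (comma_arr (fibre x i)).

Lemma comparison_arrP (i j : ordcat n) (f : hom i j) :
  comp (comparison_arr j) (fhom (functor_comp T (transport_src n x)) f) =
  comp (fhom (functor_comp I (base x)) f) (comparison_arr i).
Proof.
rewrite /comparison_arr -compA /= (svalP (fhom (fibre x) f)) compA.
by rewrite -!fhomM; congr (comp (fhom I (fhom (base x) _)) _); apply: bool_irrelevance.
Qed.

Definition comparison_homotopy_fun (t : functor (ordcat n) (ordcat 1)) : nerve D n :=
  @mix (ordcat n) D (functor_comp T (transport_src n x)) (functor_comp I (base x))
    comparison_arr comparison_arrP (level t) (@levelP n t).
End Homotopy.

Lemma comparison_homotopy_proof m n (a : functor (ordcat m) (ordcat n))
    (x : comma_transport n) t :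
  comparison_homotopy_fun (sact a x) (functor_comp t a) =
  sact a (comparison_homotopy_fun x t).
Proof.
apply: (@functor_eq _ _ (comparison_homotopy_fun (transport_act a a x) (functor_comp t a))
  (functor_comp (comparison_homotopy_fun x t) a) erefl) => i j f /=.
rewrite /mix_hom; apply: mixhom_eq => //=.
congr (comp _ _).
rewrite /comparison_arr /= compA; congr (comp _ _).
by rewrite -!fhomM; congr (fhom I (fhom _ _)); apply: bool_irrelevance.
Qed.

Definition comparison_homotopy : shomotopy comma_transport (nerve D) :=
  @SHomotopy comma_transport (nerve D) comparison_homotopy_fun
    comparison_homotopy_proof.

Lemma comparison_homotopyP i j k (x : chains comma_transport i) :
  j = i + 1 -> i = k + 1 ->
  cat_chains_map I i (functor_chains_map (cat_functor_comp (comma_functor T) I) i x)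
  - cat_chains_map T i (chains_map transport_src i x) =
  diff (cat_chains D) j i (prism comparison_homotopy i j x)
  + prism comparison_homotopy k i (diff (chains comma_transport) i k x).
Proof.
move=> ji ik; rewrite -!chains_map_comp.
apply: (@prismP _ _ comparison_homotopy
  (sset_comp (nerve_map I) (transport_proj (cat_functor_comp (comma_functor T) I)))
  (sset_comp (nerve_map T) transport_src)) => // n {}x /=.
  by rewrite [RHS]mix_true // => l; apply: level_top.
by rewrite [RHS]mix_false // => l; apply: level_bot.
Qed.

(* On [Y x X] with [Y] the chains of [E] and [X] those of the transport, this
   is [(y, x) |-> (I y + h x, src x)]. *)
Definition comparison :
    chain_map (cone (functor_chains_map (cat_functor_comp (comma_functor T) I)))
              (cone (cat_chains_map T)) :=
  lax_cone comparison_homotopyP.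
End Comparison.

(** * Acyclic models *)

Lemma bdr_at (X : complex) i j (z : X i) :
  bdr z -> j = i + 1 -> exists x : X j, diff X j i x = z.
Proof. by move=> /bdrP bz ->. Qed.

(** Like [diff], the contraction carries two degrees; its components outside [i -> i + 1] are left
    free. *)
Definition contractible (X : complex) :=
  exists s : forall i j, {additive X i -> X j},
  forall i j k (x : X i), j = i + 1 -> i = k + 1 ->
    x = diff X j i (s i j x) + s k i (diff X i k x).

Lemma contractible_acyclic (X : complex) : contractible X -> acyclic X.
Proof.
move=> [s sP] i z cz; rewrite [z](sP i (i + 1) (i - 1)) ?subrK //.
rewrite cz raddf0 addr0; exact: bdr_diff.
Qed.

Section PairInjections.
Variables U V : zmodType.

Definition pair_inl (x : U) : (U * V)%type := (x, 0).
Definition pair_inr (x : V) : (U * V)%type := (0, x).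

Lemma pair_inl_additive : zmod_morphism pair_inl.
Proof. by move=> x y; congr (_, _); rewrite subr0. Qed.

Lemma pair_inr_additive : zmod_morphism pair_inr.
Proof. by move=> x y; congr (_, _); rewrite subr0. Qed.

HB.instance Definition _ :=
  GRing.isZmodMorphism.Build U (U * V)%type pair_inl pair_inl_additive.
HB.instance Definition _ :=
  GRing.isZmodMorphism.Build V (U * V)%type pair_inr pair_inr_additive.
End PairInjections.

Section AcyclicModels.
Variables (Ob : Type) (Mor : Ob -> Ob -> Type).
Variable cmp : forall a b c, Mor b c -> Mor a b -> Mor a c.

Record abfun := AbFun {
  af :> Ob -> zmodType;
  afm : forall a b, Mor a b -> {additive af a -> af b};
  afC : forall a b c (g : Mor b c) (f : Mor a b) x,
    afm (cmp g f) x = afm g (afm f x) }.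

Record nattr (A B : abfun) := NatTr {
  nt :> forall a, {additive A a -> B a};
  ntP : forall a b (f : Mor a b) x, nt b (afm A f x) = afm B f (nt a x) }.

Variable good : Ob -> Prop.

(** Surjectivity is asked on good objects alone, while the lift is natural on all objects. This is
    how acyclicity on the models spreads to every object. *)
Definition projective (L : abfun) :=
  forall (A B : abfun) (p : nattr A B) (b : nattr L B),
  (forall a, good a -> forall l : L a, exists x, p a x = b a l) ->
  exists s : nattr L A, forall a l, p a (s a l) = b a l.

Section Product.
Variables L1 L2 : abfun.

Definition prod_map a b (f : Mor a b) (x : L1 a * L2 a) : L1 b * L2 b :=
  (afm L1 f x.1, afm L2 f x.2).

Lemma prod_map_additive a b (f : Mor a b) : zmod_morphism (prod_map f).
Proof. by move=> x y; rewrite /prod_map /= !raddfB. Qed.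

HB.instance Definition _ a b (f : Mor a b) :=
  GRing.isZmodMorphism.Build (L1 a * L2 a)%type (L1 b * L2 b)%type (prod_map f)
    (prod_map_additive f).

Definition prod_abfun : abfun.
Proof.
refine (@AbFun (fun a => (L1 a * L2 a)%type) (fun a b f => prod_map f) _).
by move=> a b c g f x; rewrite /= /prod_map !afC.
Defined.

Definition inl_nattr : nattr L1 prod_abfun.
Proof.
refine (@NatTr L1 prod_abfun (fun a => @pair_inl (L1 a) (L2 a)) _).
by move=> a b f x; rewrite /= /prod_map /pair_inl /= raddf0.
Defined.

Definition inr_nattr : nattr L2 prod_abfun.
Proof.
refine (@NatTr L2 prod_abfun (fun a => @pair_inr (L1 a) (L2 a)) _).
by move=> a b f x; rewrite /= /prod_map /pair_inr /= raddf0.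
Defined.

Definition comp_nattr (A B E : abfun) (g : nattr B E) (f : nattr A B) : nattr A E.
Proof.
refine (@NatTr A E (fun a => (g a \o f a : {additive A a -> E a})) _).
by move=> a b h x; rewrite /= !ntP.
Defined.

Lemma projective_prod : projective L1 -> projective L2 -> projective prod_abfun.
Proof.
move=> P1 P2 A B p b onto.
have [s1 e1] := P1 A B p (comp_nattr b inl_nattr) (fun a ga l => onto a ga (l, 0)).
have [s2 e2] := P2 A B p (comp_nattr b inr_nattr) (fun a ga l => onto a ga (0, l)).
pose F a : {additive prod_abfun a -> A a} :=
  (s1 a \o fst : (L1 a * L2 a)%type -> A a) \+ (s2 a \o snd).
have Fn a c (f : Mor a c) x : F c (afm prod_abfun f x) = afm A f (F a x).
  by rewrite /F /= !ntP raddfD.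
exists (NatTr Fn) => a [l1 l2]; rewrite /= raddfD.
apply: etrans (congr2 +%R (e1 a l1) (e2 a l2)) _; rewrite /= -raddfD.
by congr (b a _); congr (_, _); rewrite ?addr0 ?add0r.
Qed.
End Product.
Section Free.
Variables (G : Ob -> Type) (Gm : forall a b, Mor a b -> G a -> G b).
Hypothesis GC : forall a b c (g : Mor b c) (f : Mor a b) x,
  Gm (cmp g f) x = Gm g (Gm f x).

Definition free_abfun : abfun.
Proof.
refine (@AbFun (fun a => free_group (G a))
  (fun a b f => free_lift (fun x => gen (Gm f x))) _).
move=> a b c g f x; set h := fun a b (f : Mor a b) => free_lift (fun x => gen (Gm f x)).
apply: (@free_group_ext _ _ (h _ _ (cmp g f)) (h _ _ g \o h _ _ f)) => {}x.
by rewrite /h /= !free_lift_gen GC.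
Defined.

Variables (T : Type) (M : T -> Ob) (u : forall t, G (M t)).
Variable inv : forall a, G a -> {t : T & Mor (M t) a}.
Hypothesis invK : forall a g, Gm (projT2 (inv g)) (u (projT1 (inv g))) = g :> G a.
Hypothesis invN : forall a b (f : Mor a b) g,
  inv (Gm f g) = existT _ (projT1 (inv g)) (cmp f (projT2 (inv g))).
Hypothesis goodM : forall t, good (M t).

(** As in the Yoneda lemma: [inv] writes each element, naturally, as the image of a universal
    element [u t], so a preimage [w t] of each of them determines the lift. *)
Lemma projective_free : projective free_abfun.
Proof.
move=> A B p b onto.
pose w t := sval (cid (onto _ (goodM t) (gen (u t)))).
have wP t : p (M t) (w t) = b (M t) (gen (u t)).
  by rewrite /w; case: (cid _).
pose F0 a (g : G a) : A a := afm A (projT2 (inv g)) (w (projT1 (inv g))).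
pose F a : {additive free_abfun a -> A a} := free_lift (@F0 a).
have Fn a c (f : Mor a c) x : F c (afm free_abfun f x) = afm A f (F a x).
  apply: (@free_group_ext _ _ (F c \o afm free_abfun f) (afm A f \o F a)) => {}x.
  by rewrite /= !free_lift_gen /F0 invN /= afC.
exists (NatTr Fn) => a x.
apply: (@free_group_ext _ _ (p a \o F a) (b a)) => {}x.
rewrite /= free_lift_gen /F0 ntP wP -ntP /=.
by congr (b a _); rewrite [LHS]free_lift_gen invK.
Qed.
End Free.

Section Contraction.
Variable K : Ob -> complex.
Variable Km : forall a b, Mor a b -> chain_map (K a) (K b).
Hypothesis KmC : forall a b c (g : Mor b c) (f : Mor a b) i x,
  Km (cmp g f) i x = Km g i (Km f i x).

Definition degree_abfun (i : int) : abfun :=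
  @AbFun (fun a => K a i) (fun a b f => Km f i) (fun a b c g f x => KmC g f x).

Definition diff_nattr i j : nattr (degree_abfun i) (degree_abfun j) :=
  @NatTr (degree_abfun i) (degree_abfun j) (fun a => diff (K a) i j)
    (fun a b f x => esym (cmapP (Km f) j x)).

Hypothesis Kproj : forall i, projective (degree_abfun i).
Hypothesis Kneg : forall a n (x : K a (Negz n)), x = 0.
Hypothesis Kacyclic : forall a, good a -> acyclic (K a).

Let htpy (n : nat) := nattr (degree_abfun n) (degree_abfun n.+1).
(** The trace of the contraction identity in the next degree. It says that [id - t d] takes values
    in cycles; these bound on good objects, so projectivity lifts [id - t d] through the
    differential and gives the next homotopy. *)
Let partial n (t : htpy n) :=
  forall a (x : K a n.+1), diff (K a) n.+1 n (t a (diff (K a) n.+1 n x)) =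
    diff (K a) n.+1 n x.

Lemma acyclic_models_step n (t : htpy n) : partial t -> exists t' : htpy n.+1,
  partial t' /\ forall a (x : K a n.+1),
    x = diff (K a) n.+2 n.+1 (t' a x) + t a (diff (K a) n.+1 n x).
Proof.
move=> pt.
pose F a : {additive degree_abfun n.+1 a -> degree_abfun n.+1 a} :=
  idfun \- (t a \o diff (K a) n.+1 n).
have Fn a c (f : Mor a c) x : F c (afm (degree_abfun n.+1) f x) =
    afm (degree_abfun n.+1) f (F a x).
  by rewrite /F /= raddfB -cmapP -(ntP t).
have [|t' tE] := @Kproj n.+1 _ _ (diff_nattr n.+2 n.+1) (NatTr Fn).
  move=> a ga x; apply: bdr_at; last by lia.
  apply: Kacyclic => //; apply/cycP.
  have -> : n.+1%:Z - 1 = n by lia.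
  by rewrite /= raddfB /= pt subrr.
exists t'; have eq a (x : K a n.+1) :
    x = diff (K a) n.+2 n.+1 (t' a x) + t a (diff (K a) n.+1 n x).
  by apply: etrans (esym (congr1 (+%R^~ _) (tE a x))); rewrite /= subrK.
split=> // a x.
by rewrite [RHS]eq diff_diff raddf0 addr0.
Qed.

Lemma acyclic_models_base : exists t : htpy 0, partial t /\
  forall a (x : K a 0), x = diff (K a) 1 0 (t a x).
Proof.
pose F a : {additive degree_abfun 0 a -> degree_abfun 0 a} := idfun.
have [|t tE] := @Kproj 0 _ _ (diff_nattr 1 0) (@NatTr _ _ F (fun _ _ _ _ => erefl)).
  move=> a ga x; apply: bdr_at => //.
  by apply: Kacyclic => //; apply/cycP; exact: Kneg.
exists t; split=> [a x|a x]; first exact: tE.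
exact: esym (tE a x).
Qed.

Theorem acyclic_models a : contractible (K a).
Proof.
have [t0 [p0 e0]] := acyclic_models_base.
(* Each stage is chosen from the previous one and its property [partial], hence a recursion on
   pairs. Below, [s] spreads the stages over integer degrees, with 0 outside [n -> n.+1]. *)
pose S := fix S n : {t : htpy n | partial t} :=
  if n is m.+1 return {t : htpy n | partial t} then
    let w := cid (acyclic_models_step (svalP (S m))) in exist _ (sval w) (svalP w).1
  else exist _ t0 p0.
have SE n x : x = diff (K a) n.+2 n.+1 (sval (S n.+1) a x)
    + sval (S n) a (diff (K a) n.+1 n x) 
  by exact: (svalP (cid (acyclic_models_step (svalP (S n))))).2.
pose s i j : {additive K a i -> K a j} :=
  match i, j return {additive K a i -> K a j} with
  | Posz m, Posz n =>
      if eqP is ReflectT e then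
        ecast l {additive K a m -> K a (Posz l)} (e : m.+1 = n) (sval (S m) a)
      else \0
  | _, _ => \0
  end.
have sE (n : nat) : s n n.+1 = sval (S n) a.
  by rewrite /s; case: eqP => // e; rewrite (eq_irrelevance e erefl).
exists s => i j k x; case: i x => [n|n] x; last by rewrite [x]Kneg !raddf0 addr0.
move=> jn; have -> : j = n.+1 by lia.
case: n x {jn} => [|n] x nk.
  have -> : diff (K a) 0 k x = 0.
    by apply: (_ : cyc x); apply/cycP; exact: Kneg.
  by rewrite raddf0 addr0 sE; exact: e0.
have -> : k = n by lia.
by rewrite !sE; exact: SE.
Qed.
End Contraction.
End AcyclicModels.

(** * Categories with a cut *)

(** Casting at each object separately lets [e] be defined by cases and reduce in each of them, which
    an equality of functions obtained by extensionality does not do. *)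
Lemma functor_ext (A B : category) (F G : functor A B) (e : forall x, F x = G x) :
  (forall x y (f : hom x y),
     ecast z (hom (G x) z) (e y) (ecast z (hom z (F y)) (e x) (fhom F f)) =
     fhom G f) -> F = G.
Proof.
move=> h; have eo : fob F = fob G by exact: functional_extensionality_dep.
apply: (functor_eq (e := eo)) => x y f; rewrite -h.
move: (fhom F f) => u; case: _ / eo e {h} => e.
by rewrite (Prop_irrelevance (e x) erefl) (Prop_irrelevance (e y) erefl).
Qed.

Lemma mix_comp (E D D' : category) (F : functor D D') (A B : functor E D) eta etaP t tP P :
  functor_comp F (@mix E D A B eta etaP t tP) =
  @mix E D' (functor_comp F A) (functor_comp F B) (fun x => fhom F (eta x)) P t tP.
Proof.
(* [F] passes through the conditional only after a case on [t x], where both sides become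
   convertible. *)
pose e x : F (if t x then B x else A x) = if t x then F (B x) else F (A x) :=
  if t x as b return F (if b then B x else A x) = if b then F (B x) else F (A x)
  then erefl else erefl.
apply: (@functor_ext E D' (functor_comp F (mix etaP tP))
  (@mix E D' (functor_comp F A) (functor_comp F B) (fun x => fhom F (eta x)) P t tP)
  e) => x y f; rewrite /e /= /mix_hom.
move: (tP x y f); case: (t x) (t y) => [] [] h //=; last by rewrite fhomM.
by case: (notF (h isT)).
Qed.

(** The equality concerns underlying objects, so that [erefl] serves even if the membership proofs
    differ. *)
Lemma full_functor_ext (A B : category) (P : B -> Prop)
    (F G : functor A (full_subcategory P)) (e : (fun x => sval (F x)) = (fun x => sval (G x))) :
  (forall x y (f : hom x y),
     ecast s (@hom B (s x) (s y)) e (fhom F f) = fhom G f) -> F = G.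
Proof.
move=> h; have eo : fob F = fob G.
  apply: functional_extensionality_dep => x.
  have := congr1 (fun s => s x) e; move: (F x) (G x) => [u pu] [v pv] /= euv.
  by subst v; rewrite (Prop_irrelevance pu pv).
apply: (functor_eq (e := eo)) => x y f; rewrite -h.
move: (fhom F f) => u; case: _ / eo e {h} => e.
by rewrite (Prop_irrelevance e erefl).
Qed.

Lemma comma_functor_ext (A C D : category) (T : functor C D) (d : D)
    (F G : functor A (comma T d))
    (e : (fun x => comma_src (F x)) = (fun x => comma_src (G x))) :
  (forall x, ecast s (hom (T (s x)) d) e (comma_arr (F x)) = comma_arr (G x)) ->
  (forall x y (f : hom x y),
     ecast s (hom (s x) (s y)) e (sval (fhom F f)) = sval (fhom G f)) -> F = G.
Proof.
move=> ha hh; have eo : fob F = fob G.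
  have gen_eq (s s' : A -> C) (es : s = s') (a : forall x, hom (T (s x)) d)
      (a' : forall x, hom (T (s' x)) d) :
      (forall x, ecast s (hom (T (s x)) d) es (a x) = a' x) ->
      (fun x => CommaOb (a x)) = (fun x => CommaOb (a' x)).
    case: _ / es a' => a' aa'.
    by rewrite (_ : a = a') //; apply: functional_extensionality_dep.
  (* With primitive projections, [F x] is convertible to the [CommaOb] built from its own arrow. *)
  exact: (gen_eq _ _ e (fun x => comma_arr (F x)) (fun x => comma_arr (G x)) ha).
apply: (functor_eq (e := eo)) => x y f; apply: comma_hom_eq; rewrite -hh.
move: (fhom F f) => u; case: _ / eo e {ha hh} => e.
by rewrite (Prop_irrelevance e erefl).
Qed.

Lemma comma_transport_ext (C D E : category) (T : functor C D) (I : functor E D) n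
    (x y : comma_transport T I n)
    (ed : I (base x ord0) = I (base y ord0))
    (es : (fun i => comma_src (fibre x i)) = (fun i => comma_src (fibre y i))) :
  base x = base y ->
  (forall i, ecast d (hom (T (comma_src (fibre y i))) d) ed
     (ecast s (hom (T (s i)) (I (base x ord0))) es (comma_arr (fibre x i))) =
     comma_arr (fibre y i)) ->
  (forall i j (f : hom i j),
     ecast s (hom (s i) (s j)) es (sval (fhom (fibre x) f)) =
     sval (fhom (fibre y) f)) -> x = y.
Proof.
case: x ed es => bx fx; case: y => b_y fy /= ed es e.
case: _ / e fy ed es => fy ed es; rewrite (Prop_irrelevance ed erefl) /= => ha hh.
congr TransportSimplex; exact: (@comma_functor_ext (ordcat n) C D T (I (bx ord0)) fx fy es ha hh).
Qed.

Section SubFunctor.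
Variables (A B : category) (F : functor A B) (P : A -> Prop) (Q : B -> Prop).
Hypothesis FPQ : forall x, P x -> Q (F x).

Program Definition sub_functor : functor (full_subcategory P) (full_subcategory Q) :=
  @Functor (full_subcategory P) (full_subcategory Q)
    (fun x => exist _ (F (sval x)) (FPQ (proj2_sig x)))
    (fun _ _ f => fhom F f) _ _.
Next Obligation. by move=> x; apply: fhom1. Qed.
Next Obligation. by move=> x y z g f; apply: fhomM. Qed.
End SubFunctor.

(* Stands for the inclusion of the full subcategory on [cin]. In contrast with a
   cellular functor, which may identify objects, a string in [ccat] whose first
   objects satisfy [cin] has here a unique lift. *)
Record cutcat := CutCat {
  ccat :> category;
  cin : ccat -> Prop;
  cinP : forall x y : ccat, hom x y -> cin y -> cin x }.

(** Outside objects stay outside, so that [cut_out] is functorial and a string and its image are cut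
    at the same place. *)
Record cutmor (J J' : cutcat) := CutMor {
  cfun :> functor J J';
  cfun_in : forall x, cin x -> cin (cfun x);
  cfun_out : forall x, ~ cin x -> ~ cin (cfun x) }.

Lemma cutmor_eq (J J' : cutcat) (F G : cutmor J J') : cfun F = cfun G -> F = G.
Proof.
case: F G => [F i o] [G i' o'] /= e; subst G.
by rewrite (Prop_irrelevance i i') (Prop_irrelevance o o').
Qed.

Definition cutcomp (J J' J'' : cutcat) (G : cutmor J' J'') (F : cutmor J J') :
    cutmor J J'' :=
  @CutMor J J'' (functor_comp G F) (fun x p => cfun_in G (cfun_in F p))
    (fun x p => @cfun_out _ _ G _ (@cfun_out _ _ F _ p)).

Definition cut_in (J : cutcat) : category := full_subcategory (@cin J).
Definition cut_out (J : cutcat) : category := full_subcategory (fun x => ~ @cin J x).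
Definition incl_in (J : cutcat) : functor (cut_in J) J := subcategory_incl _.
Definition incl_out (J : cutcat) : functor (cut_out J) J := subcategory_incl _.

Definition cut_transport (J : cutcat) : sset :=
  comma_transport (incl_in J) (incl_out J).

Definition cut_comparison (J : cutcat) := comparison (incl_in J) (incl_out J).

Section CutFunctoriality.
Variables (J J' : cutcat) (F : cutmor J J').

Definition fun_in : functor (cut_in J) (cut_in J') := sub_functor (@cfun_in _ _ F).
Definition fun_out : functor (cut_out J) (cut_out J') := sub_functor (@cfun_out _ _ F).

Section CutComma.
Variable d : J.

Definition cut_comma_ob (x : comma (incl_in J) d) : comma (incl_in J') (F d) :=
  @CommaOb _ _ (incl_in J') _ (fun_in (comma_src x)) (fhom F (comma_arr x)).

Program Definition cut_comma_hom (x y : comma (incl_in J) d) (f : hom x y) :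
  hom (cut_comma_ob x) (cut_comma_ob y) := exist _ (fhom F (sval f)) _.
Next Obligation. by move=> x y [f ef] /=; rewrite -fhomM; congr (fhom F _). Qed.

Program Definition cut_comma : functor (comma (incl_in J) d) (comma (incl_in J') (F d)) :=
  @Functor _ _ cut_comma_ob cut_comma_hom _ _.
Next Obligation. by move=> x; apply: comma_hom_eq; apply: fhom1. Qed.
Next Obligation. by move=> x y z g f; apply: comma_hom_eq; apply: fhomM. Qed.
End CutComma.

Definition cut_transport_fun n (x : cut_transport J n) : cut_transport J' n :=
  @TransportSimplex _ (cat_functor_comp (comma_functor (incl_in J')) (incl_out J')) n n
    (functor_comp fun_out (base x)) (functor_comp (cut_comma _) (fibre x)).

Lemma cut_transport_proof m n (a : functor (ordcat m) (ordcat n)) (x : cut_transport J n) :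
  cut_transport_fun (sact a x) = sact a (cut_transport_fun x).
Proof.
apply: (@comma_transport_ext _ _ _ _ _ _ (cut_transport_fun (transport_act a a x))
  (transport_act a a (cut_transport_fun x)) erefl erefl) => //=.
- exact: functor_compA.
- by move=> i; rewrite fhomM.
Qed.

Definition cut_transport_map : sset_map (cut_transport J) (cut_transport J') :=
  @SSetMap (cut_transport J) (cut_transport J') cut_transport_fun cut_transport_proof.
End CutFunctoriality.

Lemma cut_transport_mapC (J J' J'' : cutcat) (G : cutmor J' J'') (F : cutmor J J') n
    (x : cut_transport J n) :
  cut_transport_map (cutcomp G F) n x = cut_transport_map G n (cut_transport_map F n x).
Proof.
refine (@comma_transport_ext _ _ _ (incl_in J'') (incl_out J'') n (cut_transport_fun (cutcomp G F) x)
  (cut_transport_fun G (cut_transport_fun F x)) erefl erefl _ _ _) => //.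
exact: (@functor_eq _ _ (functor_comp (fun_out (cutcomp G F)) (base x))
    (functor_comp (fun_out G) (functor_comp (fun_out F) (base x))) erefl).
Qed.

Section CutComplex.

Lemma cut_transport_mapE J J' (F : cutmor J J') i x :
  cat_chains_map (fun_out F) i
    (functor_chains_map (cat_functor_comp (comma_functor (incl_in J)) (incl_out J)) i x) =
  functor_chains_map (cat_functor_comp (comma_functor (incl_in J')) (incl_out J')) i
    (chains_map (cut_transport_map F) i x).
Proof. by rewrite /functor_chains_map -!chains_map_comp; apply: chains_map_ext. Qed.

Lemma cut_inclE J J' (F : cutmor J J') i x :
  cat_chains_map F i (cat_chains_map (incl_in J) i x) =
  cat_chains_map (incl_in J') i (cat_chains_map (fun_in F) i x).
Proof.
rewrite /cat_chains_map -!chains_map_comp; apply: chains_map_ext => n y.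
exact: (@functor_eq _ _ (functor_comp F (functor_comp (incl_in J) y))
  (functor_comp (incl_in J') (functor_comp (fun_in F) y)) erefl).
Qed.

Definition cut_source J J' (F : cutmor J J') := cone_map (cut_transport_mapE F).
Definition cut_target J J' (F : cutmor J J') := cone_map (cut_inclE F).

Lemma cut_homotopyE J J' (F : cutmor J J') n (y : cut_transport J n) t :
  comparison_homotopy (incl_in J') (incl_out J') n (cut_transport_map F n y) t =
  nerve_map F n (comparison_homotopy (incl_in J) (incl_out J) n y t).
Proof.
apply/esym.
have P i j (f : @hom (ordcat n) i j) :
    comp (fhom F (comparison_arr y j))
      (fhom (functor_comp F (functor_comp (incl_in J) (transport_src _ _ n y))) f) =
    comp (fhom (functor_comp F (functor_comp (incl_out J) (base y))) f)
      (fhom F (comparison_arr y i)).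
  by rewrite /= -!fhomM; congr (fhom F _); exact: (comparison_arrP y f).
refine (etrans (@mix_comp (ordcat n) J J' F
  (functor_comp (incl_in J) (transport_src (incl_in J) (incl_out J) n y))
  (functor_comp (incl_out J) (base y)) (comparison_arr y) (@comparison_arrP _ _ _ _ _ n y)
  (level t) (@levelP n t) P) _).
apply: (@functor_eq _ _ (@mix (ordcat n) J'
    (functor_comp F (functor_comp (incl_in J) (transport_src (incl_in J) (incl_out J) n y)))
    (functor_comp F (functor_comp (incl_out J) (base y)))
    (fun i => fhom F (comparison_arr y i)) P (level t) (@levelP n t))
  (comparison_homotopy_fun (cut_transport_map F n y) t) erefl) => i j f /=.
by apply: mixhom_eq => //=; rewrite /comparison_arr /= -!fhomM.
Qed.

Lemma cut_comparisonE J J' (F : cutmor J J') i z :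
  cut_target F i (cut_comparison J i z) = cut_comparison J' i (cut_source F i z).
Proof.
rewrite /cut_target /cut_source !cone_mapE; case: z => y x.
rewrite /= /lax_cone_fun /=.
congr (_, _).
  rewrite raddfD; congr (_ + _); last exact: prism_nat (cut_homotopyE F).
  rewrite /cat_chains_map -!chains_map_comp; apply: chains_map_ext => n u.
  exact: (@functor_eq _ _ (functor_comp F (functor_comp (incl_out J) u))
    (functor_comp (incl_out J') (functor_comp (fun_out F) u)) erefl).
rewrite /cat_chains_map -!chains_map_comp; apply: chains_map_ext => n u.
exact: (@functor_eq _ _ (functor_comp (fun_in F) (transport_src _ _ n u))
  (transport_src _ _ n (cut_transport_map F n u)) erefl).
Qed.

Definition cut_complex (J : cutcat) : complex := cone (cut_comparison J).

Definition cut_map J J' (F : cutmor J J') : chain_map (cut_complex J) (cut_complex J') :=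
  cone_map (cut_comparisonE F).

Lemma cut_mapC J J' J'' (G : cutmor J' J'') (F : cutmor J J') i x :
  cut_map (cutcomp G F) i x = cut_map G i (cut_map F i x).
Proof.
rewrite /cut_map /cut_target /cut_source !cone_mapE.
rewrite /cat_chains_map -!chains_map_comp.
congr ((_, _), (_, _)); apply: chains_map_ext => n y.
- exact: (@functor_eq _ _ (functor_comp (functor_comp G F) y)
    (functor_comp G (functor_comp F y)) erefl).
- exact: (@functor_eq _ _ (functor_comp (fun_in (cutcomp G F)) y)
    (functor_comp (fun_in G) (functor_comp (fun_in F) y)) erefl).
- exact: (@functor_eq _ _ (functor_comp (fun_out (cutcomp G F)) y)
    (functor_comp (fun_out G) (functor_comp (fun_out F) y)) erefl).
exact: cut_transport_mapC.
Qed.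
End CutComplex.

(** * Models *)

(** Applied below with identities for [u] and [v], to pass between functors whose groups agree by
    conversion but which are packaged differently. *)
Lemma projective_retract (Ob : Type) (Mor : Ob -> Ob -> Type) cmp (good : Ob -> Prop)
    (L L' : @abfun Ob Mor cmp) (u : nattr L L') (v : nattr L' L) :
  (forall a l, v a (u a l) = l) -> projective good L' -> projective good L.
Proof.
move=> vu P A B p b onto.
have [s sE] := P A B p (comp_nattr b v) (fun a ga l => onto a ga (v a l)).
by exists (comp_nattr s u) => a l; apply: etrans (sE a (u a l)) _; rewrite /= vu.
Qed.

Lemma chains_neg (X : sset) i (z : chains X i) : (i < 0)%R -> z = 0.
Proof.
move=> i0; apply: (@free_group_ext _ _ idfun \0).
by case: i z i0 => // n _ _ [].
Qed.

(** What the models have in common: they are thin, and each side of the cut is empty or has an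
    initial object, the one inside being initial in all of [J]. *)
Definition good_cut (J : cutcat) :=
  [/\ forall (x y : J) (f g : hom x y), f = g,
      (exists2 x0 : J, cin x0 & forall y, inhabited (hom x0 y)) \/
        (forall x : J, ~ cin x) &
      (exists2 x1 : J, ~ cin x1 & forall y, ~ cin y -> inhabited (hom x1 y)) \/
        (forall x : J, cin x)].

Section ChainsProjective.
Variables (X : cutcat -> sset) (Xm : forall J J', cutmor J J' -> sset_map (X J) (X J')).
Hypothesis XmC : forall J J' J'' (G : cutmor J' J'') (F : cutmor J J') n x,
  Xm (cutcomp G F) n x = Xm G n (Xm F n x).

Definition chains_abfun (i : int) : abfun cutcomp.
Proof.
refine (@AbFun _ _ cutcomp (fun J => chains (X J) i) (fun J J' F => chains_map (Xm F) i) _).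
move=> J J' J'' G F x; rewrite -chains_map_comp; apply: chains_map_ext => n y.
exact: XmC.
Defined.

Hypothesis models : forall n, exists (T : Type) (M : T -> cutcat)
  (u : forall t, X (M t) n) (inv : forall J, X J n -> {t : T & cutmor (M t) J}),
  [/\ forall J g, Xm (projT2 (inv J g)) n (u (projT1 (inv J g))) = g,
      forall J J' (F : cutmor J J') g,
        inv J' (Xm F n g) = existT _ (projT1 (inv J g)) (cutcomp F (projT2 (inv J g))) &
      forall t, good_cut (M t)].

Lemma chains_projective i : projective good_cut (chains_abfun i).
Proof.
case: i => n; last first.
  move=> A B p b _.
  exists (@NatTr _ _ cutcomp (chains_abfun (Negz n)) A (fun J => \0) (fun _ _ _ _ => esym (raddf0 _))).
  by move=> J l; rewrite [l in RHS](@chains_neg _ (Negz n)) // !raddf0.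
have [T [M [u [inv [invK invN goodM]]]]] := models n.
pose L := @free_abfun _ _ cutcomp (fun J => X J n) (fun J J' F => Xm F n)
  (fun J J' J'' G F x => XmC G F x).
have PL : projective good_cut L by apply: projective_free invK invN goodM.
apply: (@projective_retract _ _ _ _ _ L
  (@NatTr _ _ cutcomp (chains_abfun n) L (fun J => idfun) (fun _ _ _ _ => erefl))
  (@NatTr _ _ cutcomp L (chains_abfun n) (fun J => idfun) (fun _ _ _ _ => erefl))) => //.
Qed.
End ChainsProjective.


Definition ord_cut n (Q : ordcat n -> Prop)
    (QP : forall i j : ordcat n, hom i j -> Q j -> Q i) : cutcat :=
  @CutCat (ordcat n) Q QP.

(** If anything is inside, so is the minimum of [[n]], which is initial; the least object outside is
    initial among those outside. *)
Lemma good_ord_cut n Q QP : good_cut (@ord_cut n Q QP).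
Proof.
split=> [i j f g| |]; first exact: bool_irrelevance.
- have [Q0|Q0] := pselect (Q ord0); [left; exists ord0 => // i; constructor; exact: leq0n|].
  by right=> i /(QP _ _ (from0 i)).
have [[i0 Qi0]|NQ] := pselect (exists i, ~ Q i); last first.
  by right=> i; apply: contrapT => Qi; apply: NQ; exists i.
left; have i0P : `[< ~ Q i0 >] by apply/asboolP.
have [i /asboolP Qi imin] := @arg_minnP _ i0 (fun i => `[< ~ Q i >]) (fun i => i : nat) i0P.
by exists i => // j Qj; constructor; apply: imin; apply/asboolP.
Qed.

Lemma nerve_mapC (J J' J'' : cutcat) (G : cutmor J' J'') (F : cutmor J J') n x :
  nerve_map (cutcomp G F) n x = nerve_map G n (nerve_map F n x).
Proof. exact: esym (functor_compA _ _ _). Qed.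

Lemma nerve_fun_inC (J J' J'' : cutcat) (G : cutmor J' J'') (F : cutmor J J') n x :
  nerve_map (fun_in (cutcomp G F)) n x = nerve_map (fun_in G) n (nerve_map (fun_in F) n x).
Proof.
exact: (@functor_eq _ _ (functor_comp (fun_in (cutcomp G F)) x)
    (functor_comp (fun_in G) (functor_comp (fun_in F) x)) erefl).
Qed.

Lemma nerve_fun_outC (J J' J'' : cutcat) (G : cutmor J' J'') (F : cutmor J J') n x :
  nerve_map (fun_out (cutcomp G F)) n x = nerve_map (fun_out G) n (nerve_map (fun_out F) n x).
Proof.
exact: (@functor_eq _ _ (functor_comp (fun_out (cutcomp G F)) x)
    (functor_comp (fun_out G) (functor_comp (fun_out F) x)) erefl).
Qed.

Section NerveModels.
Variable n : nat.

Let Tn := {Q : ordcat n -> Prop | forall i j : ordcat n, hom i j -> Q j -> Q i}.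
Let Mn (t : Tn) : cutcat := ord_cut (proj2_sig t).

Definition pull_cut (J : cutcat) (s : functor (ordcat n) J) : Tn :=
  exist (fun Q : ordcat n -> Prop => forall i j : ordcat n, hom i j -> Q j -> Q i)
    (fun i => cin (s i)) (fun i j f => cinP (fhom s f)).

(** A string is a morphism out of [[n]] once [[n]] carries the cut pulled back along it; the
    universal string is the identity functor. *)
Definition nerve_inv (J : cutcat) (s : functor (ordcat n) J) :
    {t : Tn & cutmor (Mn t) J} :=
  existT _ (pull_cut s) (@CutMor (Mn (pull_cut s)) J s (fun _ p => p) (fun _ p => p)).

(** Since [F] respects both sides, a string and its image pull back equivalent predicates, hence
    equal ones by extensionality; the morphisms are then compared over that equality. *)
Lemma nerve_invN (J J' : cutcat) (F : cutmor J J') (s : functor (ordcat n) J) :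
  nerve_inv (functor_comp F s) =
  existT _ (projT1 (nerve_inv s)) (cutcomp F (projT2 (nerve_inv s))).
Proof.
have e : pull_cut (functor_comp F s) = pull_cut s.
  suff eQ : sval (pull_cut (functor_comp F s)) = sval (pull_cut s).
    move: (pull_cut (functor_comp F s)) (pull_cut s) eQ => [Q q] [Q' q'] /= eQ.
    by subst Q'; rewrite (Prop_irrelevance q q').
  apply: functional_extensionality_dep => i; apply: propositional_extensionality.
  split; last exact: cfun_in.
  by move=> p; apply: contrapT => np; apply: (@cfun_out _ _ F _ np).
rewrite /nerve_inv /=.
have K (t t' : Tn) (et : t = t') (f : cutmor (Mn t) J') (f' : cutmor (Mn t') J') :
    cfun f = cfun f' -> existT (fun t => cutmor (Mn t) J') t f = existT _ t' f'.
  by subst t' => ff'; rewrite (cutmor_eq ff').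
exact: K.
Qed.
End NerveModels.

Section FullModels.
Variables (R : forall J : cutcat, J -> Prop).
Hypothesis RF : forall (J J' : cutcat) (F : cutmor J J') (x : J), R x -> R (F x).
Variable n : nat.
Variable Q : Prop.
Let M := @ord_cut n (fun _ => Q) (fun _ _ _ q => q).
Hypothesis RM : forall i : M, R i.
Hypothesis Rlift : forall (J : cutcat) (s : functor (ordcat n) J),
  (forall i, R (s i)) -> exists f : cutmor M J, cfun f = s.

(** Here [R] is one side of the cut and [Q] is [True] or [False] accordingly, so the model is [[n]]
    lying wholly on that side. The chosen lift is unique by [cutmor_eq]. *)
Definition full_inv (J : cutcat) (s : functor (ordcat n) (full_subcategory (@R J))) :
    {t : unit & cutmor M J} :=
  existT _ tt (sval (cid (Rlift (s := functor_comp (subcategory_incl _) s)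
    (fun i => proj2_sig (s i))))).

Program Definition full_unit : functor (ordcat n) (full_subcategory (@R M)) :=
  @Functor (ordcat n) (full_subcategory (@R M)) (fun i => exist _ i (RM i))
    (fun _ _ f => f) _ _.
Next Obligation. by []. Qed.
Next Obligation. by []. Qed.

Lemma full_invE (J : cutcat) (s : functor (ordcat n) (full_subcategory (@R J))) :
  cfun (projT2 (full_inv s)) = functor_comp (subcategory_incl _) s.
Proof. by rewrite /full_inv /=; case: cid. Qed.

Lemma full_invK (J : cutcat) (s : functor (ordcat n) (full_subcategory (@R J))) :
  functor_comp (sub_functor (@RF _ _ (projT2 (full_inv s)))) full_unit = s.
Proof.
have := full_invE s; move: (projT2 (full_inv s)) => f ef.
move: (@RF _ _ f); rewrite ef => RFf.
exact: (@full_functor_ext _ _ _ (functor_comp (sub_functor RFf) full_unit) s erefl).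
Qed.

Lemma full_invN (J J' : cutcat) (F : cutmor J J')
    (s : functor (ordcat n) (full_subcategory (@R J))) :
  full_inv (functor_comp (sub_functor (@RF _ _ F)) s) =
  existT _ (projT1 (full_inv s)) (cutcomp F (projT2 (full_inv s))).
Proof.
have := full_invE (functor_comp (sub_functor (@RF _ _ F)) s).
have := full_invE s.
move: (projT2 (full_inv s)) => f ef eg.
rewrite {1}/full_inv; congr existT; apply: cutmor_eq; apply: etrans eg _.
rewrite /= ef.
exact: (@functor_eq _ _ (functor_comp (subcategory_incl _) (functor_comp (sub_functor (@RF _ _ F)) s))
  (functor_comp F (functor_comp (subcategory_incl _) s)) erefl).
Qed.
End FullModels.

Lemma ecast_sval (A B : Type) (P : B -> Prop) (s s' : A -> {b | P b})
    (F : (A -> B) -> Type) (e' : s = s')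
    (e : (fun a => sval (s a)) = (fun a => sval (s' a))) u :
  ecast s (F (fun a => sval (s a))) e' u = ecast s (F s) e u.
Proof. by case: _ / e' e => e; rewrite (Prop_irrelevance e erefl). Qed.

Lemma ecast_congr1 (A B : Type) (g : A -> B) (F : B -> Type) (a a' : A) (e : a = a') u :
  ecast d (F d) (congr1 g e) u = ecast b (F (g b)) e u.
Proof. by case: _ / e. Qed.

(** Only the underlying objects in [J] of the two strings are compared, so both equalities can be
    [erefl] when the membership proofs differ. *)
Lemma cut_transport_ext (J : cutcat) n (x y : cut_transport J n)
    (eb : (fun i => sval (base x i)) = (fun i => sval (base y i)))
    (es : (fun i => sval (comma_src (fibre x i))) = (fun i => sval (comma_src (fibre y i)))) :
  (forall i j (f : @hom (ordcat n) i j),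
    ecast s (@hom J (s i) (s j)) eb (fhom (base x) f) = fhom (base y) f) ->
  (forall i, ecast b (@hom J (sval (comma_src (fibre y i))) (b ord0)) eb
     (ecast s (@hom J (s i) (sval (base x ord0))) es (comma_arr (fibre x i))) =
     comma_arr (fibre y i)) ->
  (forall i j (f : @hom (ordcat n) i j),
     ecast s (@hom J (s i) (s j)) es (sval (fhom (fibre x) f)) =
     sval (fhom (fibre y) f)) -> x = y.
Proof.
move=> hb ha hh.
have es' : (fun i => comma_src (fibre x i)) = (fun i => comma_src (fibre y i)).
  apply: functional_extensionality_dep => i; have := congr1 (fun s => s i) es.
  move: (comma_src (fibre x i)) (comma_src (fibre y i)) => [u pu] [v pv] /= euv.
  by subst v; rewrite (Prop_irrelevance pu pv).
apply: (@comma_transport_ext _ _ _ (incl_in J) (incl_out J) n x y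
  (congr1 (fun b => b ord0) eb) es').
- exact: full_functor_ext hb.
- move=> i; rewrite -ha.
  rewrite (@ecast_sval _ _ _ _ _ (fun s => @hom J (s i) (sval (base x ord0))) es' es).
  exact: (@ecast_congr1 _ _ (fun b => b ord0) (fun d => @hom J (sval (comma_src (fibre y i))) d)).
- move=> i j f; rewrite -hh.
  by rewrite (@ecast_sval _ _ _ _ _ (fun s => @hom J (s i) (s j)) es' es).
Qed.

Section LexModel.
Variable n : nat.

(** The [false] copy of [[n]] carries the string of the fibre, the [true] copy that of the base. *)
Definition lex_le (p q : bool * 'I_n.+1) : bool :=
  match p, q with
  | (false, _), (true, _) => true
  | (true, _), (false, _) => false
  | (_, i), (_, j) => (i <= j)%N
  end.

Lemma lex_refl p : lex_le p p.
Proof. by case: p => [[] i] /=. Qed.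

Lemma lex_trans p q r : lex_le q r -> lex_le p q -> lex_le p r.
Proof. by case: p q r => [[] i] [[] j] [[] k] //= jk ij; apply: leq_trans ij jk. Qed.

Program Definition lex_cat : category :=
  @Category (bool * 'I_n.+1) (fun p q => lex_le p q) lex_refl lex_trans _ _ _.
Next Obligation. by move=> *; exact: bool_irrelevance. Qed.
Next Obligation. by move=> *; exact: bool_irrelevance. Qed.
Next Obligation. by move=> *; exact: bool_irrelevance. Qed.

Lemma lex_closed (p q : lex_cat) : hom p q -> q.1 = false -> p.1 = false.
Proof. by case: p q => [[] i] [[] j]. Qed.

(* The join [n] * [n], cut in the middle. *)
Definition lex_cut : cutcat := CutCat lex_closed.

Lemma good_lex_cut : good_cut lex_cut.
Proof.
split=> [p q f g| |]; first exact: bool_irrelevance.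
  by left; exists (false, ord0) => // -[[] i]; constructor.
left; exists (true, ord0); first by move=> h; have : true = false := h.
by case=> [[] i] p; [constructor | case: (p erefl)].
Qed.

Lemma lex_true_out (i : 'I_n.+1) : ~ @cin lex_cut (true, i).
Proof. by move=> h; have : true = false := h. Qed.

Program Definition lex_base : functor (ordcat n) (cut_out lex_cut) :=
  @Functor (ordcat n) (cut_out lex_cut)
    (fun i => exist _ (true, i) (@lex_true_out i)) (fun i j f => f) _ _.
Next Obligation. by move=> *; exact: bool_irrelevance. Qed.
Next Obligation. by move=> *; exact: bool_irrelevance. Qed.

Program Definition lex_fibre :
    functor (ordcat n) (comma (incl_in lex_cut) ((true, ord0) : lex_cut)) :=
  @Functor (ordcat n) (comma (incl_in lex_cut) ((true, ord0) : lex_cut))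
    (fun i => @CommaOb _ _ (incl_in lex_cut) ((true, ord0) : lex_cut)
       (exist _ (false, i) erefl) isT)
    (fun i j f => exist _ f _) _ _.
Next Obligation. by move=> *; exact: bool_irrelevance. Qed.
Next Obligation. by move=> *; apply: comma_hom_eq; exact: bool_irrelevance. Qed.
Next Obligation. by move=> *; apply: comma_hom_eq; exact: bool_irrelevance. Qed.

Definition lex_unit : cut_transport lex_cut n :=
  @TransportSimplex _ (cat_functor_comp (comma_functor (incl_in lex_cut)) (incl_out lex_cut))
    n n lex_base lex_fibre.

Section Reconstruction.
Variables (J : cutcat) (x : cut_transport J n).

Definition rec_ob (p : lex_cat) : J :=
  match p with
  | (false, i) => sval (comma_src (fibre x i))
  | (true, i) => sval (base x i)
  end.

(** An arrow between the two copies becomes [c_i -> d_0 -> d_j]. Functoriality across the copies is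
    the compatibility of the fibre with its arrows to [d_0]. *)
Definition rec_hom (p q : lex_cat) : hom p q -> hom (rec_ob p) (rec_ob q) :=
  match p, q return @hom lex_cat p q -> hom (rec_ob p) (rec_ob q) with
  | (false, i), (false, j) => fun f => sval (fhom (fibre x) (f : @hom (ordcat n) i j))
  | (true, i), (true, j) => fun f => fhom (base x) (f : @hom (ordcat n) i j)
  | (false, i), (true, j) => fun _ =>
      comp (fhom (incl_out J) (fhom (base x) (from0 j))) (comma_arr (fibre x i))
  | (true, i), (false, j) => fun f => False_rect _ (notF f)
  end.

Program Definition rec_functor : functor lex_cut J :=
  @Functor lex_cut J rec_ob rec_hom _ _.
Next Obligation.
case=> [[] i].
  apply: etrans _ (fhom1 (base x) i) => /=.
  by congr (fhom (base x) _); apply: bool_irrelevance.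
apply: etrans _ (congr1 sval (fhom1 (fibre x) i)) => /=.
by congr (sval (fhom (fibre x) _)); apply: bool_irrelevance.
Qed.
Next Obligation.
case=> [[] i] [[] j] [[] k] //= g f.
- apply: etrans _ (fhomM (base x) (g : @hom (ordcat n) j k) (f : @hom (ordcat n) i j)).
  by congr (fhom (base x) _); apply: bool_irrelevance.
- rewrite compA; congr (comp _ _).
  apply: etrans _ (fhomM (base x) (g : @hom (ordcat n) j k) (from0 j)).
  by congr (fhom (base x) _); apply: bool_irrelevance.
- rewrite -compA; congr (comp _ _); apply: esym.
  exact: (svalP (fhom (fibre x) (f : @hom (ordcat n) i j))).
- apply: etrans _ (congr1 sval (fhomM (fibre x) (g : @hom (ordcat n) j k)
    (f : @hom (ordcat n) i j))).
  by congr (sval (fhom (fibre x) _)); apply: bool_irrelevance.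
Qed.

Lemma rec_in p : @cin lex_cut p -> cin (rec_functor p).
Proof. by case: p => [[] i] // _; exact: (proj2_sig (comma_src (fibre x i))). Qed.

Lemma rec_out p : ~ @cin lex_cut p -> ~ cin (rec_functor p).
Proof. by case: p => [[] i] // h; [exact: (proj2_sig (base x i)) | case: (h erefl)]. Qed.

Definition rec_mor : cutmor lex_cut J := CutMor rec_in rec_out.

Lemma rec_morK : cut_transport_map rec_mor n lex_unit = x.
Proof.
refine (@cut_transport_ext _ _ (cut_transport_fun rec_mor lex_unit) x erefl erefl _ _ _) => //.
(* The arrow to [d_0] comes back composed with the image of [0 <= 0], an identity by [fhom1]
   only. *)
move=> i; apply: etrans _ (comp1m _); congr (comp _ _).
apply: etrans _ (fhom1 (base x) ord0); congr (fhom (base x) _).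
exact: bool_irrelevance.
Qed.
End Reconstruction.

Lemma rec_morN (J J' : cutcat) (F : cutmor J J') (x : cut_transport J n) :
  rec_mor (cut_transport_map F n x) = cutcomp F (rec_mor x).
Proof.
apply: cutmor_eq.
pose e (p : lex_cat) : rec_ob (cut_transport_map F n x) p = F (rec_ob x p) :=
  match p return rec_ob (cut_transport_map F n x) p = F (rec_ob x p) with
  | (false, _) => erefl
  | (true, _) => erefl
  end.
apply: (@functor_ext lex_cat J' (rec_functor (cut_transport_map F n x))
  (functor_comp F (rec_functor x)) e).
by case=> [[] i] [[] j] //= f; rewrite fhomM.
Qed.
End LexModel.

Section CutProjective.

Lemma nerve_projective i :
  projective good_cut (chains_abfun (X := fun J => nerve J) nerve_mapC i).
Proof.
apply: chains_projective => n.
exists {Q : ordcat n -> Prop | forall i j : ordcat n, hom i j -> Q j -> Q i}.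
exists (fun t => ord_cut (proj2_sig t)), (fun t => functor_id (ordcat n)), (@nerve_inv n).
split=> [J s|J J' F s|t].
- exact: functor_compf1.
- exact: nerve_invN.
exact: good_ord_cut.
Qed.

Lemma nerve_in_projective i :
  projective good_cut (chains_abfun (X := fun J => nerve (cut_in J)) nerve_fun_inC i).
Proof.
apply: chains_projective => n.
have lift (J : cutcat) (s : functor (ordcat n) J) : (forall i, cin (s i)) ->
    exists f : cutmor (@ord_cut n (fun _ => True) (fun _ _ _ q => q)) J, cfun f = s.
  move=> sP; unshelve eexists (@CutMor (ord_cut _) J s _ _) => //.
  by move=> x [].
exists unit, (fun _ => @ord_cut n (fun _ => True) (fun _ _ _ q => q)).
exists (fun _ => @full_unit (@cin) n True (fun _ => I)), (@full_inv _ n _ lift).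
split=> [J s|J J' F s|t].
- exact: full_invK.
- exact: full_invN.
exact: good_ord_cut.
Qed.

Lemma nerve_out_projective i :
  projective good_cut (chains_abfun (X := fun J => nerve (cut_out J)) nerve_fun_outC i).
Proof.
apply: chains_projective => n.
have lift (J : cutcat) (s : functor (ordcat n) J) : (forall i, ~ cin (s i)) ->
    exists f : cutmor (@ord_cut n (fun _ => False) (fun _ _ _ q => q)) J, cfun f = s.
  move=> sP; unshelve eexists (@CutMor (ord_cut _) J s _ _) => //.
exists unit, (fun _ => @ord_cut n (fun _ => False) (fun _ _ _ q => q)).
exists (fun _ => @full_unit (fun J x => ~ @cin J x) n False (fun _ f => f)).
exists (@full_inv (fun J x => ~ @cin J x) n _ lift).
split=> [J s|J J' F s|t].
- exact: full_invK.
- exact: full_invN.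
exact: good_ord_cut.
Qed.

Lemma transport_projective i :
  projective good_cut (chains_abfun (X := cut_transport) cut_transport_mapC i).
Proof.
apply: chains_projective => n.
exists unit, (fun _ => lex_cut n), (fun _ => lex_unit n), (fun J x => existT _ tt (rec_mor x)).
split=> [J s|J J' F s|t].
- exact: rec_morK.
- by rewrite /= rec_morN.
exact: good_lex_cut.
Qed.

(** In degree [i] the cone of a map of cones is a sum of four free functors: strings of [J] in
    degree [i], strings inside and strings outside in degree [i - 1], transport simplices in degree
    [i - 2]. *)
Lemma cut_complex_projective i :
  projective good_cut (degree_abfun cut_mapC i).
Proof.
pose L1 := prod_abfun (chains_abfun (X := fun J => nerve J) nerve_mapC i)
  (chains_abfun (X := fun J => nerve (cut_in J)) nerve_fun_inC (i - 1)).
pose L2 := prod_abfun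
  (chains_abfun (X := fun J => nerve (cut_out J)) nerve_fun_outC (i - 1))
  (chains_abfun (X := cut_transport) cut_transport_mapC (i - 1 - 1)).
have P : projective good_cut (prod_abfun L1 L2).
  apply: projective_prod; apply: projective_prod.
  - exact: nerve_projective.
  - exact: nerve_in_projective.
  - exact: nerve_out_projective.
  - exact: transport_projective.
have E J J' (F : cutmor J J') (x : prod_abfun L1 L2 J) :
    cut_map F i x = afm (prod_abfun L1 L2) F x.
  by rewrite /cut_map /cut_source /cut_target !cone_mapE.
apply: (@projective_retract _ _ _ _ _ _
  (@NatTr _ _ _ (degree_abfun cut_mapC i) (prod_abfun L1 L2) (fun J => idfun) E)
  (@NatTr _ _ _ (prod_abfun L1 L2) (degree_abfun cut_mapC i) (fun J => idfun)
    (fun J J' F x => esym (E J J' F x))) _ P) => //.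
Qed.
End CutProjective.

(** * Acyclicity on the models *)

Lemma chains_empty (X : sset) i (z : chains X i) : (forall n, X n -> False) -> z = 0.
Proof.
move=> X0; apply: (@free_group_ext _ _ idfun \0).
by case: i z => n _ x; [case: (X0 n x) | case: x].
Qed.

Lemma qis_zero (X Y : complex) (f : chain_map X Y) :
  (forall i (x : X i), x = 0) -> (forall i (y : Y i), y = 0) -> qis f.
Proof.
by move=> X0 Y0; apply: qis_acyclic => i z _; [rewrite [z]X0 | rewrite [z]Y0];
  apply: bdr0.
Qed.

Lemma qis_chains_bij (X Y : sset) (f : sset_map X Y) :
  (forall n, bijective (f n)) -> qis (chains_map f).
Proof.
move=> fb; apply: qis_bij => i.
have [g fK gK] : bijective (@smapz X Y f i) by case: i => // n; exists id.
pose G := free_lift (fun y => gen (g y)) : free_group _ -> free_group _.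
exists G.
  apply: (@free_group_ext _ _ (free_lift (fun y => gen (g y)) \o chains_map f i) idfun) => x.
  by rewrite /= !free_lift_gen fK.
apply: (@free_group_ext _ _ (chains_map f i \o free_lift (fun y => gen (g y))) idfun) => x.
by rewrite /= !free_lift_gen gK.
Qed.

Section FullAll.
Variables (B : category) (P : B -> Prop) (PT : forall b, P b).

Program Definition full_all : functor B (full_subcategory P) :=
  @Functor B (full_subcategory P) (fun b => exist _ b (PT b)) (fun _ _ f => f) _ _.
Next Obligation. by []. Qed.
Next Obligation. by []. Qed.

Lemma qis_full_all : qis (cat_chains_map (subcategory_incl P)).
Proof.
apply: qis_chains_bij => n; exists (fun s => functor_comp full_all s) => s /=.
  exact: (@full_functor_ext _ _ _
    (functor_comp full_all (functor_comp (subcategory_incl P) s)) s erefl).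
exact: (@functor_eq _ _ (functor_comp (subcategory_incl P) (functor_comp full_all s)) s erefl).
Qed.
End FullAll.

Lemma nerve_empty (B : category) : (B -> False) -> forall n, nerve B n -> False.
Proof. by move=> B0 n s; apply: B0 (s ord0). Qed.

Definition const_functor (A B : category) (b : B) : functor A B :=
  @Functor A B (fun _ => b) (fun _ _ _ => idm b) (fun _ => erefl)
    (fun _ _ _ _ _ => esym (comp1m _)).

Section Initial.
Variables (A : category) (a0 : A).
Hypothesis thin : forall (x y : A) (f g : hom x y), f = g.
Hypothesis a0P : forall y, inhabited (hom a0 y).

Let init_arr y : hom a0 y := sval (cid (let: inhabits f := a0P y in ex_intro (fun=> True) f I)).

(** The arrows out of the initial object go from the constant functor to the identity, and are
    natural because [A] is thin. *)
Lemma qis_to_point : qis (cat_chains_map (const_functor A (ord0 : ordcat 0))).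
Proof.
pose pt := const_functor A (ord0 : ordcat 0).
pose i0 := const_functor (ordcat 0) a0.
apply: (@qis_inverse _ _ _ (cat_chains_map i0)
  (cat_chains_map (functor_comp i0 pt)) (cat_chains_map (functor_comp pt i0))).
- move=> i x; rewrite /cat_chains_map -chains_map_comp; apply: chains_map_ext => n y.
  exact: esym (functor_compA _ _ _).
- move=> i x; rewrite /cat_chains_map -chains_map_comp; apply: chains_map_ext => n y.
  exact: esym (functor_compA _ _ _).
- move=> i x cx; rewrite -opprB; apply: bdrN.
  have := @nerve_homotopy_bdr A A (functor_comp i0 pt) (functor_id A) init_arr
    (fun _ _ _ => thin _ _) i x cx.
  by rewrite [cat_chains_map (functor_id A) i x]chains_map_id // => n y; exact: functor_comp1f.
move=> i x _; rewrite chains_map_id ?subrr => [|n y]; first exact: bdr0.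
by apply: functor_ordcat_eq => j; apply: ord_inj; case: (y j) => -[].
Qed.
End Initial.

Lemma qis_initial (A B : category) (F : functor A B) (a0 : A) (b0 : B) :
  (forall (x y : A) (f g : hom x y), f = g) -> (forall y, inhabited (hom a0 y)) ->
  (forall (x y : B) (f g : hom x y), f = g) -> (forall y, inhabited (hom b0 y)) ->
  qis (cat_chains_map F).
Proof.
move=> tA iA tB iB; apply: qis_right (qis_to_point tA iA) (qis_to_point tB iB) => i x.
rewrite /cat_chains_map -chains_map_comp; apply: chains_map_ext => n y.
by apply: functor_ordcat_eq.
Qed.

Section ThinTransport.
Variables (J : cutcat).
Hypothesis thin : forall (x y : J) (f g : hom x y), f = g.

Lemma thin_transport_ext n (x y : cut_transport J n) :
  (forall i, sval (base x i) = sval (base y i)) ->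
  (forall i, sval (comma_src (fibre x i)) = sval (comma_src (fibre y i))) -> x = y.
Proof.
move=> hb hs.
have eb : (fun i => sval (base x i)) = (fun i => sval (base y i)).
  exact: functional_extensionality_dep.
have es : (fun i => sval (comma_src (fibre x i))) = (fun i => sval (comma_src (fibre y i))).
  exact: functional_extensionality_dep.
by apply: (cut_transport_ext (eb := eb) (es := es)) => *; exact: thin.
Qed.

Lemma comma_thin (d : J) (x y : comma (incl_in J) d) (f g : hom x y) : f = g.
Proof. by apply: comma_hom_eq; apply: thin. Qed.

Variables (x0 : J) (x0in : cin x0) (x0P : forall y, inhabited (hom x0 y)).

Let init_arr y : hom x0 y := sval (cid (let: inhabits f := x0P y in ex_intro (fun=> True) f I)).

Let init_comma (d : J) : comma (incl_in J) d :=
  @CommaOb _ _ (incl_in J) d (exist _ x0 x0in) (init_arr d).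

(** A section of the projection to the base: over [d_0], the constant string at the initial object
    [x0 -> d_0] of the comma category. The homotopy below moves any fibre to it. *)
Definition init_transport_fun n (b : nerve (cut_out J) n) : cut_transport J n :=
  @TransportSimplex _ (cat_functor_comp (comma_functor (incl_in J)) (incl_out J)) n n
    b (const_functor (ordcat n) (init_comma (sval (b ord0)))).

Lemma init_transport_proof m n (a : functor (ordcat m) (ordcat n)) b :
  init_transport_fun (sact a b) = sact a (init_transport_fun b).
Proof. exact: thin_transport_ext. Qed.

Definition init_transport : sset_map (nerve (cut_out J)) (cut_transport J) :=
  @SSetMap (nerve (cut_out J)) (cut_transport J) init_transport_fun init_transport_proof.

Let init_comma_hom (d : J) (c : comma (incl_in J) d) : hom (init_comma d) c :=
  exist _ (init_arr _) (thin _ _).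

Definition init_homotopy_fun n (x : cut_transport J n) t : cut_transport J n :=
  @TransportSimplex _ (cat_functor_comp (comma_functor (incl_in J)) (incl_out J)) n n
    (base x)
    (@mix (ordcat n) (comma (incl_in J) (incl_out J (base x ord0)))
      (const_functor _ (init_comma _)) (fibre x)
      (fun i => init_comma_hom (fibre x i)) (fun i j f => comma_thin _ _)
      (level t) (@levelP n t)).

Lemma init_homotopy_proof m n (a : functor (ordcat m) (ordcat n)) x t :
  init_homotopy_fun (sact a x) (functor_comp t a) = sact a (init_homotopy_fun x t).
Proof.
apply: (@thin_transport_ext _ (init_homotopy_fun (sact a x) (functor_comp t a))
  (sact a (init_homotopy_fun x t))) => // i.
rewrite /=.
have -> : level (functor_comp t a) i = level t (a i) by [].
by case: (level t (a i)).
Qed.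

Definition init_homotopy : shomotopy (cut_transport J) (cut_transport J) :=
  @SHomotopy (cut_transport J) (cut_transport J) init_homotopy_fun init_homotopy_proof.

Lemma qis_init_transport :
  qis (functor_chains_map (cat_functor_comp (comma_functor (incl_in J)) (incl_out J))).
Proof.
set p := transport_proj (cat_functor_comp (comma_functor (incl_in J)) (incl_out J)).
apply: (@qis_inverse _ _ _ (chains_map init_transport)
  (chains_map (sset_comp init_transport p)) (chains_map (sset_comp p init_transport))).
- by move=> i x; rewrite chains_map_comp.
- by move=> i x; rewrite chains_map_comp.
- move=> i x cx; rewrite -opprB; apply: bdrN.
  rewrite -[X in X - _](@chains_map_id _ (sset_id _)) //.
  apply: (@shomotopy_bdr _ _ init_homotopy) => // n y; apply: thin_transport_ext => // k /=.
    by rewrite level_top.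
  by rewrite level_bot.
by move=> i x _; rewrite chains_map_id ?subrr //; exact: bdr0.
Qed.
End ThinTransport.

(** With nothing inside the cut, the transport and the inner strings vanish, and what remains is the
    inclusion of the outside, which is all of [J]. Otherwise both cones are acyclic: the transport
    retracts to its base, and the inclusion of the inside is a quasi-isomorphism. *)
Lemma good_cut_acyclic (J : cutcat) : good_cut J -> acyclic (cut_complex J).
Proof.
move=> [thin hin hout]; apply/qis_coneP.
pose p := functor_chains_map (cat_functor_comp (comma_functor (incl_in J)) (incl_out J)).
pose c := cat_chains_map (incl_in J).
have [[x0 x0in x0P]|hin0] := hin; last first.
  have in0 : cut_in J -> False by move=> [x /hin0].
  have X0 i (z : chains (cut_transport J) i) : z = 0.
    by apply: chains_empty => n x; apply: in0 (comma_src (fibre x ord0)).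
  have C0 i (z : cat_chains (cut_in J) i) : z = 0 by apply: chains_empty => n; apply: nerve_empty.
  by apply: qis_lax_cone; [exact: qis_zero | exact: qis_full_all].
suff [qp qc] : qis p /\ qis c by apply: qis_acyclic; apply/qis_coneP.
split; first exact: qis_init_transport thin x0 x0in x0P.
have [[x1 x1out x1P]|hout0] := hout; last exact: qis_full_all.
apply: (@qis_initial _ _ (incl_in J) (exist _ x0 x0in) x0) => //.
- by move=> x y f g; apply: thin.
- by move=> y; apply: x0P.
Qed.

Theorem cut_complex_contractible (J : cutcat) : contractible (cut_complex J).
Proof.
apply: acyclic_models cut_complex_projective _ good_cut_acyclic J => J n x.
have neg k : (Negz n - k%:Z < 0)%R by lia.
case: x => [[y c] [z w]].
rewrite [y](@chains_neg _ (Negz n)) // [c](@chains_neg _ (Negz n - 1)) //.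
by rewrite [z](@chains_neg _ (Negz n - 1)) // [w](@chains_neg _ (Negz n - 1 - 1)) //; lia.
Qed.

(** * Cellular functors *)

(* A functor over [D] up to a natural transformation [T' A => T] acts on the
   transports of the comma categories. *)
Section LaxTransport.
Variables (C C' D E : category) (T : functor C D) (T' : functor C' D).
Variables (I : functor E D) (A : functor C C').
Variable phi : forall c, hom (T' (A c)) (T c).
Hypothesis phiP : forall c c' (f : hom c c'),
  comp (phi c') (fhom T' (fhom A f)) = comp (fhom T f) (phi c).

Section LaxComma.
Variable d : D.

Definition lax_comma_ob (x : comma T d) : comma T' d :=
  @CommaOb _ _ T' d (A (comma_src x)) (comp (comma_arr x) (phi _)).

Program Definition lax_comma_hom (x y : comma T d) (f : hom x y) :
  hom (lax_comma_ob x) (lax_comma_ob y) := exist _ (fhom A (sval f)) _.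
Next Obligation. by move=> x y [f ef] /=; rewrite -compA phiP compA ef. Qed.

Program Definition lax_comma : functor (comma T d) (comma T' d) :=
  @Functor _ _ lax_comma_ob lax_comma_hom _ _.
Next Obligation. by move=> x; apply: comma_hom_eq; apply: fhom1. Qed.
Next Obligation. by move=> x y z g f; apply: comma_hom_eq; apply: fhomM. Qed.
End LaxComma.

Definition lax_transport_fun n (x : comma_transport T I n) : comma_transport T' I n :=
  @TransportSimplex _ (cat_functor_comp (comma_functor T') I) n n
    (base x) (functor_comp (lax_comma _) (fibre x)).

Lemma lax_transport_proof m n (a : functor (ordcat m) (ordcat n)) (x : comma_transport T I n) :
  lax_transport_fun (sact a x) = sact a (lax_transport_fun x).
Proof.
apply: (@comma_transport_ext _ _ _ _ _ _ (lax_transport_fun (transport_act a a x))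
  (transport_act a a (lax_transport_fun x)) erefl erefl) => //=.
by move=> i; rewrite compA.
Qed.

Definition lax_transport : sset_map (comma_transport T I) (comma_transport T' I) :=
  @SSetMap (comma_transport T I) (comma_transport T' I) lax_transport_fun lax_transport_proof.
End LaxTransport.

Section LaxHomotopy.
Variables (C D E : category) (T : functor C D) (I : functor E D) (A : functor C C).
Variable eta : forall c, hom (A c) c.
Hypothesis etaP : forall c c' (f : hom c c'),
  comp (eta c') (fhom A f) = comp f (eta c).

Lemma lax_etaP c c' (f : hom c c') :
  comp (fhom T (eta c')) (fhom T (fhom A f)) = comp (fhom T f) (fhom T (eta c)).
Proof. by rewrite -!fhomM etaP. Qed.

Section Fibre.
Variables (n : nat) (d : D) (x : functor (ordcat n) (comma T d)).
Variables (t : ordcat n -> bool) (tP : forall i j : ordcat n, hom i j -> t i -> t j).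

Definition lax_src : functor (ordcat n) C :=
  @mix (ordcat n) C (functor_comp A (functor_comp (comma_src_functor T d) x))
    (functor_comp (comma_src_functor T d) x) (fun i => eta (comma_src (x i)))
    (fun i j f => etaP (sval (fhom x f))) t tP.

Definition lax_arr i : hom (T (lax_src i)) d :=
  match t i as b return
    hom (T (if b then comma_src (x i) else A (comma_src (x i)))) d with
  | true => comma_arr (x i)
  | false => comp (comma_arr (x i)) (fhom T (eta _))
  end.

Lemma lax_arrP i j (f : @hom (ordcat n) i j) :
  comp (lax_arr j) (fhom T (fhom lax_src f)) = lax_arr i.
Proof.
have xf := svalP (fhom x f).
rewrite /lax_arr /= /mix_hom; move: (tP f).
case: (t i) (t j) => [] [] h //=; first by case: (notF (h isT)).
  by rewrite etaP fhomM compA xf.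
by rewrite -compA lax_etaP compA xf.
Qed.

Program Definition lax_fibre : functor (ordcat n) (comma T d) :=
  @Functor (ordcat n) (comma T d) (fun i => CommaOb (lax_arr i))
    (fun i j f => exist _ (fhom lax_src f) (lax_arrP f)) _ _.
Next Obligation. by move=> i; apply: comma_hom_eq; apply: fhom1. Qed.
Next Obligation. by move=> i j k g f; apply: comma_hom_eq; apply: fhomM. Qed.
End Fibre.

Lemma lax_fibre_true n d x t tP : (forall i, t i = true) -> @lax_fibre n d x t tP = x.
Proof.
move=> t1; have e : t = fun=> true by apply: functional_extensionality_dep.
by subst t; apply: (@comma_functor_ext _ _ _ _ _ (lax_fibre x tP) x erefl).
Qed.

Lemma lax_fibre_false n d x t tP : (forall i, t i = false) ->
  @lax_fibre n d x t tP = functor_comp (lax_comma lax_etaP d) x.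
Proof.
move=> t1; have e : t = fun=> false by apply: functional_extensionality_dep.
by subst t; apply: (@comma_functor_ext _ _ _ _ _ (lax_fibre x tP)
  (functor_comp (lax_comma lax_etaP d) x) erefl).
Qed.

Definition lax_homotopy_fun n (x : comma_transport T I n) t : comma_transport T I n :=
  @TransportSimplex _ (cat_functor_comp (comma_functor T) I) n n
    (base x) (lax_fibre (fibre x) (@levelP n t)).

Lemma lax_homotopy_proof m n (a : functor (ordcat m) (ordcat n)) x t :
  lax_homotopy_fun (sact a x) (functor_comp t a) = sact a (lax_homotopy_fun x t).
Proof.
apply: (@comma_transport_ext _ _ _ _ _ _ (lax_homotopy_fun (transport_act a a x) (functor_comp t a))
  (transport_act a a (lax_homotopy_fun x t)) erefl erefl) => //=.
  move=> i; rewrite /lax_arr /=.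
  change (level (functor_comp t a) i) with (level t (a i)).
  by case: (level t (a i)); rewrite //= compA.
by move=> i j f; rewrite /mix_hom; apply: mixhom_eq.
Qed.

Definition lax_homotopy : shomotopy (comma_transport T I) (comma_transport T I) :=
  @SHomotopy (comma_transport T I) (comma_transport T I) lax_homotopy_fun lax_homotopy_proof.

(** The homotopy fixes the base and moves the fibre from [A c] to [c] along [eta]. *)
Lemma lax_transport_bdr i (z : chains (comma_transport T I) i) : cyc z ->
  bdr (chains_map (lax_transport I lax_etaP) i z - z).
Proof.
move=> cz; rewrite -opprB; apply: bdrN.
rewrite -[X in X - _](@chains_map_id _ (sset_id _)) //.
apply: (@shomotopy_bdr _ _ lax_homotopy) => // n y.
  rewrite /= /lax_homotopy_fun lax_fibre_true //.
  exact: level_top.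
rewrite /= /lax_homotopy_fun lax_fibre_false //.
exact: level_bot.
Qed.
End LaxHomotopy.

Lemma qis_sset_id (X : sset) : qis (chains_map (sset_id X)).
Proof. by apply: qis_chains_bij => n; exists id. Qed.

(** Equalities of objects become arrows, so that the chosen preimages under [T] are handled by
    composition instead of casts. *)
Definition eqhom (D : category) (x y : D) (e : x = y) : hom x y :=
  ecast z (hom x z) e (idm x).

Lemma eqhomK (D : category) (x y : D) (e : x = y) (e' : y = x) :
  comp (eqhom e') (eqhom e) = idm x.
Proof. by case: _ / e e' => e'; rewrite (Prop_irrelevance e' erefl) /= comp1m. Qed.

Section Cellular.
Variables (C D : category) (T : functor C D).
Hypothesis hT : cellular T.

Lemma cellular_lift x y (g : hom (T x) (T y)) : exists f : hom x y, fhom T f = g.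
Proof. by have [h _ hK] := hT.1 x y; exists (h g). Qed.

Definition fullinv x y (g : hom (T x) (T y)) : hom x y := sval (cid (cellular_lift g)).

Lemma fullinvK x y (g : hom (T x) (T y)) : fhom T (fullinv g) = g.
Proof. by rewrite /fullinv; case: cid. Qed.

Lemma cellular_inj x y (f g : hom x y) : fhom T f = fhom T g -> f = g.
Proof. exact: bij_inj (hT.1 x y) f g. Qed.

Lemma cellular_closed (x y : D) : hom x y -> in_image T y -> in_image T x.
Proof.
move=> f [c ec]; apply: contrapT => nx; subst y; exact: hT.2 nx f.
Qed.

Definition image_cut : cutcat := @CutCat D (in_image T) cellular_closed.

Program Definition to_image : functor C (cut_in image_cut) :=
  @Functor C (cut_in image_cut) (fun c => exist _ (T c) (ex_intro _ c erefl))
    (fun _ _ f => fhom T f) _ _.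
Next Obligation. by move=> x; apply: fhom1. Qed.
Next Obligation. by move=> x y z g f; apply: fhomM. Qed.

Definition lift_ob (x : cut_in image_cut) : C := sval (cid (proj2_sig x)).

Lemma lift_obK x : T (lift_ob x) = sval x.
Proof. by rewrite /lift_ob; case: cid. Qed.

Definition lift_arr (x : cut_in image_cut) : @hom D (T (lift_ob x)) (sval x) :=
  eqhom (lift_obK x).

Definition lift_hom (x y : cut_in image_cut) (f : hom x y) : hom (lift_ob x) (lift_ob y) :=
  fullinv (comp (eqhom (esym (lift_obK y))) (comp (f : @hom D (sval x) (sval y)) (lift_arr x))).

Lemma lift_homP (x y : cut_in image_cut) (f : hom x y) :
  comp (lift_arr y) (fhom T (lift_hom f)) = comp (f : @hom D (sval x) (sval y)) (lift_arr x).
Proof. by rewrite fullinvK compA eqhomK comp1m. Qed.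

(** Cancels the invertible [lift_arr] and the faithful [T] together; functoriality of [from_image]
    is checked through it. *)
Lemma lift_arr_mono (x : cut_in image_cut) c (f g : hom c (lift_ob x)) :
  comp (lift_arr x) (fhom T f) = comp (lift_arr x) (fhom T g) -> f = g.
Proof.
move=> /(congr1 (comp (eqhom (esym (lift_obK x))))).
by rewrite !compA !eqhomK !comp1m => /cellular_inj.
Qed.

Program Definition from_image : functor (cut_in image_cut) C :=
  @Functor (cut_in image_cut) C lift_ob lift_hom _ _.
Next Obligation.
by move=> x; apply: lift_arr_mono; rewrite lift_homP fhom1 compm1 /= comp1m.
Qed.
Next Obligation.
move=> x y z g f; apply: lift_arr_mono.
by rewrite lift_homP fhomM compA lift_homP -compA lift_homP /= compA.
Qed.

(** The chosen preimage of [T c] may differ from [c]; fullness provides the arrow that compares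
    them. *)
Definition unit_arr (c : C) : hom (from_image (to_image c)) c := fullinv (lift_arr (to_image c)).

Lemma unit_arrP c c' (f : hom c c') :
  comp (unit_arr c') (fhom (functor_comp from_image to_image) f) = comp f (unit_arr c).
Proof.
apply: cellular_inj; rewrite !fhomM ![fhom T (unit_arr _)]fullinvK.
exact: (lift_homP (fhom to_image f)).
Qed.

Lemma qis_to_image : qis (cat_chains_map to_image).
Proof.
apply: (@qis_inverse _ _ _ (cat_chains_map from_image)
  (cat_chains_map (functor_comp from_image to_image))
  (cat_chains_map (functor_comp to_image from_image))).
- move=> i x; rewrite /cat_chains_map -chains_map_comp; apply: chains_map_ext => n y.
  exact: esym (functor_compA _ _ _).
- move=> i x; rewrite /cat_chains_map -chains_map_comp; apply: chains_map_ext => n y.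
  exact: esym (functor_compA _ _ _).
- move=> i x cx; rewrite -opprB; apply: bdrN.
  have := @nerve_homotopy_bdr C C (functor_comp from_image to_image) (functor_id C)
    unit_arr unit_arrP i x cx.
  by rewrite [cat_chains_map (functor_id C) i x]chains_map_id // => n y; exact: functor_comp1f.
move=> i x cx; rewrite -opprB; apply: bdrN.
have := @nerve_homotopy_bdr _ _ (functor_comp to_image from_image) (functor_id (cut_in image_cut))
    lift_arr (fun x y f => lift_homP f) i x cx.
by rewrite [cat_chains_map (functor_id (cut_in image_cut)) i x]chains_map_id // => n y; exact: functor_comp1f.
Qed.

Let I := incl_out image_cut.

Lemma to_imageP c c' (f : hom c c') :
  comp (idm (T c')) (fhom (incl_in image_cut) (fhom to_image f)) = comp (fhom T f) (idm (T c)).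
Proof. by rewrite comp1m compm1. Qed.

Definition transport_to_image :
    sset_map (comma_transport T I) (cut_transport image_cut) :=
  @lax_transport _ _ _ _ T (incl_in image_cut) I to_image (fun c => idm (T c)) to_imageP.

Definition transport_from_image :
    sset_map (cut_transport image_cut) (comma_transport T I) :=
  @lax_transport _ _ _ _ (incl_in image_cut) T I from_image lift_arr (fun x y f => lift_homP f).

(** The equivalence acts on the fibres alone. Each composite is the map induced by [unit_arr] or by
    [lift_arr], to which [lax_transport_bdr] applies. *)
Lemma qis_transport_to_image : qis (chains_map transport_to_image).
Proof.
apply: (@qis_inverse _ _ _ (chains_map transport_from_image)
  (chains_map (lax_transport I (lax_etaP T unit_arrP)))
  (chains_map (lax_transport I (lax_etaP (incl_in image_cut)
     (A := functor_comp to_image from_image) (eta := lift_arr) (fun x y f => lift_homP f))))).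
- move=> i x; rewrite -chains_map_comp; apply: chains_map_ext => n y.
  apply: (@comma_transport_ext _ _ _ T I n (lax_transport I (lax_etaP T unit_arrP) n y)
    (transport_from_image n (transport_to_image n y)) erefl erefl) => //=.
  by move=> j; rewrite compm1 fullinvK.
- move=> i x; rewrite -chains_map_comp; apply: chains_map_ext => n y.
  apply: (@comma_transport_ext _ _ _ (incl_in image_cut) I n
    (lax_transport I (lax_etaP (incl_in image_cut)
     (A := functor_comp to_image from_image) (eta := lift_arr) (fun x y f => lift_homP f)) n y)
    (transport_to_image n (transport_from_image n y)) erefl erefl) => //=.
  by move=> j; rewrite compm1.
- by move=> i x; apply: lax_transport_bdr.
by move=> i x; apply: lax_transport_bdr.
Qed.

Lemma source_to_imageE i x :
  chains_map (sset_id (nerve (cut_out image_cut))) i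
    (functor_chains_map (cat_functor_comp (comma_functor T) I) i x) =
  functor_chains_map (cat_functor_comp (comma_functor (incl_in image_cut)) I) i
    (chains_map transport_to_image i x).
Proof. by rewrite /functor_chains_map -!chains_map_comp; apply: chains_map_ext. Qed.

Lemma target_to_imageE i x :
  chains_map (sset_id (nerve D)) i (cat_chains_map T i x) =
  cat_chains_map (incl_in image_cut) i (cat_chains_map to_image i x).
Proof.
rewrite /cat_chains_map -!chains_map_comp; apply: chains_map_ext => n y.
exact: (@functor_eq _ _ (functor_comp T y)
  (functor_comp (incl_in image_cut) (functor_comp to_image y)) erefl).
Qed.

Lemma comparison_to_imageE i z :
  cut_comparison image_cut i (cone_map source_to_imageE i z) =
  cone_map target_to_imageE i (comparison T I i z).
Proof.
rewrite !cone_mapE; case: z => y x.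
rewrite /= /lax_cone_fun /=; congr (_, _).
  rewrite raddfD; congr (_ + _).
    by rewrite /cat_chains_map -!chains_map_comp; apply: chains_map_ext.
  apply/esym/prism_nat => n w t.
  apply: (@functor_eq _ _ (comparison_homotopy_fun (transport_to_image n w) t)
    (comparison_homotopy_fun w t) erefl) => j k f.
  by apply: mixhom_eq => //; rewrite /comparison_arr /= compm1.
rewrite /cat_chains_map -!chains_map_comp; apply: chains_map_ext => n w.
exact: (@functor_eq _ _ (transport_src _ _ n (transport_to_image n w))
  (functor_comp to_image (transport_src _ _ n w)) erefl).
Qed.

(** Two out of three in the square of [comparison_to_imageE], whose other three sides are
    quasi-isomorphisms. *)
Theorem qis_comparison : qis (comparison T I).
Proof.
pose h := chain_comp (cut_comparison image_cut) (cone_map source_to_imageE).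
apply: (@qis_right _ _ _ _ (cone_map target_to_imageE) h).
- exact: comparison_to_imageE.
- apply: (@qis_comp _ _ _ (cone_map source_to_imageE) (cut_comparison image_cut)) => //.
    exact: qis_lax_cone qis_transport_to_image (qis_sset_id _).
  apply/qis_coneP/contractible_acyclic; exact: cut_complex_contractible.
exact: qis_lax_cone qis_to_image (qis_sset_id _).
Qed.
End Cellular.

(** * Homology classes and tensor products *)

Section HomologyClasses.
Variables (X : complex) (i : int).

Definition hclass (z : cycle X i) : homology X i := (\pi_(Quotient.quot (@boundary X i)) z)%qT.

Lemma hclass_additive : zmod_morphism hclass.
Proof. by move=> x y; rewrite /hclass raddfB. Qed.

HB.instance Definition _ :=
  GRing.isZmodMorphism.Build (cycle X i) (homology X i) hclass hclass_additive.

Lemma kval_cyc (z : cycle X i) : cyc (kval z).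
Proof. by apply/cycP; apply/eqP; exact: kvalP. Qed.

Lemma cyc_kernel (z : X i) : cyc z -> z \in in_kernel (diff X i (i - 1)).
Proof. by move=> cz; rewrite unfold_in cz. Qed.

Lemma hclass_surj (w : homology X i) : exists z, w = hclass z.
Proof. by elim/quotW: w => z; exists z. Qed.

Lemma hclass_eq0 (z : cycle X i) : hclass z = 0 <-> bdr (kval z).
Proof.
rewrite bdrP -(raddf0 hclass); split=> [/eqP|h].
  by rewrite -Quotient.idealrBE subr0 => /asboolP.
by apply/eqP; rewrite -Quotient.idealrBE subr0; apply/asboolP.
Qed.

Lemma hclass_eq (z w : cycle X i) : hclass z = hclass w <-> bdr (kval z - kval w).
Proof.
rewrite -[kval z - kval w]/(kval (z - w)) -hclass_eq0 raddfB.
split=> [e|/eqP]; last by rewrite subr_eq0 => /eqP.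
by apply/eqP; rewrite subr_eq0; apply/eqP.
Qed.
End HomologyClasses.

Section InducedMap.
Variables (X Y : complex) (i j : int) (g : {additive X i -> Y j}).
Hypothesis gc : forall z, cyc z -> cyc (g z).
Hypothesis gb : forall z, bdr z -> bdr (g z).

Definition induced_cycle (z : cycle X i) : cycle Y j :=
  Kernel (cyc_kernel (gc (kval_cyc z))).

Definition induced_class (z : cycle X i) : homology Y j := hclass (induced_cycle z).

Lemma induced_class_additive : zmod_morphism induced_class.
Proof.
move=> x y; rewrite /induced_class -raddfB; congr hclass.
by apply: val_inj; rewrite /= raddfB.
Qed.

HB.instance Definition _ :=
  GRing.isZmodMorphism.Build (cycle X i) (homology Y j) induced_class
    induced_class_additive.

Lemma induced_class0 z : z \in @boundary X i -> induced_class z = 0.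
Proof. by move=> /asboolP bz; apply/hclass_eq0; apply: gb; apply/bdrP. Qed.

(** Unlike [homology_map], this allows a change of degree, as the arrows of the long exact sequence
    require. *)
Definition induced : {additive homology X i -> homology Y j} :=
  quot_lift induced_class0.

Lemma inducedE z : induced (hclass z) = hclass (induced_cycle z).
Proof. exact: quot_liftE. Qed.
End InducedMap.

Lemma homology_mapE (X Y : complex) (f : chain_map X Y) i (z : cycle X i) :
  homology_map f i (hclass z) = hclass (cycle_map f z).
Proof. exact: quot_liftE. Qed.

Lemma inj_surj_bijective (A B : Type) (f : A -> B) :
  injective f -> (forall b, exists a, f a = b) -> bijective f.
Proof.
move=> fi fs; have [g gP] := boolp.choice fs.
by exists g => // a; apply: fi; rewrite gP.
Qed.

Lemma qis_quasi_iso (X Y : complex) (f : chain_map X Y) : qis f -> quasi_iso f.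
Proof.
move=> [fi fs] i; apply: inj_surj_bijective.
  apply: raddf_inj => w; have [z ->] := hclass_surj w.
  by rewrite homology_mapE => /hclass_eq0/(fi _ _ (kval_cyc z))/hclass_eq0.
move=> w; have [y ->] := hclass_surj w.
have [z [cz bz]] := fs _ _ (kval_cyc y).
by exists (hclass (Kernel (cyc_kernel cz))); rewrite homology_mapE; apply/hclass_eq.
Qed.

Lemma additive_factor (U V W : zmodType) (u : {additive U -> W}) (v : {additive V -> W}) :
  bijective v -> exists b : {additive U -> V}, forall x, v (b x) = u x.
Proof.
move=> [g vK gK].
have badd : zmod_morphism (g \o u).
  by move=> x y; apply: (can_inj vK); rewrite /= raddfB [RHS]raddfB !gK.
pose b : {additive U -> V} := HB.pack (g \o u) (GRing.isZmodMorphism.Build _ _ _ badd).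
by exists b => x; rewrite /= gK.
Qed.

Section TensorMaps.
Variable A : zmodType.

Lemma tensor_map_id (M : zmodType) (f : {additive M -> M}) x :
  f =1 id -> tensor_map A f x = x.
Proof.
move=> f1; apply: (@tensor_ext _ _ _ (tensor_map A f) idfun) => m a.
by rewrite tensor_mapE f1.
Qed.

Lemma tensor_map_comp (M N P : zmodType) (g : {additive N -> P}) (f : {additive M -> N}) x :
  tensor_map A (g \o f) x = tensor_map A g (tensor_map A f x).
Proof.
apply: (@tensor_ext _ _ _ (tensor_map A (g \o f)) (tensor_map A g \o tensor_map A f)) => m a.
change (tensor_map A (g \o f) (tens m a) = tensor_map A g (tensor_map A f (tens m a))).
by rewrite !tensor_mapE.
Qed.

Lemma tensor_map_add (M N : zmodType) (f g : {additive M -> N}) x :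
  tensor_map A (f \+ g) x = tensor_map A f x + tensor_map A g x.
Proof.
apply: (@tensor_ext _ _ _ (tensor_map A (f \+ g)) (tensor_map A f \+ tensor_map A g)) => m a.
change (tensor_map A (f \+ g) (tens m a) =
  tensor_map A f (tens m a) + tensor_map A g (tens m a)).
by rewrite !tensor_mapE tensDl.
Qed.

Lemma tensor_contractible (X : complex) :
  contractible X -> contractible (tensor_complex X A).
Proof.
move=> [s sP]; exists (fun i j => tensor_map A (s i j)) => i j k x ji ik.
pose F : {additive X i -> X i} := (diff X j i \o s i j) \+ (s k i \o diff X i k).
rewrite -[LHS](@tensor_map_id _ F); last by move=> y; rewrite /= -sP.
by rewrite tensor_map_add !tensor_map_comp.
Qed.

Section TensorCone.
Variables (X Y : complex) (f : chain_map X Y).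

Let fA := tensor_chain_map f A.

(** The tensor product distributes over the pairs of a cone only up to isomorphism, which has to be
    made a chain map. *)
Definition tensor_cone_fun i (z : tensor_complex (cone f) A i) : cone fA i :=
  (tensor_map A (fst : (Y i * X (i - 1))%type -> Y i) z,
   tensor_map A (snd : (Y i * X (i - 1))%type -> X (i - 1)) z).

Lemma tensor_cone_additive i : zmod_morphism (@tensor_cone_fun i).
Proof. by move=> x y; rewrite /tensor_cone_fun !raddfB. Qed.

HB.instance Definition _ i :=
  GRing.isZmodMorphism.Build (tensor_complex (cone f) A i) (cone fA i)
    (@tensor_cone_fun i) (@tensor_cone_additive i).

Lemma tens_cast i j (y : Y i) (a : A) :
  degree_cast (D := tensor_complex Y A) j (tens y a) = tens (degree_cast j y) a.
Proof.
by rewrite /degree_cast; case: eqP => [e|_]; [case: _ / e | rewrite tens0l].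
Qed.

Lemma tensNl (M : zmodType) (m : M) (a : A) : tens (- m) a = - tens m a.
Proof. by apply: (addrI (tens m a)); rewrite -tensDl !subrr tens0l. Qed.

Lemma tensor_cone_proof i j z :
  tensor_cone_fun (diff (tensor_complex (cone f) A) i j z) =
  diff (cone fA) i j (tensor_cone_fun z).
Proof.
pose F k : {additive tensor_complex (cone f) A k -> cone fA k} := @tensor_cone_fun k.
apply: (@tensor_ext _ _ _ (F j \o diff (tensor_complex (cone f) A) i j)
  (diff (cone fA) i j \o F i)) => -[y x] a.
change (tensor_cone_fun (tensor_map A (diff (cone f) i j) (tens (y, x) a)) =
  cone_diff fA j (tensor_cone_fun (tens (y, x) a))).
rewrite /tensor_cone_fun tensor_mapE !tensor_mapE /cone_diff.
rewrite ![fst _]/= ![snd _]/=.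
change ((tens (diff Y i j y + degree_cast j (f (i - 1) x)) a,
    tens (- diff X (i - 1) (j - 1) x) a) =
  (tensor_map A (diff Y i j) (tens y a) +
     degree_cast (D := tensor_complex Y A) j (tensor_map A (f (i - 1)) (tens x a)),
   - tensor_map A (diff X (i - 1) (j - 1)) (tens x a))).
by rewrite tensDl tensNl !tensor_mapE tens_cast.
Qed.

Definition tensor_cone : chain_map (tensor_complex (cone f) A) (cone fA) :=
  @ChainMap (tensor_complex (cone f) A) (cone fA)
    (fun i => @tensor_cone_fun i) tensor_cone_proof.

Lemma qis_tensor_cone : qis tensor_cone.
Proof.
apply: qis_bij => i.
pose G (z : cone fA i) : tensor_complex (cone f) A i :=
  tensor_map A (@pair_inl (Y i) (X (i - 1))) z.1 +
  tensor_map A (@pair_inr (Y i) (X (i - 1))) z.2.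
pose p1 : {additive (Y i * X (i - 1))%type -> Y i} := fst.
pose p2 : {additive (Y i * X (i - 1))%type -> X (i - 1)} := snd.
pose i1 : {additive Y i -> (Y i * X (i - 1))%type} := @pair_inl (Y i) (X (i - 1)).
pose i2 : {additive X (i - 1) -> (Y i * X (i - 1))%type} := @pair_inr (Y i) (X (i - 1)).
exists G => [z|[u v]].
  change (tensor_map A i1 (tensor_map A p1 z) + tensor_map A i2 (tensor_map A p2 z) = z).
  rewrite -!tensor_map_comp -tensor_map_add tensor_map_id // => -[y x].
  by congr (_, _); rewrite /= ?addr0 ?add0r.
change ((tensor_map A p1 (tensor_map A i1 u + tensor_map A i2 v),
  tensor_map A p2 (tensor_map A i1 u + tensor_map A i2 v)) = (u, v)).
rewrite !raddfD -!tensor_map_comp.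
congr (_, _).
  rewrite (@tensor_map_id _ (p1 \o i1)) // -[RHS]addr0; congr (_ + _).
  by apply: (@tensor_ext _ _ _ (tensor_map A _) \0) => m a; rewrite tensor_mapE /= tens0l.
rewrite (@tensor_map_id _ (p2 \o i2)) // -[RHS]add0r; congr (_ + _).
by apply: (@tensor_ext _ _ _ (tensor_map A _) \0) => m a; rewrite tensor_mapE /= tens0l.
Qed.
End TensorCone.

(** Through [tensor_cone], cycles of the cone of the tensored map come from [cone f] tensored with
    [A], which inherits the contraction. *)
Lemma qis_tensor (X Y : complex) (f : chain_map X Y) :
  contractible (cone f) -> qis (tensor_chain_map f A).
Proof.
move=> cf; apply/qis_coneP => i z cz.
have [ti ts] := qis_tensor_cone f.
have [w [cw bw]] := ts _ _ cz.
rewrite -[z](subKr (tensor_cone f i w)); apply: bdrB => //.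
apply: bdr_map; apply: contractible_acyclic cw; exact: tensor_contractible.
Qed.
End TensorMaps.

(** * The long exact sequence *)

(* The acyclic models theorem over the one-object category, in which every
   object is a model: bounded below acyclic complexes of free abelian groups
   are contractible. *)
Section FreeAcyclic.

Let Mor (_ _ : unit) := unit.
Let cmp (_ _ _ : unit) (_ _ : unit) : unit := tt.

Definition id_chain_map (X : complex) : chain_map X X :=
  @ChainMap X X (fun i => idfun) (fun _ _ _ => erefl).

Let const_degree (X : complex) i : abfun cmp :=
  @degree_abfun unit Mor cmp (fun _ => X) (fun _ _ _ => id_chain_map X)
    (fun _ _ _ _ _ _ _ => erefl) i.

Lemma chains_unit_projective (S : sset) i :
  projective (fun _ => True) (const_degree (chains S) i).
Proof.
pose L := @free_abfun unit Mor cmp (fun _ => simplexz S i) (fun _ _ _ x => x)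
  (fun _ _ _ _ _ _ => erefl).
have PL : projective (fun _ => True) L.
  apply: (@projective_free _ _ _ _ _ _ _ (simplexz S i) (fun _ => tt) (fun x => x)
    (fun _ x => existT _ x tt)) => //.
have afmL a b (f : Mor a b) x : afm L f x = x.
  apply: (@free_group_ext _ _ (afm L f) idfun) => y; exact: free_lift_gen.
apply: (@projective_retract _ _ _ _ _ L
  (@NatTr _ _ cmp (const_degree (chains S) i) L (fun _ => idfun)
    (fun a b f x => esym (afmL a b f x)))
  (@NatTr _ _ cmp L (const_degree (chains S) i) (fun _ => idfun) afmL)) => //.
Qed.

Lemma cone_unit_projective (X Y : complex) (f : chain_map X Y) i :
  projective (fun _ => True) (const_degree Y i) ->
  projective (fun _ => True) (const_degree X (i - 1)) ->
  projective (fun _ => True) (const_degree (cone f) i).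
Proof.
move=> PY PX; have P := projective_prod PY PX.
by apply: (@projective_retract _ _ _ _ _ _
  (@NatTr _ _ cmp (const_degree (cone f) i) (prod_abfun (const_degree Y i) (const_degree X (i - 1)))
    (fun _ => idfun) (fun a b _ x => surjective_pairing x))
  (@NatTr _ _ cmp (prod_abfun (const_degree Y i) (const_degree X (i - 1))) (const_degree (cone f) i)
    (fun _ => idfun) (fun a b _ x => esym (surjective_pairing x))) _ P).
Qed.

Lemma cone_cone_contractible (S1 S2 S3 S4 : sset) (f : sset_map S1 S2) (g : sset_map S3 S4)
    (h : chain_map (cone (chains_map f)) (cone (chains_map g))) :
  acyclic (cone h) -> contractible (cone h).
Proof.
move=> ah; apply: (@acyclic_models unit Mor cmp (fun _ => True) (fun _ => cone h)
  (fun _ _ _ => id_chain_map (cone h)) (fun _ _ _ _ _ _ _ => erefl) _ _ _ tt) => //.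
  by move=> i; do 2 (apply: cone_unit_projective); exact: chains_unit_projective.
move=> _ n [[y c] [z w]].
rewrite [y](@chains_neg _ (Negz n)) // [c](@chains_neg _ (Negz n - 1)) //.
by rewrite [z](@chains_neg _ (Negz n - 1)) // [w](@chains_neg _ (Negz n - 1 - 1)) //; lia.
Qed.
End FreeAcyclic.

Lemma cellular_contractible (C D : category) (T : functor C D) (hT : cellular T) :
  contractible (cone (comparison T (incl_out (image_cut hT)))).
Proof.
by apply: cone_cone_contractible; apply/qis_coneP; exact: qis_comparison.
Qed.

Section ConeSequence.
Variables (X Y E : complex) (f : chain_map X Y) (h : chain_map E (cone f)).
Variable A : zmodType.
Hypothesis hh : contractible (cone h).

Let XA := tensor_complex X A.
Let YA := tensor_complex Y A.
Let EA := tensor_complex E A.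
Let fA := tensor_chain_map f A.
Let RA := tensor_complex (shift (-1) E) A.

Let hA : chain_map EA (cone fA) := chain_comp (tensor_cone A f) (tensor_chain_map h A).

Lemma qis_hA : qis hA.
Proof.
apply: (@qis_comp _ _ _ (tensor_chain_map h A) (tensor_cone A f)) => //.
  exact: qis_tensor.
exact: qis_tensor_cone.
Qed.

(** Up to reindexing the groups of [RA] and [EA] are convertible and the differentials differ by a
    sign, so cycles and boundaries are the same. *)
Lemma shift_tensor_diff i j (z : RA i) :
  diff RA i j z = - (diff EA (i - -1) (j - -1) (z : EA (i - -1))).
Proof.
pose d : {additive RA i -> RA j} := diff EA (i - -1) (j - -1).
apply: (@tensor_ext _ _ _ (diff RA i j) (-%R \o d : {additive RA i -> RA j})) => m a.
change (tensor_map A (diff (shift (-1) E) i j) (tens m a) =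
  - (tensor_map A (diff E (i - -1) (j - -1)) (tens (m : E (i - -1)) a))).
by rewrite !tensor_mapE /= /shift_diff expr1 mulrN1z tensNl.
Qed.

Lemma shift_cyc i (z : RA i) : cyc z <-> cyc (z : EA (i - -1)).
Proof.
split=> cz j; last by rewrite shift_tensor_diff cz oppr0.
have -> : j = (j - 1) - -1 by rewrite opprK subrK.
by apply/eqP; rewrite -oppr_eq0 -shift_tensor_diff cz.
Qed.

Lemma shift_bdr i (z : RA i) : bdr z <-> bdr (z : EA (i - -1)).
Proof.
split=> -[j [x dx]].
  exists (j - -1), (- x : EA (j - -1)).
  by apply: etrans (raddfN (diff EA (j - -1) (i - -1)) x) _; rewrite -dx shift_tensor_diff.
have ej : j = (j - 1) - -1 by rewrite opprK subrK.
move: x dx; rewrite ej => x dx; exists (j - 1), (- x : EA (j - 1 - -1)).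
apply: etrans (raddfN (diff RA (j - 1) i) (x : RA (j - 1))) _.
by rewrite shift_tensor_diff opprK.
Qed.

Lemma cone_cast i j (q : cone fA i) :
  i = j -> (degree_cast j q).2 = degree_cast (j - 1) q.2.
Proof. by move=> e; subst j; rewrite !degree_cast_id. Qed.

(** The degree [j] is free because degree [i - 1] of [RA] must reach degree [i] of the cone, and
    [i - 1 - -1] is not convertible to [i]. *)
Definition seq_target j i : {additive RA i -> cone fA j} :=
  (@degree_cast (cone fA) (i - -1) j \o hA (i - -1) : {additive EA (i - -1) -> cone fA j}).

Definition seq_source i : {additive RA i -> XA i} :=
  (@degree_cast XA (i - -1 - 1) i \o snd \o hA (i - -1) :
    {additive EA (i - -1) -> XA i}).

Lemma seq_target_cyc j i (z : RA i) : cyc z -> cyc (seq_target j i z).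
Proof. by move=> /shift_cyc cz; apply/cyc_cast/cyc_map. Qed.

Lemma seq_target_bdr j i (z : RA i) : bdr z -> bdr (seq_target j i z).
Proof. by move=> /shift_bdr bz; apply/bdr_cast/bdr_map. Qed.

Lemma cone_snd_bdr i (q : cone fA i) : bdr q -> bdr q.2.
Proof.
case: q => y x /cone_bdrP[y' [x' [_ <-]]]; exact/bdrN/bdr_diff.
Qed.

Lemma cone_snd_cyc i (q : cone fA i) : cyc q -> cyc q.2.
Proof. by case: q => y x /cone_cycP[]. Qed.

Lemma seq_source_cyc i (z : RA i) : cyc z -> cyc (seq_source i z).
Proof. by move=> /shift_cyc cz; apply/cyc_cast/cone_snd_cyc/cyc_map. Qed.

Lemma seq_source_bdr i (z : RA i) : bdr z -> bdr (seq_source i z).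
Proof. by move=> /shift_bdr bz; apply/bdr_cast/cone_snd_bdr/bdr_map. Qed.

Definition seq_incl i : {additive YA i -> cone fA i} := @pair_inl (YA i) (XA (i - 1)).

Lemma seq_incl_cyc i (y : YA i) : cyc y -> cyc (seq_incl i y).
Proof.
move=> cy; apply/cone_cycP; split; last exact: cyc0.
by rewrite cy raddf0 addr0.
Qed.

Lemma seq_incl_bdr i (y : YA i) : bdr y -> bdr (seq_incl i y).
Proof.
move=> /bdrP[y' dy]; apply/cone_bdrP; exists y', 0.
by split; rewrite !raddf0 ?addr0 ?oppr0.
Qed.

Let Ha i := induced (@seq_source_cyc i) (@seq_source_bdr i).
Let Hv j i := induced (@seq_target_cyc j i) (@seq_target_bdr j i).
Let Hu i := induced (@seq_incl_cyc i) (@seq_incl_bdr i).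

Lemma Hv_bijective i : bijective (Hv i (i - 1)).
Proof.
have [hi hs] := qis_hA; have ei : i - 1 - -1 = i by rewrite opprK subrK.
apply: inj_surj_bijective.
  apply: raddf_inj => w; have [z ->] := hclass_surj w.
  rewrite inducedE => /hclass_eq0 bz; apply/hclass_eq0/shift_bdr.
  apply: hi; first by apply/shift_cyc; apply: kval_cyc.
  by rewrite -[hA _ _](degree_castK _ ei); apply: bdr_cast.
move=> w; have [q ->] := hclass_surj w.
have cq : cyc (degree_cast (i - 1 - -1) (kval q)) by apply/cyc_cast/kval_cyc.
have [e [ce be]] := hs _ _ cq.
have ce' : cyc (e : RA (i - 1)) by apply/shift_cyc.
exists (hclass (Kernel (cyc_kernel ce'))); rewrite inducedE; apply/hclass_eq => /=.
have := bdr_cast i be; rewrite degree_castB (degree_castK _ (esym ei)); exact.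
Qed.

(** With [Hv] identifying the homology of [RA] with that of the cone, [a] is the projection to the
    second component, and [b] is the inclusion of the first followed by the inverse of [Hv]. *)
Theorem cone_sequence :
  exists (a : forall i, {additive homology RA i -> homology XA i})
         (b : forall i, {additive homology YA i -> homology RA (i - 1)}),
  forall i, [/\ exact (a i) (homology_map fA i),
    exact (homology_map fA i) (b i) & exact (b i) (a (i - 1))].
Proof.
pose b i := sval (cid (additive_factor (Hu i) (Hv_bijective i))).
have bE i y : Hv i (i - 1) (b i y) = Hu i y.
  by rewrite /b; case: cid.
exists Ha, b => i.
have [hi hs] := qis_hA.
split=> w.
- have [z ->] := hclass_surj w; rewrite homology_mapE; split.
    move=> /hclass_eq0 bfz0; have bfz : bdr (fA i (kval z)) := bfz0.
    have ek : i - -1 = i + 1 by rewrite opprK.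
    have ek' : i = i - -1 - 1 by rewrite opprK addrK.
    have [y' dy'] := bdr_at bfz ek.
    (* As [y'] has boundary the image of the cycle, this pair is a cycle of the cone lying over
       it. *)
    have cq : cyc ((- y', degree_cast (i - -1 - 1) (kval z)) : cone fA (i - -1)).
      apply/cone_cycP; split; last exact/cyc_cast/kval_cyc.
      rewrite degree_cast_map raddfN -dy'.
      by rewrite (@degree_castC _ (i - -1) (i - -1)) // degree_cast_id addNr.
    have [e [ce be]] := hs _ _ cq.
    have ce' : cyc (e : RA i) by apply/shift_cyc.
    exists (hclass (Kernel (cyc_kernel ce'))); rewrite inducedE; apply/hclass_eq => /=.
    have := bdr_cast i (cone_snd_bdr be).
    by rewrite degree_castB (degree_castK _ ek').
  case=> r; have [e ->] := hclass_surj r.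
  rewrite inducedE => /hclass_eq be; apply/hclass_eq0.
  change (bdr (fA i (kval z))).
  pose q : cone fA (i - -1) := hA (i - -1) (kval e).
  have cq : cyc q by apply/cyc_map/shift_cyc/kval_cyc.
  have /cone_cycP[dq _] : cyc ((q.1, q.2) : cone fA (i - -1)).
    by rewrite -surjective_pairing.
  have bq : bdr (fA (i - -1 - 1) q.2).
    by rewrite -(addr0_eq dq); apply/bdrN/bdr_diff.
  rewrite -[kval z](subKr (degree_cast i q.2)) raddfB degree_cast_map.
  by apply: bdrB; [apply: bdr_cast | apply: bdr_map].
- have [y ->] := hclass_surj w; split.
    move=> by0; have := bE i (hclass y); rewrite by0 raddf0 inducedE => /esym.
    move=> /hclass_eq0/cone_bdrP[y' [x' [dy dx]]].
    have cx : cyc x' by apply/cycP; apply/eqP; rewrite -oppr_eq0 dx.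
    exists (hclass (Kernel (cyc_kernel cx))); rewrite homology_mapE.
    apply/hclass_eq; change (bdr (fA i x' - kval y)); rewrite -dy opprD addrCA subrr addr0.
    exact/bdrN/bdr_diff.
  case=> v; have [x ->] := hclass_surj v; rewrite homology_mapE => /hclass_eq bfx0.
  have bfx : bdr (fA i (kval x) - kval y) := bfx0.
  (* Values of [b] are known only after [Hv], which is injective. *)
  apply: (bij_inj (Hv_bijective i)); rewrite bE raddf0 inducedE; apply/hclass_eq0.
  have /bdrP[u du] := bfx; apply/cone_bdrP; exists (- u), (kval x); split.
    by rewrite raddfN du opprB subrK.
  by apply/eqP; rewrite oppr_eq0; apply/eqP/(kval_cyc x).
have [e ->] := hclass_surj w.
have ei : i - 1 - -1 = i by rewrite opprK subrK.
have cq : cyc (seq_target i (i - 1) (kval e)) by apply/seq_target_cyc/kval_cyc.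
have q2 : (seq_target i (i - 1) (kval e)).2 = seq_source (i - 1) (kval e) by exact: cone_cast.
split.
  rewrite inducedE => /hclass_eq0 b0.
  have : bdr (seq_source (i - 1) (kval e)) := b0; rewrite -q2 => /bdr_at b2.
  have [x dx] := b2 i (esym (subrK _ _)).
  move: cq q2; set q := seq_target _ _ _ => cq q2.
  have /cone_cycP[dq _] : cyc ((q.1, q.2) : cone fA i) by rewrite -surjective_pairing.
  (* Adding the boundary of [(0, x)] to [q] cancels its second component and leaves this cycle in
     the first. *)
  have cy : cyc (q.1 + fA i x) by apply/cycP; rewrite raddfD -cmapP dx.
  exists (hclass (Kernel (cyc_kernel cy))).
  apply: (bij_inj (Hv_bijective i)); rewrite bE !inducedE; apply/hclass_eq.
  change (bdr (((q.1 + fA i x, 0) : cone fA i) - q)); have -> :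
      ((q.1 + fA i x, 0) : cone fA i) - q = (fA i x, - q.2).
    by case: (q) => u v; congr (_, _);
      [change (u + fA i x - u = fA i x); zmod | exact: sub0r].
  apply/cone_bdrP; exists 0, x.
  by split; [rewrite raddf0 add0r | rewrite dx].
case=> y ey; have := bE i y; rewrite ey; have [y0 ->] := hclass_surj y.
rewrite !inducedE => /hclass_eq/cone_snd_bdr bq.
apply/hclass_eq0; change (bdr (seq_source (i - 1) (kval e))); rewrite -q2.
by rewrite -[X in bdr X]subr0.
Qed.
End ConeSequence.

(** * Tensoring with the integers, and undoing the two shifts *)

Section TensorInt.
Variable M : zmodType.

Definition tens_int (m : M) : tensor M int := tens m (1 : int).

Lemma tens_int_additive : zmod_morphism tens_int.
Proof. by move=> x y; rewrite /tens_int tensDl tensNl. Qed.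

HB.instance Definition _ :=
  GRing.isZmodMorphism.Build M (tensor M int) tens_int tens_int_additive.

Definition int_action_gen (p : M * int) : M := p.1 *~ p.2.

Lemma int_action_subproof x : x \in @bilinear M int -> free_lift int_action_gen x = 0.
Proof.
move=> /asboolP; elim=> {x} [m m' a|m a a'||x y _ ex _ ey].
- by rewrite !raddfB /= !free_lift_gen /int_action_gen /= mulrzDl; zmod.
- by rewrite !raddfB /= !free_lift_gen /int_action_gen /= mulrzDr; zmod.
- exact: raddf0.
- by rewrite raddfB /= ex ey subr0.
Qed.

Definition int_action : {additive tensor M int -> M} := quot_lift int_action_subproof.

Lemma int_actionE m n : int_action (tens m n) = m *~ n.
Proof.
exact: etrans (quot_liftE int_action_subproof _) (free_lift_gen _ _).
Qed.

Lemma tens0r (A : zmodType) (m : M) : tens m (0 : A) = 0.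
Proof. by apply: (addrI (tens m 0)); rewrite -tensDr !addr0. Qed.

Lemma tensr_additive (A : zmodType) (m : M) : zmod_morphism (fun a : A => tens m a).
Proof.
have tensNr (a : A) : tens m (- a) = - tens m a.
  by apply: (addrI (tens m a)); rewrite -tensDr !subrr tens0r.
by move=> a b; rewrite tensDr tensNr.
Qed.

(** Both sides are additive in the integer and agree at 1. *)
Lemma tens_mulz (m : M) (n : int) : tens (m *~ n) (1 : int) = tens m n.
Proof.
pose F : {additive int -> tensor M int} :=
  HB.pack (fun a : int => tens m a) (GRing.isZmodMorphism.Build _ _ _ (@tensr_additive int m)).
rewrite -[LHS]/(tens_int (m *~ n)) raddfMz -[n in RHS]intz.
by rewrite -[RHS]/(F (n%:~R)) raddfMz.
Qed.

Lemma tens_int_bijective : bijective tens_int.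
Proof.
exists int_action => [m|x]; first by rewrite /tens_int int_actionE mulr1z.
apply: (@tensor_ext _ _ _ (tens_int \o int_action) idfun) => m n.
change (tens_int (int_action (tens m n)) = tens m n).
by rewrite int_actionE; exact: tens_mulz.
Qed.
End TensorInt.

Section ShiftTensor.
Variable E : complex.

Let R := shift 1 (tensor_complex (shift (-1) E) int).

Definition shift_tensor_fun i : {additive E i -> R i} :=
  (@tens_int (E (i - 1 - -1)) \o @degree_cast E i (i - 1 - -1) :
    {additive E i -> tensor (E (i - 1 - -1)) int}).

Lemma degree_cast_diff i j i' j' (x : E i) : i = i' -> j = j' ->
  degree_cast j' (diff E i j x) = diff E i' j' (degree_cast i' x).
Proof. by move=> e e'; subst i' j'; rewrite !degree_cast_id. Qed.

(** Each of the two shifts changes the sign of the differential, and the signs cancel. *)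
Lemma shift_tensor_proof i j x :
  shift_tensor_fun j (diff E i j x) = diff R i j (shift_tensor_fun i x).
Proof.
have e (k : int) : k = k - 1 - -1 by rewrite opprK subrK.
have -> : diff R i j (shift_tensor_fun i x) =
    - diff (tensor_complex (shift (-1) E) int) (i - 1) (j - 1) (shift_tensor_fun i x).
  by rewrite /= /shift_diff expr1 mulrN1z.
rewrite shift_tensor_diff opprK.
change (tens (degree_cast (j - 1 - -1) (diff E i j x)) (1 : int) =
  tensor_map int (diff E (i - 1 - -1) (j - 1 - -1)) (tens (degree_cast (i - 1 - -1) x) (1 : int))).
by rewrite tensor_mapE (degree_cast_diff _ (e i) (e j)).
Qed.

Definition shift_tensor : chain_map E R := ChainMap shift_tensor_proof.

Lemma qis_shift_tensor : qis shift_tensor.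
Proof.
apply: qis_bij => i; have e : i = i - 1 - -1 by rewrite opprK subrK.
have [g tK gK] := @tens_int_bijective (E (i - 1 - -1)).
exists (fun t => degree_cast i (g t)) => [x|t] /=.
  by rewrite tK degree_castK.
by rewrite degree_castK // gK.
Qed.
End ShiftTensor.

Theorem corollary2p3p7 (C D : category) (T : functor C D) (hT : cellular T) :
  quasi_isomorphic (cone (cat_chains_map T))
    (shift 1 (reduced_chains (comma_functor_compl T) int))
  /\
  forall A : zmodType,
  exists (a : forall i : int,
            {additive reduced_homology (comma_functor_compl T) A i ->
                      cat_homology C A i})
         (b : forall i : int,
            {additive cat_homology D A i ->
                      reduced_homology (comma_functor_compl T) A (i - 1)}),
  forall i : int,
    [/\ exact (a i) (cat_homology_map T A i),
        exact (cat_homology_map T A i) (b i) &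
        exact (b i) (a (i - 1))].
Proof.
split; last by move=> A; exact: cone_sequence (cellular_contractible hT).
(* The middle of the zigzag maps to the cone of [C_*(T)] by [comparison], and to the other side by
   [shift_tensor]. By conversion, [complement T] is the outside of [image_cut]. *)
apply: (@rst_trans _ _ _ (cone (functor_chains_map (comma_functor_compl T)))).
  apply: rst_sym; apply: rst_step.
  by exists (comparison T (incl_out (image_cut hT))); apply/qis_quasi_iso/qis_comparison.
by apply: rst_step; exists (shift_tensor _); apply/qis_quasi_iso/qis_shift_tensor.
Qed.
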